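(* Let $(b,0)$ be a connected weighted graph over $V$ and let $e^{-tL^{(D)}}$ be the semigroup associated with the regular Dirichlet form $Q^{(D)}$ of $(b,0)$ on $\ell^2(V,1)$ (that is, with the measure $m\equiv 1$). For any $x,y\in V$ the equality $$G(x,y)=\int_0^\infty e^{-tL^{(D)}}\delta_x(y)\,dt=\frac{1}{\deg(y)}\sum_{n=0}^\infty P^{(n)}(x,y)$$ holds (as an equality in $[0,\infty]$).
   Context: $V$ is an infinite countable set. A weighted graph $(b,c)$ over $V$ consists of $b:V\times V\to[0,\infty)$ with $b(x,x)=0$, $b(x,y)=b(y,x)$ and $\sum_{y\in V}b(x,y)<\infty$ for all $x,y\in V$, and $c:V\to[0,\infty)$; $(b,0)$ means $c\equiv 0$. Write $x\sim y$ if $b(x,y)>0$. The graph is connected if any two vertices $x,y$ are joined by a finite sequence $x=x_0\sim x_1\sim\dots\sim x_n=y$. $\deg(x)=\sum_{y\in V}b(x,y)+c(x)$. $C_c(V)$ is the set of finitely supported real functions on $V$; $\delta_x$ is the function equal to $1$ at $x$ and $0$ elsewhere. For $u:V\to\mathbb{R}$ let $\widetilde Q(u)=\frac12\sum_{x,y\in V}b(x,y)(u(x)-u(y))^2+\sum_{x\in V}c(x)u(x)^2\in[0,\infty]$, $\widetilde D=\{u:V\to\mathbb{R}:\widetilde Q(u)<\infty\}$, and extend $\widetilde Q$ to a bilinear form on $\widetilde D$ by $\widetilde Q(u,v)=\frac12\sum_{x,y}b(x,y)(u(x)-u(y))(v(x)-v(y))+\sum_x c(x)u(x)v(x)$. For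 $m:V\to(0,\infty)$, $\ell^2(V,m)$ has inner product $\langle f,g\rangle=\sum_x f(x)g(x)m(x)$ and norm $\|\cdot\|_2$. The regular Dirichlet form $Q^{(D)}$ associated with the graph on $\ell^2(V,m)$ is the restriction of $\widetilde Q$ to the closure $D(Q^{(D)})$ of $C_c(V)$ in $\widetilde D\cap\ell^2(V,m)$ with respect to the norm $\|u\|_Q=(\widetilde Q(u)+\|u\|_2^2)^{1/2}$. $L^{(D)}$ is the associated nonnegative self-adjoint operator: $D(L^{(D)})=\{u\in D(Q^{(D)}):\exists w\in\ell^2(V,m)\ \forall v\in D(Q^{(D)}):Q^{(D)}(u,v)=\langle w,v\rangle\}$, $L^{(D)}u=w$. The semigroup $e^{-tL^{(D)}}$ is defined by spectral calculus. $G(x,y)=\int_0^\infty e^{-tL^{(D)}}\delta_x(y)\,dt\in[0,\infty]$ is the Green's function of $Q^{(D)}$. $P$ is the infinite matrix with entries $P(x,y)=b(x,y)/\deg(x)$ (the transition matrix of the random walk associated with $(b,0)$), and $P^{(n)}$ denotes its $n$-th power. *)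

(* Defs.v *)
(* MathComp-Analysis, over an arbitrary R : realType. *)
From HB Require Import structures.
From mathcomp Require Export all_boot all_order all_algebra.
From mathcomp Require Export all_classical all_reals all_analysis.

Set Implicit Arguments.
Unset Strict Implicit.
Unset Printing Implicit Defensive.

Import Order.TTheory GRing.Theory Num.Theory.
Import numFieldNormedType.Exports.

Local Open Scope classical_set_scope.
Local Open Scope ring_scope.

(* Sum of an absolutely summable real family, as the difference of the sums of
   its positive and negative parts. *)
Definition rsum (R : realType) (I : choiceType) (f : I -> R) : R :=
  fine (\esum_(i in [set: I]) (Num.max (f i) 0)%:E)
  - fine (\esum_(i in [set: I]) (Num.max (- f i) 0)%:E).

Section Graph.
Variables (R : realType) (V : countType).
Implicit Types (b : V -> V -> R) (c m u v f g w : V -> R) (x y : V).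

Record weighted_graph b c : Prop := {
  graph_b_ge0 : forall x y, 0 <= b x y;
  graph_b_diag : forall x, b x x = 0;
  graph_b_sym : forall x y, b x y = b y x;
  graph_b_sum : forall x, (\esum_(y in [set: V]) (b x y)%:E < +oo)%E;
  graph_c_ge0 : forall x, 0 <= c x }.

Definition adjacent b : rel V := fun x y => 0 < b x y.

Definition graph_connected b : Prop :=
  forall x y, exists2 p : seq V, path (adjacent b) x p & y = last x p.

Definition degree b c x : R := fine (\esum_(y in [set: V]) (b x y)%:E) + c x.

Definition delta x : V -> R := fun y => (y == x)%:R.

Definition finitely_supported u : Prop := finite_set [set x | u x != 0].

(* The form Q~ on the diagonal, with values in [0, +oo]. *)
Definition energy b c u : \bar R :=
  (((2^-1)%:E
      * (\esum_(p in [set: V * V]) (b p.1 p.2 * (u p.1 - u p.2) ^+ 2)%:E))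
   + (\esum_(x in [set: V]) (c x * u x ^+ 2)%:E))%E.

Definition finite_energy b c u : Prop := (energy b c u < +oo)%E.

(* The bilinear extension of Q~ to functions of finite energy. *)
Definition energy_form b c u v : R :=
  2^-1 * rsum (fun p : V * V =>
                 b p.1 p.2 * (u p.1 - u p.2) * (v p.1 - v p.2))
  + rsum (fun x => c x * u x * v x).

Definition l2normsq m f : \bar R := (\esum_(x in [set: V]) (f x ^+ 2 * m x)%:E)%E.

Definition l2norm m f : \bar R := sqrte (l2normsq m f).

Definition in_l2 m f : Prop := (l2normsq m f < +oo)%E.

Definition inner m f g : R := rsum (fun x => f x * g x * m x).

Definition form_norm b c m u : \bar R :=
  sqrte (energy b c u + l2normsq m u)%E.

(* D(Q^(D)): the closure of C_c(V) in D~ /\ l^2(V, m) for the form norm. *)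
Definition dirichlet_domain b c m u : Prop :=
  [/\ finite_energy b c u, in_l2 m u &
      forall e : R, 0 < e ->
        exists2 phi : V -> R, finitely_supported phi &
          (form_norm b c m (u \- phi)%R < e%:E)%E].

(* The graph of the operator L^(D): "u is in D(L^(D)) and L^(D) u = w". *)
Definition dirichlet_operator b c m u w : Prop :=
  [/\ dirichlet_domain b c m u, in_l2 m w &
      forall v, dirichlet_domain b c m v -> energy_form b c u v = inner m w v].

(* Projection-valued measures on the Borel sets of the real line, with values in
   the orthogonal projections of l^2(V, m). Only the values E B f with B Borel
   and f in l^2(V, m) are meaningful. *)
Record projection_valued_measure m (E : set R -> (V -> R) -> V -> R) : Prop := {
  pvm_l2 : forall B f, measurable B -> in_l2 m f -> in_l2 m (E B f);
  pvm_linear : forall B (a : R) f g, measurable B -> in_l2 m f -> in_l2 m g ->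
    E B (fun x => a * f x + g x) = (fun x => a * E B f x + E B g x);
  pvm_symmetric : forall B f g, measurable B -> in_l2 m f -> in_l2 m g ->
    inner m (E B f) g = inner m f (E B g);
  pvm_idempotent : forall B f, measurable B -> in_l2 m f ->
    E B (E B f) = E B f;
  pvm_set0 : forall f, in_l2 m f -> E set0 f = (fun=> 0);
  pvm_setT : forall f, in_l2 m f -> E setT f = f;
  pvm_setI : forall A B f, measurable A -> measurable B -> in_l2 m f ->
    E (A `&` B) f = E A (E B f);
  pvm_sigma_additive : forall (B : nat -> set R) f,
    (forall k, measurable (B k)) -> trivIset setT B -> in_l2 m f ->
    l2norm m (fun x => E (\bigcup_k B k) f x - \sum_(k < n) E (B k) f x)
      @[n --> \oo] --> 0%E }.

Section SpectralCalculus.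
Variables (m : V -> R) (E : set R -> (V -> R) -> V -> R).

(* The finite Borel measure B |-> <E(B) f, f>. *)
Definition spectral_distribution f : set R -> \bar R :=
  fun B => (inner m (E B f) f)%:E.

(* The domain of the operator psi(A) = \int psi dE. *)
Definition spectral_domain (psi : R -> R) f : Prop :=
  in_l2 m f /\ (\int[spectral_distribution f]_s (psi s ^+ 2)%:E < +oo)%E.

(* \int psi(s) d<E(s) f, g>, by polarization of the measures <E(.) h, h>; the
   integrals are finite for f and g in spectral_domain psi. *)
Definition spectral_pairing (psi : R -> R) f g : R :=
  4^-1 * (fine (\int[spectral_distribution (f \+ g)%R]_s (psi s)%:E)
          - fine (\int[spectral_distribution (f \- g)%R]_s (psi s)%:E)).

(* "f is in the domain of \int psi dE and (\int psi dE) f = w". It is enough to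
   test against the g in the domain, since the domain is dense. *)
Definition spectral_integral (psi : R -> R) f w : Prop :=
  [/\ spectral_domain psi f, in_l2 m w &
      forall g, spectral_domain psi g -> inner m w g = spectral_pairing psi f g].

(* psi(A) f, and 0 if f is not in the domain of psi(A). *)
Definition spectral_calculus (psi : R -> R) f : V -> R :=
  xget (fun=> 0) [set w | spectral_integral psi f w].

End SpectralCalculus.

(* E is the spectral measure of the self-adjoint operator on l^2(V, m) whose
   graph is A, that is, A = \int s dE(s), domains included. *)
Definition spectral_measure_of m E (A : (V -> R) -> (V -> R) -> Prop) : Prop :=
  projection_valued_measure m E /\
  forall f w, A f w <-> spectral_integral m E idfun f w.

(* e^{-tA}, for A with spectral measure E. *)
Definition semigroup m E (t : R) f : V -> R :=
  spectral_calculus m E (fun s => expR (- t * s)) f.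

Definition green m E x y : \bar R :=
  (\int[lebesgue_measure]_(t in `[0%R, +oo[) (semigroup m E t (delta x) y)%:E)%E.

Definition transition b c x y : R := b x y / degree b c x.

(* Powers of an infinite matrix with nonnegative entries; the entries of the
   powers are in [0, +oo]. *)
Fixpoint matrix_power (P : V -> V -> R) (n : nat) (x y : V) : \bar R :=
  (if n is n'.+1 then \esum_(z in [set: V]) ((P x z)%:E * matrix_power P n' z y)
   else (x == y)%:R%:E)%E.

End Graph.

(* Main.v *)
(* For [alpha > 0] and [r >= 0] summable, the Neumann series with terms
   [t 0 = r / (deg + alpha)] and [t n.+1 = b (t n) / (deg + alpha)] converges to
   [(L + alpha)^-1 r]: its partial sums lie in the form domain and, [b] being symmetric,
   the squared form norm of a difference of partial sums is bounded by a tail of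
   [\sum_n <r, t n>]. So the resolvent has nonnegative matrix entries.
   On the spectral side let [mu_f B = <E B f, f>]. The form being nonnegative, [mu_f] is
   carried by the half-line [s >= 0], and [A u = w] implies that [mu_(w + alpha u)] has
   density [(s + alpha) ^ 2] with respect to [mu_u]. This represents the powers of the
   resolvent by the functions [(s + alpha) ^- k]. Hence the heat kernel is nonnegative by
   the Post-Widder formula, and its Laplace transform is the resolvent kernel. As [alpha]
   decreases to 0, monotone convergence turns the Laplace transform into the Green
   function and the Neumann series of [delta y] into [(deg y)^-1 * \sum_n P^n x y]. *)
From HB Require Import structures.
Require Import Defs.
From mathcomp Require Import finmap ring lra measurable_realfun exponential_distribution.

Set Implicit Arguments.
Unset Strict Implicit.
Unset Printing Implicit Defensive.

Import Order.TTheory GRing.Theory Num.Theory.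
Import numFieldNormedType.Exports.
Local Open Scope classical_set_scope.
Local Open Scope ring_scope.

(** * Absolutely summable and square-summable families *)

Section Sums.
Context {R : realType}.

Section OneIndex.
Context {I : choiceType}.
Implicit Types (f g p q : I -> R) (a : R).

(** The spectral measure is given only through its projections, so the calculus is reduced to scalar
    measures: an entry [<psi(A) (delta x), delta y>] is a quarter of the difference of the integrals
    of [psi] against the spectral measures of [delta x + delta y] and [delta x - delta y].
    Identities between such differences are written additively, negative terms on the other side,
    since some integrals are not yet known to be finite. The density is a square because [mu_f] is
    quadratic in [f]. It removes two factors of the resolvent at a time, so the powers obtained are
    even; the first power, needed for the Laplace transform, comes from [<E B w, u>]. Degrees may be
    unbounded, and then so is [L]. Operator bounds are replaced by a duality: the Neumann terms are
    bounded and also summable with weight [deg + alpha], which makes the double sums in Green's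
    formula absolutely convergent. The shift [alpha > 0] supplies these bounds, through the constant
    [rsum r / alpha]. The limit in [alpha] is taken in [[0, +oo]], so a recurrent walk, where both
    sides are infinite, is not a separate case. *)

Definition abs_summable f : Prop := (\esum_(i in [set: I]) `|f i|%:E < +oo)%E.

Lemma esum_fineK f : (forall i, 0 <= f i) -> abs_summable f ->
  (fine (\esum_(i in [set: I]) (f i)%:E))%:E = \esum_(i in [set: I]) (f i)%:E.
Proof.
move=> f0 fs; rewrite fineK// ge0_fin_numE; last by apply: esum_ge0 => i _; rewrite lee_fin.
by apply: le_lt_trans fs; apply: le_esum => i _; rewrite lee_fin ler_norm.
Qed.

Lemma abs_summable_ge0 f : (forall i, 0 <= f i) ->
  (\esum_(i in [set: I]) (f i)%:E < +oo)%E -> abs_summable f.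
Proof.
move=> f0; rewrite /abs_summable; under [X in _ -> (X < _)%E]eq_esum => i _ do rewrite ger0_norm//.
by [].
Qed.

Lemma abs_summable_le f g : (forall i, `|f i| <= `|g i|) -> abs_summable g -> abs_summable f.
Proof.
by move=> fg; apply: le_lt_trans; apply: le_esum => i _; rewrite lee_fin.
Qed.

Lemma abs_summable0 : abs_summable (fun=> 0).
Proof. by rewrite /abs_summable esum1 ?ltry// => i _; rewrite normr0. Qed.

Lemma abs_summableD f g : abs_summable f -> abs_summable g ->
  abs_summable (fun i => f i + g i).
Proof.
move=> fs gs; apply: (@le_lt_trans _ _ (\esum_(i in [set: I]) (`|f i|%:E + `|g i|%:E)%E)).
  by apply: le_esum => i _; rewrite -EFinD lee_fin ler_normD.
by rewrite esumD//; [exact: lte_add_pinfty|move=> i _; rewrite lee_fin..].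
Qed.

Lemma esumZl a f : 0 <= a -> (forall i, 0 <= f i) ->
  (\esum_(i in [set: I]) (a * f i)%:E = a%:E * \esum_(i in [set: I]) (f i)%:E)%E.
Proof.
have le_ (c : R) (h : I -> R) : 0 <= c -> (forall i, 0 <= h i) ->
  (\esum_(i in [set: I]) (c * h i)%:E <= c%:E * \esum_(i in [set: I]) (h i)%:E)%E.
  move=> c0 h0; apply: ge_ereal_sup => _ [X [finX _] <-].
  under eq_fsbigr do rewrite EFinM.
  rewrite -ge0_mule_fsumr; last by move=> i; rewrite lee_fin.
  by rewrite lee_wpmul2l ?lee_fin//; apply: ereal_sup_ubound; exists X.
rewrite le_eqVlt => /orP[/eqP <- f0|a0 f0].
  by rewrite mul0e esum1// => i _; rewrite mul0r.
apply/eqP; rewrite eq_le (le_ _ _ (ltW a0) f0)/=.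
rewrite -lee_pdivlMl//.
(* The reverse inequality is [le_] again, for the factor [a^-1] and the family [a * f]. *)
have := le_ a^-1 (fun i => a * f i) _ (fun i => mulr_ge0 (ltW a0) (f0 i)).
rewrite invr_ge0 (ltW a0) => /(_ isT).
by under [leLHS]eq_esum => i _ do rewrite mulrA mulVf ?gt_eqF// mul1r.
Qed.

Lemma abs_summableZ a f : abs_summable f -> abs_summable (fun i => a * f i).
Proof.
move=> fs; rewrite /abs_summable.
under eq_esum => i _ do rewrite normrM.
by rewrite esumZl// lte_mul_pinfty// lee_fin.
Qed.

Lemma abs_summableN f : abs_summable f -> abs_summable (fun i => - f i).
Proof. by apply: abs_summable_le => i; rewrite normrN. Qed.

Lemma abs_summableB f g : abs_summable f -> abs_summable g ->
  abs_summable (fun i => f i - g i).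
Proof. by move=> fs /abs_summableN; exact: abs_summableD. Qed.

Lemma rsum_ge0E f : (forall i, 0 <= f i) ->
  rsum f = fine (\esum_(i in [set: I]) (f i)%:E).
Proof.
move=> f0; rewrite /rsum [X in _ - fine X]esum1 ?subr0; last first.
  by move=> i _; rewrite max_r// oppr_le0.
by congr fine; apply: eq_esum => i _; rewrite max_l.
Qed.

Lemma rsum_EFin f : (forall i, 0 <= f i) -> abs_summable f ->
  (rsum f)%:E = \esum_(i in [set: I]) (f i)%:E.
Proof. by move=> f0 fs; rewrite rsum_ge0E// esum_fineK. Qed.

(** [p] and [q] need not be the positive and negative parts of [p - q]. With these parts called [pp]
    and [qq], one has [pp + q = qq + p] between nonnegative families, where [esum] is additive. *)
Lemma rsum_diff p q : (forall i, 0 <= p i) -> (forall i, 0 <= q i) ->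
  abs_summable p -> abs_summable q ->
  rsum (fun i => p i - q i) = rsum p - rsum q.
Proof.
move=> p0 q0 ps qs; rewrite (rsum_ge0E p0) (rsum_ge0E q0) /rsum.
set pp := fun i => Num.max (p i - q i) 0; set qq := fun i => Num.max (- (p i - q i)) 0.
have pp0 i : 0 <= pp i by rewrite le_max lexx orbT.
have qq0 i : 0 <= qq i by rewrite le_max lexx orbT.
have pps : abs_summable pp.
  apply: abs_summable_le ps => i; rewrite !ger0_norm// /pp ge_max p0 andbT.
  by rewrite gerBl.
have qqs : abs_summable qq.
  apply: abs_summable_le qs => i; rewrite !ger0_norm// /qq ge_max q0 andbT.
  by rewrite opprB gerBl.
apply/eqP; rewrite subr_eq addrAC eq_sym subr_eq; apply/eqP.
apply: EFin_inj; rewrite !EFinD !esum_fineK// -!esumD//; do ?[by move=> i _; rewrite lee_fin// le_max lexx orbT].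
apply: eq_esum => i _; rewrite -!EFinD; congr EFin; rewrite /pp /qq.
by case: (lerP (p i) (q i)) => pq;
  rewrite /Num.max; do 2 (case: ifPn); rewrite -?leNgt; lra.
Qed.

Lemma rsum_posneg f : rsum f = rsum (fun i => Num.max (f i) 0) - rsum (fun i => Num.max (- f i) 0).
Proof. by rewrite (@rsum_ge0E (fun i => Num.max (f i) 0)) ?(@rsum_ge0E (fun i => Num.max (- f i) 0))// => i;
  rewrite le_max lexx orbT. Qed.

Lemma abs_summable_pos f : abs_summable f -> abs_summable (fun i => Num.max (f i) 0).
Proof.
apply: abs_summable_le => i; rewrite ger0_norm ?le_max ?lexx ?orbT//.
by rewrite ge_max normr_ge0 ler_norm.
Qed.

Lemma rsum0 : rsum (fun _ : I => 0 : R) = 0.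
Proof. by rewrite rsum_ge0E// esum1. Qed.

Lemma rsumN f : rsum (fun i => - f i) = - rsum f.
Proof. by rewrite /rsum opprB; under [X in _ - fine X = _]eq_esum => i _ do rewrite opprK. Qed.

Lemma rsumD f g : abs_summable f -> abs_summable g ->
  rsum (fun i => f i + g i) = rsum f + rsum g.
Proof.
move=> fs gs.
set fp := fun i => Num.max (f i) 0; set fn := fun i => Num.max (- f i) 0.
set gp := fun i => Num.max (g i) 0; set gn := fun i => Num.max (- g i) 0.
have nn (h : I -> R) i : 0 <= Num.max (h i) 0 by rewrite le_max lexx orbT.
have fps : abs_summable fp by exact: abs_summable_pos.
have gps : abs_summable gp by exact: abs_summable_pos.
have fns : abs_summable fn by exact/(@abs_summable_pos (fun i => - f i))/abs_summableN.
have gns : abs_summable gn by exact/(@abs_summable_pos (fun i => - g i))/abs_summableN.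
have E (h : I -> R) i : h i = Num.max (h i) 0 - Num.max (- h i) 0.
  by rewrite /Num.max; do 2 (case: ifPn); rewrite -?leNgt; lra.
have D (h k : I -> R) : (forall i, 0 <= h i) -> (forall i, 0 <= k i) -> abs_summable h ->
    abs_summable k -> rsum (fun i => h i + k i) = rsum h + rsum k.
  move=> h0 k0 hs ks; have hk0 i : 0 <= h i + k i by rewrite addr_ge0.
  apply: EFin_inj; rewrite [RHS]EFinD (rsum_EFin hk0 (abs_summableD hs ks)) !rsum_EFin//.
  by rewrite -esumD// => i _; rewrite lee_fin.
rewrite (_ : (fun i => _) = fun i => (fp i + gp i) - (fn i + gn i)); last first.
  by apply/funext => i; rewrite {1}(E f) {1}(E g) /fp /fn /gp /gn; lra.
rewrite rsum_diff; do ?[by move=> i; rewrite addr_ge0// ?nn//].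
- rewrite !D//; try exact: nn. rewrite (rsum_posneg f) (rsum_posneg g).
  rewrite -/fp -/fn -/gp -/gn. lra.
- by move=> i; rewrite addr_ge0//; exact: (nn (fun i => - _ i)).
- exact: abs_summableD.
- exact: abs_summableD.
Qed.

Lemma rsumB f g : abs_summable f -> abs_summable g ->
  rsum (fun i => f i - g i) = rsum f - rsum g.
Proof.
by move=> fs gs; rewrite (@rsumD f (fun i => - g i)) ?rsumN//; exact: abs_summableN.
Qed.

(** This covers divergent sums too: [fine] sends an infinite sum to 0, and its multiples as well, so
    both sides take the same default value. *)
Lemma rsumZ a f : rsum (fun i => a * f i) = a * rsum f.
Proof.
wlog a0 : a f / 0 <= a => [H|].
  have [/H//|a0] := lerP 0 a.
  rewrite (_ : (fun i => _) = fun i => - ((- a) * f i)); last by apply/funext => i; rewrite mulNr opprK.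
  by rewrite rsumN H ?mulNr ?opprK// oppr_ge0 ltW.
rewrite /rsum mulrBr.
have M (h : I -> R) : fine (\esum_(i in [set: I]) (Num.max (a * h i) 0)%:E) =
   a * fine (\esum_(i in [set: I]) (Num.max (h i) 0)%:E).
  under eq_esum => i _ do rewrite -(mulr0 a) -maxr_pMr//.
  rewrite esumZl//; last by move=> i; rewrite le_max lexx orbT.
  case: (esum _ _) => [r||]//=; rewrite ?mulr0.
    move: a0; rewrite le_eqVlt => /orP[/eqP<-|a0]; first by rewrite mul0e.
    by rewrite gt0_muley ?lte_fin.
  move: a0; rewrite le_eqVlt => /orP[/eqP<-|a0]; first by rewrite mul0e.
  by rewrite gt0_muleNy ?lte_fin.
rewrite M; congr (_ - _); rewrite -M; congr fine; apply: eq_esum => i _.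
by rewrite mulrN.
Qed.

Lemma rsum_ge0 f : (forall i, 0 <= f i) -> 0 <= rsum f.
Proof. by move=> f0; rewrite rsum_ge0E// fine_ge0// esum_ge0// => i _; rewrite lee_fin. Qed.

Lemma ler_rsum f g : abs_summable f -> abs_summable g -> (forall i, f i <= g i) ->
  rsum f <= rsum g.
Proof.
move=> fs gs fg; rewrite -subr_ge0 -rsumB//; apply: rsum_ge0 => i.
by rewrite subr_ge0.
Qed.

Lemma bounded_mul_summable f g (M : R) : abs_summable f -> (forall i, `|g i| <= M) ->
  abs_summable (fun i => f i * g i).
Proof.
move=> fs gM; apply: (abs_summable_le _ (abs_summableZ M fs)) => i.
rewrite mulrC normrM [leRHS]normrM ler_wpM2r//; apply: (le_trans (gM _)); exact: ler_norm.
Qed.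

Lemma esum_ge1 (f : I -> \bar R) i : (forall j, 0 <= f j)%E ->
  (f i <= \esum_(j in [set: I]) f j)%E.
Proof.
move=> f0; apply: esum_ge; exists [set i]; last by rewrite fsbig_set1.
by split => //; exact: finite_set1.
Qed.

Lemma ler_rsum1 f i : abs_summable f -> (forall j, 0 <= f j) -> f i <= rsum f.
Proof.
move=> fs f0; rewrite -lee_fin rsum_EFin//.
by apply: (@esum_ge1 (EFin \o f)) => j; rewrite lee_fin.
Qed.

Lemma esum_single i (f : I -> \bar R) : (0 <= f i)%E -> (forall j, j != i -> f j = 0%E) ->
  \esum_(j in [set: I]) f j = f i.
Proof.
move=> f0 fj; rewrite -[RHS]esum_set1// [RHS]esum_mkcond; apply: eq_esum => j _.
case: ifPn => // jni; apply: fj; apply: contra jni => /eqP ->; exact/mem_set.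
Qed.

Lemma abs_summable_single i f : (forall j, j != i -> f j = 0) -> abs_summable f.
Proof.
move=> fj; rewrite /abs_summable (esum_single (i := i)) ?ltry ?lee_fin// => j /fj ->.
by rewrite normr0.
Qed.

Lemma rsum_single i f : (forall j, j != i -> f j = 0) -> rsum f = f i.
Proof.
move=> fj; rewrite /rsum !(esum_single (i := i)) ?lee_fin ?le_max ?lexx ?orbT//=.
- by rewrite /Num.max; do 2 (case: ifPn); rewrite -?leNgt; lra.
- by move=> j /fj ->; rewrite oppr0 maxxx.
- by move=> j /fj ->; rewrite maxxx.
Qed.

(** Monotone convergence for the counting measure: finite partial sums pass to the limit, and each
    is bounded by the limit of the full sums. *)
Lemma esum_cvg (F : nat -> I -> \bar R) (f : I -> \bar R) :
  (forall n i, 0 <= F n i)%E -> (forall i, nondecreasing_seq (F ^~ i)) ->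
  (forall i, F n i @[n --> \oo] --> f i) ->
  \esum_(i in [set: I]) F n i @[n --> \oo] --> \esum_(i in [set: I]) f i.
Proof.
move=> F0 Fnd Ff.
have Fle n i : (F n i <= f i)%E.
  apply: (cvge_to_ge (Ff i)); exists n => // m /= nm; exact: Fnd.
have cv : cvgn (fun n => \esum_(i in [set: I]) F n i).
  apply: ereal_nondecreasing_is_cvgn => m n mn; apply: le_esum => i _; exact: Fnd.
suff -> : \esum_(i in [set: I]) f i = limn (fun n => \esum_(i in [set: I]) F n i) by [].
apply/eqP; rewrite eq_le; apply/andP; split; last first.
  by apply: lime_le => //; apply: nearW => n; apply: le_esum => i _; exact: Fle.
apply: ge_ereal_sup => _ [X [finX _] <-]; rewrite fsbig_finite//=.
have cvX : \sum_(i <- fset_set X) F n i @[n --> \oo] --> \sum_(i <- fset_set X) f i.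
  by apply: cvg_nnesum => // i _; apply: nearW => n.
rewrite -(cvg_lim _ cvX)//; apply: lee_lim => //; first by apply/cvg_ex; eexists; exact: cvX.
by apply: nearW => n; apply: esum_ge; exists X; [split|rewrite fsbig_finite].
Qed.

(** Fatou's lemma for sums: a finite partial sum of [f] is a limit of finite partial sums of [F n],
    each at most [rsum (F n)]. *)
Lemma rsum_fatou (F : nat -> I -> R) f (C : R) :
  (forall n i, 0 <= F n i) -> (forall i, F n i @[n --> \oo] --> f i) ->
  (forall n, abs_summable (F n)) -> (\forall n \near \oo, rsum (F n) <= C) ->
  abs_summable f /\ rsum f <= C.
Proof.
move=> F0 Ff Fs FC.
have f0 i : 0 <= f i by apply: (cvgr_to_ge (Ff i)); exact: nearW.
have bd : (\esum_(i in [set: I]) (f i)%:E <= C%:E)%E.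
  apply: ge_ereal_sup => _ [X [finX _] <-].
  rewrite fsbig_finite//= sumEFin lee_fin.
  have cv : \sum_(i <- fset_set X) F n i @[n --> \oo] --> \sum_(i <- fset_set X) f i.
    elim: (enum_fset _) => [|i s IHs].
      by rewrite big_nil; under eq_fun do rewrite big_nil; exact: cvg_cst.
    by rewrite big_cons; under eq_fun do rewrite big_cons; exact: cvgD.
  apply: (cvgr_to_le cv); near=> n.
  apply: le_trans (_ : rsum (F n) <= _); last by near: n.
  rewrite -lee_fin rsum_EFin// -sumEFin.
  apply: esum_ge; exists X; first by split.
  by rewrite fsbig_finite.
have fs : abs_summable f by apply: abs_summable_ge0 => //; exact: le_lt_trans bd (ltry _).
by split => //; rewrite -lee_fin rsum_EFin.
Unshelve. all: by end_near. Qed.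

Lemma rsum_cvg (F : nat -> I -> R) f :
  (forall n i, 0 <= F n i) -> (forall i, nondecreasing_seq (F ^~ i)) ->
  (forall i, F n i @[n --> \oo] --> f i) -> abs_summable f ->
  rsum (F n) @[n --> \oo] --> rsum f.
Proof.
move=> F0 Fnd Ff fs.
have Fle n i : F n i <= f i.
  by apply: (cvgr_to_ge (Ff i)); exists n => // m /= nm; exact: Fnd.
have f0 i : 0 <= f i by exact: le_trans (F0 0 i) (Fle 0 i).
have Fs n : abs_summable (F n) by apply: abs_summable_le fs => i; rewrite !ger0_norm.
rewrite (_ : (fun n => rsum (F n)) = fine \o (fun n => \esum_(i in [set: I]) (F n i)%:E)); last first.
  by apply/funext => n /=; rewrite rsum_ge0E.
apply: fine_cvg; rewrite rsum_EFin//.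
apply: (@esum_cvg (fun n i => (F n i)%:E) (EFin \o f)) => [n i|i m n mn|i].
- by rewrite lee_fin.
- by rewrite lee_fin; exact: Fnd.
- by apply: cvg_EFin; [exact: nearW|exact: Ff].
Qed.

End OneIndex.

(** * Double sums *)

Lemma esum_pair (I J : choiceType) (f : I * J -> \bar R) : (forall k, 0 <= f k)%E ->
  \esum_(k in [set: I * J]) f k = \esum_(i in [set: I]) \esum_(j in [set: J]) f (i, j).
Proof.
move=> f0; rewrite (@esum_esum _ _ _ [set: I] (fun=> [set: J]) (fun i j => f (i, j)))//.
have -> : ([set: I] `*`` (fun _ => [set: J])) = [set: I * J] by apply/seteqP; split.
by apply: eq_esum => -[].
Qed.

Lemma esum_swap (I J : choiceType) (f : I * J -> \bar R) :
  \esum_(k in [set: I * J]) f k = \esum_(k in [set: J * I]) f (k.2, k.1).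
Proof.
apply: (reindex_esum [set: J * I] [set: I * J] (fun k => (k.2, k.1))).
split=> //= [[a b] [c d] _ _ []|[a b] _]; first by move=> -> ->.
by exists (b, a).
Qed.

Lemma rsum_swap (I J : choiceType) (f : I * J -> R) :
  rsum f = rsum (fun k : J * I => f (k.2, k.1)).
Proof.
by rewrite /rsum (esum_swap (fun k => (Num.max (f k) 0)%:E))
  (esum_swap (fun k => (Num.max (- f k) 0)%:E)).
Qed.

Lemma abs_summable_swap (I J : choiceType) (f : I * J -> R) :
  abs_summable f -> abs_summable (fun k : J * I => f (k.2, k.1)).
Proof. by rewrite /abs_summable (esum_swap (fun k => `|f k|%:E)). Qed.

Lemma abs_summable_section (I J : choiceType) (f : I * J -> R) i :
  abs_summable f -> abs_summable (fun j => f (i, j)).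
Proof.
rewrite /abs_summable (esum_pair (f := fun k => `|f k|%:E))// => fs.
apply: le_lt_trans fs.
by apply: (@esum_ge1 _ (fun i => \esum_(j in [set: J]) `|f (i, j)|%:E)) => k; exact: esum_ge0.
Qed.

Lemma rsum_pair (I J : choiceType) (f : I * J -> R) : abs_summable f ->
  abs_summable (fun i => rsum (fun j => f (i, j))) /\
  rsum f = rsum (fun i => rsum (fun j => f (i, j))).
Proof.
move=> fs.
have nn (h : I * J -> R) k : 0 <= Num.max (h k) 0 by rewrite le_max lexx orbT.
have pos (h : I * J -> R) : (forall k, 0 <= h k) -> abs_summable h ->
   abs_summable (fun i => rsum (fun j => h (i, j))) /\
   rsum h = rsum (fun i => rsum (fun j => h (i, j))).
  move=> h0 hs.
  have H0 i : 0 <= rsum (fun j => h (i, j)) by exact: rsum_ge0.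
  have HE : (\esum_(i in [set: I]) (rsum (fun j => h (i, j)))%:E =
     \esum_(k in [set: I * J]) (h k)%:E).
    rewrite (esum_pair (f := fun k => (h k)%:E)); last by move=> k; rewrite lee_fin.
    by apply: eq_esum => i _; rewrite rsum_EFin//; exact: abs_summable_section.
  have Hs : abs_summable (fun i => rsum (fun j => h (i, j))).
    apply: abs_summable_ge0 => //; rewrite HE -rsum_EFin//; exact: ltry.
  by split => //; apply: EFin_inj; rewrite !rsum_EFin.
have fN : abs_summable (fun k => - f k) by exact: abs_summableN.
have [s1 e1] := pos _ (nn f) (abs_summable_pos fs).
have [s2 e2] := pos _ (nn (fun k => - f k)) (abs_summable_pos fN).
have E i : rsum (fun j => f (i, j)) = rsum (fun j => Num.max (f (i, j)) 0) -
    rsum (fun j => Num.max (- f (i, j)) 0) by rewrite rsum_posneg.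
split; first by under [X in abs_summable X]funext => i do rewrite E; exact: abs_summableB.
rewrite rsum_posneg e1 e2 -rsumB//; congr rsum; by apply/funext => i; rewrite E.
Qed.

(** * Square-summable families and their scalar product *)

Section SquareSummable.
Context {I : choiceType}.
Implicit Types (f g : I -> R).

Definition sq_summable f : Prop := abs_summable (fun i => f i ^+ 2).

Definition dot f g : R := rsum (fun i => f i * g i).

Lemma sq_summableE f : (\esum_(i in [set: I]) (f i ^+ 2)%:E < +oo)%E <-> sq_summable f.
Proof.
rewrite /sq_summable /abs_summable.
by under [X in _ <-> (X < _)%E]eq_esum => i _ do rewrite ger0_norm ?sqr_ge0//.
Qed.

Lemma dot_summable f g : sq_summable f -> sq_summable g -> abs_summable (fun i => f i * g i).
Proof.
move=> fs gs; apply: (abs_summable_le _ (abs_summableD fs gs)) => i.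
rewrite [leRHS]ger0_norm ?addr_ge0 ?sqr_ge0//.
rewrite -(real_normK (num_real (f i))) -(real_normK (num_real (g i))) normrM.
by have := sqr_ge0 (`|f i| - `|g i|); have := normr_ge0 (f i); have := normr_ge0 (g i); nra.
Qed.

Lemma sq_summableZ a f : sq_summable f -> sq_summable (fun i => a * f i).
Proof.
move=> fs; rewrite /sq_summable; under [X in abs_summable X]funext => i do rewrite exprMn.
exact: abs_summableZ.
Qed.

Lemma sq_summableD f g : sq_summable f -> sq_summable g -> sq_summable (fun i => f i + g i).
Proof.
move=> fs gs; have fgs := abs_summableZ 2 (dot_summable fs gs).
rewrite /sq_summable; under [X in abs_summable X]funext => i do rewrite sqrrD -mulr_natl.
exact: (abs_summableD (abs_summableD fs fgs) gs).
Qed.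

Lemma sq_summableN f : sq_summable f -> sq_summable (fun i => - f i).
Proof.
move=> fs; rewrite /sq_summable.
by under [X in abs_summable X]funext => i do rewrite sqrrN.
Qed.

Lemma sq_summableB f g : sq_summable f -> sq_summable g -> sq_summable (fun i => f i - g i).
Proof. by move=> fs /sq_summableN; exact: sq_summableD. Qed.

Lemma sq_summable0 : sq_summable (fun=> 0).
Proof. by rewrite /sq_summable expr0n/=; exact: abs_summable0. Qed.

Lemma bounded_sq_summable f (M : R) : abs_summable f -> (forall i, `|f i| <= M) -> sq_summable f.
Proof. exact: bounded_mul_summable. Qed.

Lemma dotC f g : dot f g = dot g f.
Proof. by congr rsum; apply/funext => i; rewrite mulrC. Qed.

Lemma dotDl f g h : sq_summable f -> sq_summable g -> sq_summable h ->
  dot (fun i => f i + g i) h = dot f h + dot g h.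
Proof.
move=> fs gs hs; rewrite /dot -rsumD; [|exact: dot_summable..].
by congr rsum; apply/funext => i; rewrite mulrDl.
Qed.

Lemma dotZl a f h : dot (fun i => a * f i) h = a * dot f h.
Proof. by rewrite /dot -rsumZ; congr rsum; apply/funext => i; rewrite mulrA. Qed.

Lemma dotNl f h : dot (fun i => - f i) h = - dot f h.
Proof. by rewrite /dot -rsumN; congr rsum; apply/funext => i; rewrite mulNr. Qed.

Lemma dotBl f g h : sq_summable f -> sq_summable g -> sq_summable h ->
  dot (fun i => f i - g i) h = dot f h - dot g h.
Proof.
by move=> fs gs hs; rewrite (@dotDl f (fun i => - g i)) ?dotNl//; exact: sq_summableN.
Qed.

Lemma dotDr f g h : sq_summable f -> sq_summable g -> sq_summable h ->
  dot h (fun i => f i + g i) = dot h f + dot h g.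
Proof. by move=> fs gs hs; rewrite dotC dotDl// !(dotC h). Qed.

Lemma dotBr f g h : sq_summable f -> sq_summable g -> sq_summable h ->
  dot h (fun i => f i - g i) = dot h f - dot h g.
Proof. by move=> fs gs hs; rewrite dotC dotBl// !(dotC h). Qed.

Lemma dotZr a f h : dot h (fun i => a * f i) = a * dot h f.
Proof. by rewrite dotC dotZl dotC. Qed.

Lemma dot_sq f : dot f f = rsum (fun i => f i ^+ 2).
Proof. by congr rsum; apply/funext => i; rewrite expr2. Qed.

Lemma dot_EFin f : sq_summable f ->
  (dot f f)%:E = \esum_(i in [set: I]) (f i ^+ 2)%:E.
Proof. by move=> fs; rewrite dot_sq rsum_EFin// => i; exact: sqr_ge0. Qed.

Lemma dotff_ge0 f : 0 <= dot f f.
Proof. by rewrite dot_sq; apply: rsum_ge0 => i; exact: sqr_ge0. Qed.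

Lemma dotff_ge1 f i : sq_summable f -> f i ^+ 2 <= dot f f.
Proof.
move=> fs; rewrite dot_sq; apply: (@ler_rsum1 _ (fun i => f i ^+ 2)) => // j; exact: sqr_ge0.
Qed.

Lemma dotff_eq0 f i : sq_summable f -> dot f f <= 0 -> f i = 0.
Proof.
move=> fs f0; apply/eqP; rewrite -sqrf_eq0 eq_le sqr_ge0 andbT.
exact: (le_trans (dotff_ge1 i fs)).
Qed.

Lemma dot_expand f g : sq_summable f -> sq_summable g ->
  dot (fun i => f i + g i) (fun i => f i + g i) = dot f f + 2 * dot f g + dot g g.
Proof.
move=> fs gs; have fgs := sq_summableD fs gs.
by rewrite dotDl// !dotDr// (dotC g f); lra.
Qed.

Lemma cauchy_schwarz f g : sq_summable f -> sq_summable g ->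
  dot f g ^+ 2 <= dot f f * dot g g.
Proof.
move=> fs gs; have [g0|g0] := lerP (dot g g) 0.
  rewrite (_ : dot f g = 0) ?expr0n ?mulr_ge0 ?dotff_ge0//.
  rewrite /dot (_ : (fun i => _) = fun=> 0) ?rsum0//.
  by apply/funext => i; rewrite (dotff_eq0 i gs g0) mulr0.
(* The square norm of [<g, g> f - <f, g> g] is [<g, g> (<f, f> <g, g> - <f, g> ^ 2)]. *)
have := dotff_ge0 (fun i => dot g g * f i + (- dot f g) * g i).
have s1 := @sq_summableZ (dot g g) _ fs.
have s2 := @sq_summableZ (- dot f g) _ gs.
rewrite dot_expand// !dotZl !dotZr.
set a := dot f f; set b := dot f g; set c := dot g g => H.
have : 0 <= c * (a * c - b ^+ 2) by move: H; rewrite expr2; nra.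
by rewrite pmulr_rge0// subr_ge0.
Qed.

Lemma dotff_le2 f g : sq_summable f -> sq_summable g ->
  dot (fun i => f i + g i) (fun i => f i + g i) <= 2 * dot f f + 2 * dot g g.
Proof.
move=> fs gs; have := dotff_ge0 (fun i => f i - g i).
by rewrite (dot_expand fs (sq_summableN gs)) dot_expand// (dotC f (fun i => - _ i)) !dotNl
  (dotC g (fun i => - _ i)) dotNl (dotC g f); lra.
Qed.

Lemma sq_summable_fatou (F : nat -> I -> R) f (C : R) :
  (forall i, F n i @[n --> \oo] --> f i) ->
  (forall n, sq_summable (F n)) -> (\forall n \near \oo, dot (F n) (F n) <= C) ->
  sq_summable f /\ dot f f <= C.
Proof.
move=> Ff Fs FC; rewrite dot_sq.
apply: (@rsum_fatou _ (fun n i => F n i ^+ 2)) => //.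
- by move=> n i; exact: sqr_ge0.
- by move=> i; exact: (cvgM (Ff i) (Ff i)).
Qed.

Lemma esum_tail (f : I -> R) (e : R) : (forall i, 0 <= f i) -> abs_summable f -> 0 < e ->
  exists2 X : set I, finite_set X &
    (\esum_(i in [set: I]) (if i \in X then 0 else f i)%:E < e%:E)%E.
Proof.
move=> f0 fs e0.
have : (\esum_(i in [set: I]) (f i)%:E - e%:E < \esum_(i in [set: I]) (f i)%:E)%E.
  by rewrite -rsum_EFin// -EFinB lte_fin ltrBlDr ltrDl.
move=> /ereal_sup_gt[_ [X [finX _] <-]]; rewrite -rsum_EFin// => H.
exists X => //.
have XE : \sum_(i \in X) (f i)%:E = \esum_(i in [set: I]) (if i \in X then f i else 0)%:E.
  rewrite -esum_fset//; last by move=> i _; rewrite lee_fin.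
  by rewrite esum_mkcond; apply: eq_esum => i _; case: ifPn.
have s1 : abs_summable (fun i => if i \in X then f i else 0).
  by apply: abs_summable_le fs => i; case: ifPn; rewrite ?normr0.
have s2 : abs_summable (fun i => if i \in X then 0 else f i).
  by apply: abs_summable_le fs => i; case: ifPn; rewrite ?normr0.
have n1 i : 0 <= (if i \in X then f i else 0) by case: ifPn.
have n2 i : 0 <= (if i \in X then 0 else f i) by case: ifPn.
move: H; rewrite XE -!rsum_EFin// -EFinB !lte_fin ltrBlDl => H.
have -> : rsum (fun i => if i \in X then 0 else f i) = rsum f - rsum (fun i => if i \in X then f i else 0).
  rewrite -rsumB//; congr rsum; apply/funext => i.
  by case: ifPn => _; lra.
by rewrite ltrBlDr.
Qed.

End SquareSummable.
End Sums.

(** * The Dirichlet form of a graph *)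

Section CountingMeasure.
Context {R : realType} {V : countType}.
Implicit Types (f g u v : V -> R).

Lemma in_l2_1 f : in_l2 (fun=> 1) f <-> sq_summable f.
Proof.
rewrite /in_l2 /l2normsq -sq_summableE.
by under [X in (X < _)%E <-> _]eq_esum => i _ do rewrite mulr1.
Qed.

Lemma inner_1 f g : inner (fun=> 1) f g = dot f g.
Proof. by congr rsum; apply/funext => i; rewrite mulr1. Qed.

Lemma l2normsq_1 f : sq_summable f -> l2normsq (fun=> 1) f = (dot f f)%:E.
Proof.
by move=> fs; rewrite dot_EFin//; apply: eq_esum => i _; rewrite mulr1.
Qed.

Lemma delta_sq_summable x : sq_summable (@delta R V x).
Proof.
apply: (@abs_summable_single _ _ x) => y /negPf yx.
by rewrite /delta yx expr0n.
Qed.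

Lemma dot_delta f x : dot f (@delta R V x) = f x.
Proof.
rewrite /dot (@rsum_single _ _ x) ?/delta ?eqxx ?mulr1// => y /negPf yx.
by rewrite yx mulr0.
Qed.

End CountingMeasure.

Section Dirichlet.
Context {R : realType} {V : countType}.
Variable b : V -> V -> R.
Hypothesis bG : weighted_graph b (fun=> 0).
Implicit Types (f g u v w phi : V -> R).

Let b0 x y : 0 <= b x y := graph_b_ge0 bG x y.
Let bC x y : b x y = b y x := graph_b_sym bG x y.

Local Notation dom := (dirichlet_domain b (fun=> 0) (fun=> 1)).
Local Notation oper := (dirichlet_operator b (fun=> 0) (fun=> 1)).

Definition vdeg (x : V) : R := degree b (fun=> 0) x.

Lemma vdegE x : vdeg x = rsum (b x).
Proof. by rewrite /vdeg /degree addr0 rsum_ge0E. Qed.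

Lemma b_summable x : abs_summable (b x).
Proof. by apply: abs_summable_ge0 => //; exact: (graph_b_sum bG). Qed.

Lemma vdeg_ge0 x : 0 <= vdeg x.
Proof. by rewrite vdegE; exact: rsum_ge0. Qed.

(** The square root of half the weight goes to each factor, so that the energy form is the scalar
    product of gradients in [l^2(V * V)]; Cauchy-Schwarz and Fatou then apply to energies as they do
    to functions. *)
Definition grad u (p : V * V) : R := Num.sqrt (b p.1 p.2 / 2) * (u p.1 - u p.2).

Lemma grad_mul u v p :
  grad u p * grad v p = 2^-1 * (b p.1 p.2 * (u p.1 - u p.2) * (v p.1 - v p.2)).
Proof.
rewrite /grad mulrACA -expr2 sqr_sqrtr ?divr_ge0//. ring.
Qed.

Lemma gradD a u v : grad (fun x => a * u x + v x) = fun p => a * grad u p + grad v p.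
Proof. by apply/funext => p; rewrite /grad; ring. Qed.

Lemma gradB u v : grad (fun x => u x - v x) = fun p => grad u p - grad v p.
Proof. by apply/funext => p; rewrite /grad; ring. Qed.

Lemma energy_formE u v : energy_form b (fun=> 0) u v = dot (grad u) (grad v).
Proof.
rewrite /energy_form -[RHS]addr0; congr (_ + _).
  by rewrite -rsumZ; congr rsum; apply/funext => p; rewrite grad_mul.
rewrite (_ : (fun x => 0 * u x * v x) = fun=> 0) ?rsum0//.
by apply/funext => x; rewrite !mul0r.
Qed.

Lemma energyE u : energy b (fun=> 0) u = \esum_(p in [set: V * V]) (grad u p ^+ 2)%:E.
Proof.
rewrite /energy [X in (_ + X)%E]esum1 ?adde0; last by move=> x _; rewrite mul0r.
rewrite -esumZl ?invr_ge0//; last by move=> p; rewrite mulr_ge0// sqr_ge0.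
by apply: eq_esum => p _; rewrite [grad u p ^+ 2]expr2 grad_mul -mulrA -expr2.
Qed.

Lemma finite_energyE u : finite_energy b (fun=> 0) u <-> sq_summable (grad u).
Proof. by rewrite /finite_energy energyE sq_summableE. Qed.

Definition form_normsq u : R := dot (grad u) (grad u) + dot u u.

Definition form_finite u : Prop := sq_summable (grad u) /\ sq_summable u.

Lemma form_normsq_ge0 u : 0 <= form_normsq u.
Proof. by rewrite addr_ge0 ?dotff_ge0. Qed.

Lemma form_norm_lt u (e : R) : 0 < e -> (form_norm b (fun=> 0%R) (fun=> 1%R) u < e%:E)%E <->
  form_finite u /\ form_normsq u < e ^+ 2.
Proof.
move=> e0; rewrite /form_norm.
have e1 : (e%:E = sqrte (e ^+ 2)%:E)%E by rewrite /= sqrtr_sqr ger0_norm// ltW.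
rewrite e1 !ltNge lee_sqrt; last first.
  rewrite adde_ge0// ?energyE; first by apply: esum_ge0 => p _; rewrite lee_fin sqr_ge0.
  by apply: esum_ge0 => p _; rewrite lee_fin mulr1 sqr_ge0.
rewrite -!ltNge; split=> [H|[[f1 f2] H]]; last first.
  by rewrite energyE -dot_EFin// l2normsq_1// -EFinD lte_fin.
have n1 : (0 <= energy b (fun=> 0%R) u)%E.
  by rewrite energyE; apply: esum_ge0 => p _; rewrite lee_fin sqr_ge0.
have n2 : (0 <= l2normsq (fun=> 1%R) u)%E by apply: esum_ge0 => p _; rewrite lee_fin mulr1 sqr_ge0.
have f1 : sq_summable (grad u).
  by apply/finite_energyE; apply: le_lt_trans (lt_trans H (ltry _)); rewrite leeDl.
have f2 : sq_summable u.
  apply: (proj1 (in_l2_1 u) (le_lt_trans _ (lt_trans H (ltry _)))); by rewrite leeDr.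
split => //; move: H.
by rewrite energyE -dot_EFin// l2normsq_1// -EFinD lte_fin.
Qed.

Lemma dirichlet_domainE u : dom u <->
  form_finite u /\ forall e : R, 0 < e -> exists2 phi, finitely_supported phi &
    form_finite (fun x => u x - phi x) /\ form_normsq (fun x => u x - phi x) < e.
Proof.
split=> [[/finite_energyE f1 /in_l2_1 f2 ap]|[[f1 f2] ap]].
  split=> // e e0; have e1 : 0 < Num.sqrt e by rewrite sqrtr_gt0.
  have [phi p1 /form_norm_lt] := ap _ e1; rewrite sqr_sqrtr ?ltW// => /(_ e1) p2.
  by exists phi.
split; [exact/finite_energyE|exact/in_l2_1|move=> e e0].
have [|phi p1 p2] := ap (e ^+ 2); first by rewrite exprn_gt0.
by exists phi => //; apply/form_norm_lt.
Qed.

Lemma form_finiteD a u v : form_finite u -> form_finite v ->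
  form_finite (fun x => a * u x + v x).
Proof.
move=> [u1 u2] [v1 v2]; split; first rewrite gradD; apply: sq_summableD => //; exact: sq_summableZ.
Qed.

Lemma form_normsqD u v : form_finite u -> form_finite v ->
  form_normsq (fun x => u x + v x) <= 2 * form_normsq u + 2 * form_normsq v.
Proof.
move=> [u1 u2] [v1 v2]; rewrite /form_normsq.
have -> : grad (fun x => u x + v x) = fun p => grad u p + grad v p.
  by apply/funext => p; rewrite /grad; ring.
by have := dotff_le2 u1 v1; have := dotff_le2 u2 v2; lra.
Qed.

Lemma form_normsqZ a u : form_normsq (fun x => a * u x) = a ^+ 2 * form_normsq u.
Proof.
rewrite /form_normsq.
have -> : grad (fun x => a * u x) = fun p => a * grad u p.
  by apply/funext => p; rewrite /grad; ring.
by rewrite !dotZl !dotZr; ring.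
Qed.

Lemma form_finiteZ a u : form_finite u -> form_finite (fun x => a * u x).
Proof.
move=> [u1 u2]; split; last exact: sq_summableZ.
rewrite (_ : grad _ = fun p => a * grad u p); first exact: sq_summableZ.
by apply/funext => p; rewrite /grad; ring.
Qed.

Lemma dirichlet_domain_limit u : form_finite u ->
  (forall e : R, 0 < e -> exists2 v, dom v &
     form_finite (fun x => u x - v x) /\ form_normsq (fun x => u x - v x) < e) ->
  dom u.
Proof.
move=> uf H; apply/dirichlet_domainE; split => // e e0.
(* Square norms satisfy only [|f + g|^2 <= 2 |f|^2 + 2 |g|^2], hence the quarters. *)
have e4 : 0 < e / 4 by rewrite divr_gt0.
have [v /dirichlet_domainE[vf vap] [uv1 uv2]] := H _ e4.
have [phi p1 [p2 p3]] := vap _ e4.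
exists phi => //.
have -> : (fun x => u x - phi x) = fun x => (u x - v x) + (v x - phi x).
  by apply/funext => x; ring.
split; last by have := form_normsqD uv1 p2; lra.
have := @form_finiteD 1 _ _ uv1 p2.
by under [X in form_finite X -> _]funext => x do rewrite mul1r.
Qed.

Lemma finitely_supportedD a phi psi : finitely_supported phi -> finitely_supported psi ->
  finitely_supported (fun x : V => a * phi x + psi x : R).
Proof.
move=> p q; apply: (sub_finite_set _ (_ : finite_set ([set x | phi x != 0] `|` [set x | psi x != 0]))).
  move=> x /=; have [->|] := eqVneq (phi x) 0; last by left.
  by rewrite mulr0 add0r; right.
by rewrite finite_setU.
Qed.

Lemma dirichlet_domainD a u v : dom u ->
  dom v ->
  dom (fun x => a * u x + v x).
Proof.
move=> /dirichlet_domainE[uf ua] /dirichlet_domainE[vf va].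
apply/dirichlet_domainE; split; first exact: form_finiteD.
move=> e e0.
(* Scaling by [a] multiplies the square norm by [a ^+ 2]; the [+ 1] keeps the denominator positive
   when [a = 0]. *)
have e1 : 0 < e / (4 * (a ^+ 2 + 1)) by rewrite divr_gt0// mulr_gt0// ltr_wpDl ?sqr_ge0.
have [phi p1 [p2 p3]] := ua _ e1.
have [|psi q1 [q2 q3]] := va (e / 4); first by rewrite divr_gt0.
exists (fun x => a * phi x + psi x); first exact: finitely_supportedD.
have -> : (fun x => a * u x + v x - (a * phi x + psi x)) =
  fun x => a * (u x - phi x) + (v x - psi x) by apply/funext => x; ring.
split; first exact: form_finiteD.
have := form_normsqD (form_finiteZ a p2) q2; rewrite form_normsqZ.
have : a ^+ 2 * form_normsq (fun x => u x - phi x) <= e / 4.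
  apply: (@le_trans _ _ ((a ^+ 2 + 1) * (e / (4 * (a ^+ 2 + 1))))).
    have a0 := sqr_ge0 a; have n0 := form_normsq_ge0 (fun x => u x - phi x).
    by apply: ler_pM => //; [rewrite lerDl|exact: ltW].
  rewrite le_eqVlt; apply/orP; left; apply/eqP.
  have : a ^+ 2 + 1 != 0 by rewrite gt_eqF// ltr_wpDl ?sqr_ge0.
  by move=> ?; field.
by lra.
Qed.

Lemma dirichlet_operatorD a u v w z :
  oper u w ->
  oper v z ->
  oper
    (fun x => a * u x + v x) (fun x => a * w x + z x).
Proof.
move=> [ud /in_l2_1 wl uw] [vd /in_l2_1 zl vz]; split.
- exact: dirichlet_domainD.
- by apply/in_l2_1/sq_summableD => //; exact: sq_summableZ.
move=> h hd; have := uw _ hd; have := vz _ hd; rewrite !energy_formE !inner_1.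
move: ud vd hd => /dirichlet_domainE[[u1 u2] _] /dirichlet_domainE[[v1 v2] _]
  /dirichlet_domainE[[h1 h2] _].
rewrite gradD !(dotDl (f := fun i => a * _)) ?dotZl//; try exact: sq_summableZ.
by move=> -> ->.
Qed.

Lemma dirichlet_operator_sym u v w z :
  oper u w ->
  oper v z -> dot w v = dot z u.
Proof.
move=> [ud _ uw] [vd _ vz].
by have := uw _ vd; have := vz _ ud; rewrite !energy_formE !inner_1 (dotC (grad v)) => -> ->.
Qed.

Lemma dirichlet_operator_ge0 u w :
  oper u w -> 0 <= dot w u.
Proof.
move=> [ud _ uw]; have := uw _ ud; rewrite energy_formE inner_1 => <-; exact: dotff_ge0.
Qed.

(** * Summation by parts *)

Lemma bmul_summable f : abs_summable (fun x => vdeg x * f x) ->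
  abs_summable (fun p : V * V => b p.1 p.2 * f p.1).
Proof.
have E x : \esum_(y in [set: V]) `|b x y * f x|%:E = `|vdeg x * f x|%:E.
  rewrite (eq_esum (b := fun y => (`|f x| * b x y)%:E)); last first.
    by move=> y _; rewrite normrM mulrC (ger0_norm (b0 _ _)).
  rewrite esumZl// -rsum_EFin//; last exact: b_summable.
  by rewrite -vdegE -EFinM normrM mulrC (ger0_norm (vdeg_ge0 x)).
rewrite /abs_summable (esum_pair (f := fun p : V * V => `|b p.1 p.2 * f p.1|%:E))//=.
by under [X in _ -> (X < _)%E]eq_esum => x _ do rewrite E.
Qed.

Lemma bmul_summable2 f g (M : R) : abs_summable (fun x => vdeg x * f x) ->
  (forall x, `|g x| <= M) ->
  abs_summable (fun p : V * V => b p.1 p.2 * f p.1 * g p.2).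
Proof.
move=> fs gM; apply: (abs_summable_le _ (abs_summableZ M (bmul_summable fs))) => p.
rewrite normrM [leRHS]normrM mulrC ler_wpM2r//.
by apply: (le_trans (gM _)); rewrite ler_norm.
Qed.

Definition bsum f (x : V) : R := rsum (fun y => b x y * f y).

Lemma bsum_ge0 f x : (forall y, 0 <= f y) -> 0 <= bsum f x.
Proof. by move=> f0; apply: rsum_ge0 => y; rewrite mulr_ge0. Qed.

Lemma bsum_summable f x (M : R) : (forall y, `|f y| <= M) -> abs_summable (fun y => b x y * f y).
Proof.
move=> fM; apply: (abs_summable_le _ (abs_summableZ M (b_summable x))) => y.
rewrite normrM [leRHS]normrM mulrC ler_wpM2r//.
by apply: (le_trans (fM _)); rewrite ler_norm.
Qed.

Lemma bsum_le f x (M : R) : (forall y, 0 <= f y <= M) -> bsum f x <= M * vdeg x.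
Proof.
move=> fM; rewrite vdegE -rsumZ; apply: ler_rsum.
- by apply: (@bsum_summable _ _ M) => y; have /andP[f0 fM'] := fM y; rewrite ger0_norm.
- exact/abs_summableZ/b_summable.
- by move=> y; have /andP[_ ?] := fM y; rewrite mulrC ler_wpM2r.
Qed.

Lemma dot_bsum f g (M : R) : abs_summable (fun x => vdeg x * f x) ->
  (forall x, `|g x| <= M) ->
  abs_summable (fun x => f x * bsum g x) /\
  rsum (fun p : V * V => b p.1 p.2 * f p.1 * g p.2) = dot f (bsum g).
Proof.
move=> fs gM; have [s e] := rsum_pair (bmul_summable2 fs gM).
have E x : rsum (fun y => b x y * f x * g y) = f x * bsum g x.
  by rewrite /bsum -rsumZ; congr rsum; apply/funext => y; ring.
move: s e => /=; under [X in abs_summable X]funext => x do rewrite E.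
by under [X in _ = rsum X]funext => x do rewrite E.
Qed.

(** Fubini in the other order: summing first over the vertex that carries [f], and exchanging the
    arguments of [b], moves [bsum] from [g] to [f]. *)
Lemma dot_bsum_sym f g (M : R) : abs_summable (fun x => vdeg x * f x) ->
  (forall x, `|g x| <= M) ->
  abs_summable (fun x => bsum f x * g x) /\ dot f (bsum g) = dot (bsum f) g.
Proof.
move=> fs gM; have [_ <-] := dot_bsum fs gM.
have bs := bmul_summable2 fs gM.
rewrite rsum_swap; have [s e] := rsum_pair (abs_summable_swap bs).
have E x : rsum (fun y => b y x * f y * g x) = bsum f x * g x.
  by rewrite mulrC /bsum -rsumZ; congr rsum; apply/funext => y; rewrite (bC x); ring.
move: s e => /=; under [X in abs_summable X]funext => x do rewrite E.
by under [X in _ = rsum X]funext => x do rewrite E.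
Qed.

(** With [F] the summand [b x y * f x * (g x - g y)], the product of the gradients is the half-sum
    of [F] and of [F] with its arguments exchanged. The weighted [l^1] condition on [f] against the
    sup bound on [g] makes [F] absolutely summable. *)
Lemma green_formula f g (M : R) : abs_summable (fun x => vdeg x * f x) ->
  (forall x, `|g x| <= M) ->
  dot (grad f) (grad g) = dot f (fun x => vdeg x * g x - bsum g x).
Proof.
move=> fs gM; have bs := bmul_summable2 fs gM.
have gs : abs_summable (fun p : V * V => b p.1 p.2 * (f p.1 * g p.1)).
  apply: (@bmul_summable (fun x => f x * g x)).
  apply: (abs_summable_le _ (abs_summableZ M fs)) => x.
  rewrite mulrA normrM [leRHS]normrM mulrC ler_wpM2r//.
  by apply: (le_trans (gM _)); rewrite ler_norm.
pose F (p : V * V) := b p.1 p.2 * (f p.1 * g p.1) - b p.1 p.2 * f p.1 * g p.2.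
have Fs : abs_summable F by exact: abs_summableB.
have -> : dot (grad f) (grad g) = rsum F.
  rewrite /dot (_ : (fun p => _) = fun p => 2^-1 * (F p + F (p.2, p.1))); last first.
    by apply/funext => p; rewrite grad_mul /F/= (bC p.2); ring.
  rewrite rsumZ rsumD//; last exact: (abs_summable_swap Fs).
  rewrite -(rsum_swap F); lra.
rewrite /F rsumB//; have [s ->] := dot_bsum fs gM.
have [s2 ->] := rsum_pair gs.
have E x : rsum (fun y => b x y * (f x * g x)) = f x * (vdeg x * g x).
  by rewrite mulrCA [RHS]mulrC vdegE -rsumZ; congr rsum; apply/funext => y; rewrite mulrC.
move: s2 => /=; under [X in abs_summable X]funext => x do rewrite E.
under [X in _ -> rsum X - _ = _]funext => x do rewrite E.
move=> s2; rewrite /dot -rsumB//; congr rsum; apply/funext => x; ring.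
Qed.

Lemma grad_le u : abs_summable (fun x => vdeg x * u x ^+ 2) ->
  sq_summable (grad u) /\ dot (grad u) (grad u) <= 2 * rsum (fun x => vdeg x * u x ^+ 2).
Proof.
move=> us; have bs := bmul_summable us; have bs' := abs_summable_swap bs.
have le p : grad u p ^+ 2 <= b p.1 p.2 * u p.1 ^+ 2 + b p.2 p.1 * u p.2 ^+ 2.
  rewrite expr2 grad_mul (bC p.2) -mulrDr -mulrA -expr2 mulrCA ler_wpM2l//.
  by have := sqr_ge0 (u p.1 + u p.2); rewrite !expr2; nra.
have s := abs_summableD bs bs'.
have gs : sq_summable (grad u).
  apply: (abs_summable_le _ s) => p; rewrite !ger0_norm ?sqr_ge0//=.
  by rewrite addr_ge0// mulr_ge0// sqr_ge0.
split=> //; rewrite dot_sq; apply: (le_trans (ler_rsum gs s le)).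
rewrite rsumD// -(rsum_swap (fun p : V * V => b p.1 p.2 * u p.1 ^+ 2)).
have [_ ->] := rsum_pair bs.
have E x : rsum (fun y => b x y * u x ^+ 2) = vdeg x * u x ^+ 2.
  by rewrite mulrC vdegE -rsumZ; congr rsum; apply/funext => y; rewrite mulrC.
rewrite /=; under [X in rsum X + _]funext => x do rewrite E.
by under [X in _ + rsum X]funext => x do rewrite E; lra.
Qed.

(** The form norm is dominated by the [l^2] norm with weight [vdeg + 1], in which truncations to
    finite sets converge. The factor 2 is that of [grad_le]. *)
Lemma dirichlet_domain_deg u : abs_summable (fun x => (vdeg x + 1) * u x ^+ 2) -> dom u.
Proof.
have d1 x : 0 <= (vdeg x + 1) by rewrite addr_ge0 ?vdeg_ge0.
have norm_le v : abs_summable (fun x => (vdeg x + 1) * v x ^+ 2) ->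
    form_finite v /\ form_normsq v <= 2 * rsum (fun x => (vdeg x + 1) * v x ^+ 2).
  move=> vs.
  have vs1 : abs_summable (fun x => vdeg x * v x ^+ 2).
    apply: (abs_summable_le _ vs) => x.
    rewrite (ger0_norm (mulr_ge0 (vdeg_ge0 x) (sqr_ge0 _))).
    rewrite (ger0_norm (mulr_ge0 (d1 x) (sqr_ge0 _))).
    by rewrite ler_wpM2r ?sqr_ge0// lerDl.
  have vs2 : sq_summable v.
    apply: (abs_summable_le _ vs) => x.
    rewrite (ger0_norm (sqr_ge0 _)) (ger0_norm (mulr_ge0 (d1 x) (sqr_ge0 _))).
    by rewrite ler_peMl ?sqr_ge0// lerDr vdeg_ge0.
  have [g1 g2] := grad_le vs1; split => //.
  rewrite (_ : (fun x => _) = fun x => vdeg x * v x ^+ 2 + v x ^+ 2); last first.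
    by apply/funext => x; rewrite mulrDl mul1r.
  by rewrite rsumD// /form_normsq -dot_sq; have := dotff_ge0 v; lra.
move=> us; have [uf _] := norm_le _ us.
apply/dirichlet_domainE; split => // e e0.
have [||X finX XE] := esum_tail (e := e / 2) _ us.
- by move=> x; rewrite mulr_ge0 ?sqr_ge0.
- by rewrite divr_gt0.
pose phi x := if x \in X then u x else 0.
exists phi.
  apply: sub_finite_set finX => x /=; rewrite /phi; case: ifPn => [/set_mem//|_].
  by rewrite eqxx.
have E x : (vdeg x + 1) * (u x - phi x) ^+ 2 = if x \in X then 0 else (vdeg x + 1) * u x ^+ 2.
  by rewrite /phi; case: ifPn => _; rewrite ?subrr ?expr0n ?mulr0 ?subr0.
have s : abs_summable (fun x => (vdeg x + 1) * (u x - phi x) ^+ 2).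
  by apply: (abs_summable_le _ us) => x; rewrite E; case: ifPn => _ //; rewrite normr0.
have [f1 f2] := norm_le _ s; split => //.
apply: (le_lt_trans f2); rewrite -ltr_pdivlMl// mulrC.
rewrite -lte_fin rsum_EFin//; last by move=> x; rewrite mulr_ge0 ?sqr_ge0.
by under eq_esum => x _ do rewrite E.
Qed.

End Dirichlet.

(** * Resolvents as Neumann series *)

Section Resolvent.
Context {R : realType} {V : countType}.
Variable b : V -> V -> R.
Hypothesis bG : weighted_graph b (fun=> 0).

Let b0 x y : 0 <= b x y := graph_b_ge0 bG x y.
Let bC x y : b x y = b y x := graph_b_sym bG x y.
Local Notation dom := (dirichlet_domain b (fun=> 0) (fun=> 1)).
Local Notation oper := (dirichlet_operator b (fun=> 0) (fun=> 1)).
Local Notation d := (vdeg b).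

Variables (alpha : R) (r : V -> R).
Hypothesis alpha0 : 0 < alpha.

(** The operator [L + alpha] splits into the diagonal [d + alpha] minus the adjacency operator
    [bsum]; the series expands its inverse around the diagonal. *)
Fixpoint neumann n x : R :=
  (if n is n'.+1 then bsum b (neumann n') x else r x) / (d x + alpha).

Definition neumann_sum n x : R := \sum_(k < n) neumann k x.

Definition resolvent x : R := limn (neumann_sum ^~ x).

Hypothesis r0 : forall x, 0 <= r x.
Hypothesis rs : abs_summable r.

Local Notation t := neumann.
Local Notation S := neumann_sum.
Let B := rsum r / alpha.

Let da0 x : 0 < d x + alpha.
Proof. by rewrite ltr_wpDl// vdeg_ge0. Qed.

Lemma neumann_ge0 n x : 0 <= t n x.
Proof.
elim: n x => [|n IH] x /=; first by rewrite divr_ge0// ltW.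
by rewrite divr_ge0 ?bsum_ge0// ltW.
Qed.

Let B0 : 0 <= B.
Proof. by rewrite divr_ge0 ?rsum_ge0 ?ltW. Qed.

Lemma neumann_le n x : t n x <= B.
Proof.
have BE : B * alpha = rsum r by rewrite /B divfK// gt_eqF.
elim: n x => [|n IH] x /=; rewrite ler_pdivrMr// mulrDr BE.
  by apply: (ler_wpDl _ (ler_rsum1 x rs r0)); rewrite mulr_ge0 ?vdeg_ge0.
apply: ler_wpDr; first exact: rsum_ge0.
by apply: bsum_le => // y; rewrite neumann_ge0 IH.
Qed.

Lemma neumann_norm n x : `|t n x| <= B.
Proof. by rewrite ger0_norm ?neumann_ge0 ?neumann_le. Qed.

Lemma neumann_rec n x : (d x + alpha) * t n.+1 x = bsum b (t n) x.
Proof. by rewrite mulrC divfK// gt_eqF. Qed.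

Lemma neumann0 x : (d x + alpha) * t 0 x = r x.
Proof. by rewrite mulrC divfK// gt_eqF. Qed.

Lemma neumann_sumS n x : S n.+1 x = S n x + t n x.
Proof. by rewrite /neumann_sum big_ord_recr. Qed.

Lemma neumann_sum_ge0 n x : 0 <= S n x.
Proof. by apply: sumr_ge0 => k _; exact: neumann_ge0. Qed.

Lemma neumann_sum_nd x : nondecreasing_seq (S ^~ x).
Proof. by apply/nondecreasing_seqP => n; rewrite neumann_sumS lerDl neumann_ge0. Qed.

Lemma neumann_sum_rec n x : (d x + alpha) * S n.+1 x = r x + bsum b (S n) x.
Proof.
(* A crude bound growing with [m], enough to split [bsum] of a sum. The uniform bound of
   [neumann_sum_le] is deduced from the present identity. *)
have Sb m y : `|S m y| <= B *+ m.
  rewrite ger0_norm ?neumann_sum_ge0//.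
  elim: m => [|m IH]; first by rewrite /neumann_sum big_ord0.
  by rewrite neumann_sumS mulrSr lerD// neumann_le.
elim: n => [|n IH].
  rewrite neumann_sumS {1}/neumann_sum big_ord0 add0r neumann0.
  rewrite (_ : bsum _ _ _ = 0) ?addr0// /bsum -[RHS](@rsum0 R V); congr rsum.
  by apply/funext => y; rewrite /neumann_sum big_ord0 mulr0.
rewrite neumann_sumS mulrDr IH neumann_rec -addrA; congr (_ + _).
rewrite /bsum -rsumD; last 2 first.
- exact/(bsum_summable bG)/Sb.
- exact/(bsum_summable bG)/neumann_norm.
by congr rsum; apply/funext => y; rewrite neumann_sumS mulrDr.
Qed.

(** The constant function [B] is a supersolution: [(d + alpha) B - bsum B = alpha B = rsum r], which
    dominates [r] pointwise. The recursion preserves this comparison. *)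
Lemma neumann_sum_le n x : S n x <= B.
Proof.
have BE : B * alpha = rsum r by rewrite /B divfK// gt_eqF.
elim: n x => [|n IH] x; first by rewrite /neumann_sum big_ord0.
rewrite -(ler_pM2l (da0 x)) neumann_sum_rec mulrDl addrC lerD//.
  rewrite mulrC; apply: (bsum_le bG) => y; by rewrite neumann_sum_ge0 IH.
by rewrite mulrC BE ler_rsum1.
Qed.

Lemma neumann_sum_cvg x : S n x @[n --> \oo] --> resolvent x.
Proof.
apply: nondecreasing_is_cvgn; first exact: neumann_sum_nd.
by exists B => _ [n _ <-]; exact: neumann_sum_le.
Qed.

Arguments neumann_sum_cvg : clear implicits.

Lemma neumann_sum_resolvent n x : S n x <= resolvent x.
Proof. by apply: nondecreasing_cvgn_le; [exact: neumann_sum_nd|exact: neumann_sum_cvg]. Qed.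

Lemma resolvent_ge0 x : 0 <= resolvent x.
Proof. by have := neumann_sum_resolvent 0 x; rewrite /neumann_sum big_ord0. Qed.

Lemma resolvent_le x : resolvent x <= B.
Proof. by apply: (cvgr_to_le (neumann_sum_cvg x)); apply: nearW => n; exact: neumann_sum_le. Qed.

Lemma resolvent_eq x : (d x + alpha) * resolvent x = r x + bsum b resolvent x.
Proof.
have c1 : (d x + alpha) * S n.+1 x @[n --> \oo] --> (d x + alpha) * resolvent x.
  apply: cvgM; first exact: cvg_cst.
  by have := neumann_sum_cvg x; rewrite -(cvg_shiftS (S ^~ x)).
have c2 : r x + bsum b (S n) x @[n --> \oo] --> r x + bsum b resolvent x.
  apply: cvgD; first exact: cvg_cst.
  apply: rsum_cvg => [n y|y m n mn|y|].
  - by rewrite mulr_ge0 ?neumann_sum_ge0.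
  - by rewrite ler_wpM2l// neumann_sum_nd.
  - by apply: cvgM; [exact: cvg_cst|exact: neumann_sum_cvg].
  - by apply: (@bsum_summable _ _ _ bG _ _ B) => y; rewrite ger0_norm ?resolvent_ge0 ?resolvent_le.
rewrite -(cvg_lim _ c1)// -(cvg_lim _ c2)//; congr (limn _).
by apply/funext => n; rewrite neumann_sum_rec.
Qed.

(** The defect of the [n]-th partial sum, as a solution of the resolvent equation, is the first
    omitted term times the diagonal. *)
Lemma neumann_sum_deg n x : (d x + alpha) * S n x - bsum b (S n) x = r x - (d x + alpha) * t n x.
Proof.
have := neumann_sum_rec n x; rewrite neumann_sumS mulrDr; lra.
Qed.

Lemma summable_of_deg f : abs_summable (fun x => (d x + alpha) * f x) ->
  abs_summable (fun x => d x * f x) /\ abs_summable f.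
Proof.
move=> fs; split; first apply: abs_summable_le fs => x.
  rewrite !normrM ler_wpM2r// (ger0_norm (vdeg_ge0 bG x)) (ger0_norm (ltW (da0 x))).
  by rewrite lerDl ltW.
apply: (abs_summable_le _ (abs_summableZ alpha^-1 fs)) => x.
rewrite mulrA normrM -[leLHS]mul1r ler_wpM2r//.
rewrite (ger0_norm (mulr_ge0 _ (ltW (da0 x)))) ?invr_ge0 ?(ltW alpha0)//.
by rewrite ler_pdivlMl// mulr1 lerDr vdeg_ge0.
Qed.

Lemma neumann_deg_summable n : abs_summable (fun x => (d x + alpha) * t n x).
Proof.
elim: n => [|n IH]; first by under [X in abs_summable X]funext => x do rewrite neumann0.
under [X in abs_summable X]funext => x do rewrite neumann_rec.
(* Testing against the constant 1 turns the weighted summability of [t n] into the summability of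
   [bsum b (t n)]. *)
have [|s _] := @dot_bsum_sym _ _ _ bG (t n) (fun=> 1) 1 (summable_of_deg IH).1; first by rewrite normr1.
by under [X in abs_summable X]funext => x do rewrite -[bsum _ _ _]mulr1.
Qed.

Lemma neumann_sum_deg_summable n : abs_summable (fun x => (d x + alpha) * S n x).
Proof.
elim: n => [|n IH].
  rewrite (_ : (fun x => _) = fun=> 0); first exact: abs_summable0.
  by apply/funext => x; rewrite /neumann_sum big_ord0 mulr0.
under [X in abs_summable X]funext => x do rewrite neumann_sumS mulrDr.
exact/abs_summableD/neumann_deg_summable.
Qed.

Lemma rsum_bsum f : abs_summable (fun x => (d x + alpha) * f x) ->
  rsum (bsum b f) = rsum (fun x => d x * f x).
Proof.
move=> /summable_of_deg[fs fs'].
have [|s] := @dot_bsum_sym _ _ _ bG f (fun=> 1) 1 fs; first by rewrite normr1.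
rewrite /dot; under [X in _ = rsum X -> _]funext => x do rewrite mulr1.
move=> <-; congr rsum; apply/funext => x; rewrite [RHS]mulrC (vdegE bG); congr (_ * _).
by congr rsum; apply/funext => y; rewrite mulr1.
Qed.

(** Mass balance: summing the recursion over [V] gives [rsum (d S n.+1) + alpha * rsum (S n.+1) =
    rsum r + rsum (d S n)], and the degree terms compare because the partial sums increase. *)
Lemma rsum_neumann_sum n : rsum (S n) <= B.
Proof.
have Ss m := summable_of_deg (neumann_sum_deg_summable m).
case: n => [|n].
  rewrite (_ : S 0 = fun=> 0) ?rsum0//.
  by apply/funext => x; rewrite /neumann_sum big_ord0.
have bs : abs_summable (bsum b (S n)).
  have [|s _] := @dot_bsum_sym _ _ _ bG (S n) (fun=> 1) 1 (Ss n).1; first by rewrite normr1.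
  by under [X in abs_summable X]funext => x do rewrite -[bsum _ _ _]mulr1.
have E : rsum (fun x => (d x + alpha) * S n.+1 x) = rsum r + rsum (fun x => d x * S n x).
  rewrite -(rsum_bsum (neumann_sum_deg_summable n)) -rsumD//; congr rsum.
  by apply/funext => x; rewrite neumann_sum_rec.
have E2 : rsum (fun x => (d x + alpha) * S n.+1 x) =
    rsum (fun x => d x * S n.+1 x) + alpha * rsum (S n.+1).
  rewrite -rsumZ -rsumD; [|exact: (Ss _).1|exact/abs_summableZ/(Ss _).2].
  by congr rsum; apply/funext => x; rewrite mulrDl.
have : rsum (fun x => d x * S n x) <= rsum (fun x => d x * S n.+1 x).
  apply: ler_rsum; [exact: (Ss _).1..|move=> x].
  by rewrite ler_wpM2l ?vdeg_ge0// neumann_sumS lerDl neumann_ge0.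
rewrite /B ler_pdivlMr// mulrC; lra.
Qed.

Lemma resolvent_summable : abs_summable resolvent.
Proof.
have [] := @rsum_fatou _ _ S resolvent B => //.
- exact: neumann_sum_ge0.
- exact: neumann_sum_cvg.
- by move=> n; have [] := summable_of_deg (neumann_sum_deg_summable n).
- by apply: nearW => n; exact: rsum_neumann_sum.
Qed.

(* The kernel of [b] being symmetric, only the total number of steps matters. *)
Lemma dot_neumann k n : dot (fun x => (d x + alpha) * t k x) (t n) = dot r (t (k + n)).
Proof.
elim: k n => [|k IH] n.
  by rewrite [X in dot X _](funext neumann0).
rewrite addSnnS -IH.
under [X in dot X _]funext => x do rewrite neumann_rec.
have [ds _] := summable_of_deg (neumann_deg_summable k).
have [_ <-] := dot_bsum_sym bG ds (neumann_norm n).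
congr rsum; apply/funext => x; rewrite -neumann_rec; ring.
Qed.

Lemma neumann_sum_domain n : dom (S n).
Proof.
apply: (dirichlet_domain_deg bG).
have [s1 s2] := summable_of_deg (neumann_sum_deg_summable n).
have := abs_summableZ B (abs_summableD s1 s2).
apply: abs_summable_le => x; have Sx0 := neumann_sum_ge0 n x.
rewrite (_ : d x * S n x + S n x = (d x + 1) * S n x); last by ring.
rewrite expr2 mulrCA normrM [leRHS]normrM ler_wpM2r//.
by rewrite !ger0_norm// neumann_sum_le.
Qed.

Lemma neumann_sum_norm n x : `|S n x| <= B.
Proof. by rewrite ger0_norm ?neumann_sum_ge0 ?neumann_sum_le. Qed.

Lemma resolvent_norm x : `|resolvent x| <= B.
Proof. by rewrite ger0_norm ?resolvent_ge0 ?resolvent_le. Qed.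

(** This sums [dot_neumann] over the indices [n <= k < n + m], which the identity shifts to
    [2 n <= n + k < 2 n + m]. *)
Lemma dot_neumann_sum n m :
  dot (fun x => (d x + alpha) * t n x) (fun x => S (n + m) x - S n x) =
  rsum (fun x => r x * (S (n + n + m) x - S (n + n) x)).
Proof.
have s1 := neumann_deg_summable n.
have Sd k l x : `|S k x - S l x| <= B + B.
  by apply: (le_trans (ler_normB _ _)); rewrite lerD// neumann_sum_norm.
elim: m => [|m IH].
  by rewrite !addn0; congr rsum; apply/funext => x; rewrite !subrr !mulr0.
rewrite !addnS.
transitivity (dot (fun x => (d x + alpha) * t n x) (fun x => S (n + m) x - S n x) +
   dot (fun x => (d x + alpha) * t n x) (t (n + m))).
  rewrite /dot -rsumD.
  - by congr rsum; apply/funext => x; rewrite neumann_sumS; ring.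
  - by apply: (bounded_mul_summable s1) => x; exact: Sd.
  - by apply: (bounded_mul_summable s1) => x; exact: neumann_norm.
rewrite IH dot_neumann addnA /dot -rsumD.
- by congr rsum; apply/funext => x; rewrite neumann_sumS; ring.
- by apply: (bounded_mul_summable rs) => x; exact: Sd.
- by apply: (bounded_mul_summable rs) => x; exact: neumann_norm.
Qed.

Definition resolvent_tail n : R := rsum (fun x => r x * (resolvent x - S n x)).

(* [(d + alpha) v - bsum v] telescopes to [(d + alpha) (t n - t (n + m))]. *)
Lemma neumann_sum_cauchy n m (v := fun x => S (n + m) x - S n x) :
  dot (grad b v) (grad b v) + alpha * dot v v <= resolvent_tail n.
Proof.
have v0 x : 0 <= v x by rewrite subr_ge0 neumann_sum_nd// leq_addr.
have vB x : `|v x| <= B.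
  by rewrite ger0_norm// lerBlDr; apply: ler_wpDr; rewrite ?neumann_sum_ge0 ?neumann_sum_le.
have vs : abs_summable (fun x => (d x + alpha) * v x).
  rewrite (_ : (fun x => _) = fun x => (d x + alpha) * S (n + m) x - (d x + alpha) * S n x).
    by apply: abs_summableB; exact: neumann_sum_deg_summable.
  by apply/funext => x; rewrite -mulrBr.
have [dv v1] := summable_of_deg vs.
have bv x : bsum b v x = bsum b (S (n + m)) x - bsum b (S n) x.
  rewrite /bsum -rsumB; last 2 first.
  - exact/(bsum_summable bG)/neumann_sum_norm.
  - exact/(bsum_summable bG)/neumann_sum_norm.
  by congr rsum; apply/funext => y; rewrite mulrBr.
have [s1 _] := dot_bsum bG dv vB.
have s2 := bounded_mul_summable dv vB.
have s3 : sq_summable v by exact: bounded_sq_summable v1 vB.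
have s4 : abs_summable (fun x => v x * (d x * v x - bsum b v x)).
  rewrite (_ : (fun x => _) = fun x => d x * v x * v x - v x * bsum b v x).
    exact: abs_summableB.
  by apply/funext => x; ring.
rewrite (green_formula bG dv vB) dot_sq -rsumZ -rsumD//; last exact: abs_summableZ.
have s5 := neumann_deg_summable n.
have s6 : abs_summable (fun x => (d x + alpha) * t n x * v x) by exact: bounded_mul_summable s5 vB.
have s7 : abs_summable (fun x => v x * (d x * v x - bsum b v x) + alpha * v x ^+ 2).
  by apply: abs_summableD => //; exact: abs_summableZ.
(* The contribution of [t (n + m)] has a favourable sign and is dropped; multiplication by [v >= 0]
   preserves the inequality. *)
apply: (@le_trans _ _ (dot (fun x => (d x + alpha) * t n x) v)).
  apply: ler_rsum => // x.
  rewrite [leLHS](_ : _ = v x * ((d x + alpha) * v x - bsum b v x)); last by ring.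
  rewrite [leRHS]mulrC ler_wpM2l// bv /v.
  have := neumann_sum_deg n x; have := neumann_sum_deg (n + m) x.
  have : 0 <= (d x + alpha) * t (n + m) x by rewrite mulr_ge0 ?neumann_ge0 ?ltW.
  rewrite mulrBr; lra.
(* It remains to use that [S (2 n + m)] is at most the resolvent and [S (2 n)] at least [S n]. *)
rewrite dot_neumann_sum /resolvent_tail.
have Bd k l x : `|resolvent x - S k x| <= B + B /\ `|S k x - S l x| <= B + B.
  by split; apply: (le_trans (ler_normB _ _)); rewrite lerD// ?neumann_sum_norm ?resolvent_norm.
apply: ler_rsum => [||x].
- exact: (bounded_mul_summable rs (fun x => (Bd (n + n + m)%N (n + n)%N x).2)).
- exact: (bounded_mul_summable rs (fun x => (Bd n 0%N x).1)).
rewrite ler_wpM2l// lerB// ?neumann_sum_resolvent//.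
by rewrite neumann_sum_nd// leq_addr.
Qed.

Lemma resolvent_tail_cvg : resolvent_tail n @[n --> \oo] --> 0.
Proof.
have c : rsum (fun x => r x * S n x) @[n --> \oo] --> rsum (fun x => r x * resolvent x).
  apply: rsum_cvg => [n x|x n m nm|x|].
  - by rewrite mulr_ge0 ?neumann_sum_ge0.
  - by rewrite ler_wpM2l// neumann_sum_nd.
  - by apply: cvgM; [exact: cvg_cst|exact: neumann_sum_cvg].
  - by apply: (bounded_mul_summable rs) => x; exact: resolvent_norm.
rewrite (_ : resolvent_tail = fun n => rsum (fun x => r x * resolvent x) - rsum (fun x => r x * S n x)).
  rewrite -(subrr (rsum (fun x => r x * resolvent x))).
  by apply: cvgB => //; exact: cvg_cst.
apply/funext => n; rewrite -rsumB.
- by congr rsum; apply/funext => x; rewrite mulrBr.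
- exact: (bounded_mul_summable rs resolvent_norm).
- exact: (bounded_mul_summable rs (neumann_sum_norm n)).
Qed.

(** Fatou as [m] tends to infinity in [neumann_sum_cauchy]: the energy is at most the tail, and the
    square norm at most [alpha^-1] times the tail. *)
Lemma resolvent_approx n : form_finite b (fun x => resolvent x - S n x) /\
  form_normsq b (fun x => resolvent x - S n x) <= (1 + alpha^-1) * resolvent_tail n.
Proof.
have cv x : S (n + m) x - S n x @[m --> \oo] --> resolvent x - S n x.
  apply: cvgB; last exact: cvg_cst.
  have := neumann_sum_cvg x; rewrite -(cvg_shiftn n).
  by under eq_fun do rewrite addnC.
have Df m : form_finite b (fun x => S (n + m) x - S n x).
  have := @dirichlet_domainD _ _ _ bG (-1) _ _ (neumann_sum_domain n) (neumann_sum_domain (n + m)).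
  move=> /(dirichlet_domainE bG)[+ _].
  by under [X in form_finite _ X -> _]funext => x do rewrite mulN1r addrC.
have g0 m := dotff_ge0 (grad b (fun x => S (n + m) x - S n x)).
have q0 m := dotff_ge0 (fun x => S (n + m) x - S n x).
have [] := @sq_summable_fatou _ _ (fun m => grad b (fun x => S (n + m) x - S n x))
  (grad b (fun x => resolvent x - S n x)) (resolvent_tail n).
- by move=> p; apply: cvgM; [exact: cvg_cst|apply: cvgB].
- by move=> m; have [] := Df m.
- apply: nearW => m; apply: le_trans (neumann_sum_cauchy n m).
  by rewrite lerDl mulr_ge0 ?q0 ?ltW.
move=> f1 l1.
have [] := @sq_summable_fatou _ _ (fun m x => S (n + m) x - S n x)
  (fun x => resolvent x - S n x) (alpha^-1 * resolvent_tail n).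
- exact: cv.
- by move=> m; have [] := Df m.
- apply: nearW => m; rewrite ler_pdivlMl//; apply: le_trans (neumann_sum_cauchy n m).
  by rewrite lerDr g0.
move=> f2 l2; split => //; rewrite mulrDl mul1r; exact: lerD.
Qed.

Lemma resolvent_domain : dom resolvent.
Proof.
have rf : form_finite b resolvent.
  have [] := resolvent_approx 0.
  by under [X in form_finite _ X -> _]funext => x do rewrite /neumann_sum big_ord0 subr0.
apply: (dirichlet_domain_limit bG rf) => e e0.
have C0 : 0 < 1 + alpha^-1 by rewrite addr_gt0 ?invr_gt0.
have e1 : 0 < e / (1 + alpha^-1) by rewrite divr_gt0.
have /cvgr_lt /(_ _ e1) [n _ /(_ n (leqnn n)) H] := resolvent_tail_cvg.
have [f1 f2] := resolvent_approx n.
exists (S n); first exact: neumann_sum_domain.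
by split => //; apply: (le_lt_trans f2); rewrite mulrC -ltr_pdivlMr.
Qed.

(** Against finitely supported functions the weak equation is Green's formula together with
    [resolvent_eq]. Both sides are continuous for the form norm, so it extends to the closure. *)
Lemma resolvent_operator : oper resolvent (fun x => r x - alpha * resolvent x).
Proof.
set w := fun x => r x - alpha * resolvent x.
have [rf _] := (dirichlet_domainE bG _).1 resolvent_domain.
have ws : sq_summable w.
  apply: sq_summableB; last exact/sq_summableZ/(proj2 rf).
  by apply: (@bounded_sq_summable _ _ _ (rsum r)) => // x; rewrite ger0_norm// ler_rsum1.
split; [exact: resolvent_domain|exact/in_l2_1|move=> v /(dirichlet_domainE bG)[[v1 v2] va]].
rewrite (energy_formE bG) inner_1.
pose X := dot (grad b resolvent) (grad b v) - dot w v.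
(* [X] is a difference [P - Q] of two functionals evaluated at [v - phi]; [K] collects their
   Cauchy-Schwarz constants, doubled by [(P - Q)^2 <= 2 P^2 + 2 Q^2]. *)
pose K := 2 * (dot (grad b resolvent) (grad b resolvent) + dot w w).
have K0 : 0 <= K by rewrite mulr_ge0// addr_ge0 ?dotff_ge0.
have XK (e : R) : 0 < e -> X ^+ 2 <= K * e.
  move=> /va[phi phi0 [[p1 p2] pe]].
  have E : dot (grad b resolvent) (grad b phi) = dot w phi.
    have ps : abs_summable (fun x => d x * phi x).
      have [X' finX pX] : exists2 X' : set V, finite_set X' & forall x, x \notin X' -> phi x = 0.
        by exists [set x | phi x != 0] => // x; rewrite notin_setE /= => /negP; rewrite negbK => /eqP.
      rewrite /abs_summable (_ : (\esum_(x in [set: V]) `|d x * phi x|%:E)%E =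
        (\sum_(x \in X') `|d x * phi x|%:E)%E); last first.
        rewrite -esum_fset//; rewrite [RHS]esum_mkcond; apply: eq_esum => x _.
        by case: ifPn => // /pX ->; rewrite mulr0 normr0.
      by rewrite fsbig_finite//= sumEFin ltry.
    rewrite dotC (green_formula bG ps resolvent_norm) dotC.
    rewrite [X in dot X phi](_ : _ = w)//; apply/funext => x.
    by have := resolvent_eq x; rewrite /w mulrDl; lra.
  have [ps1 ps2] : sq_summable (grad b phi) /\ sq_summable phi.
    split.
    - rewrite (_ : grad b phi = fun p => grad b v p - grad b (fun x => v x - phi x) p).
        exact: sq_summableB.
      by apply/funext => p; rewrite /grad; ring.
    - rewrite (_ : phi = fun x => v x - (v x - phi x)); first exact: sq_summableB.
      by apply/funext => x; ring.
  have -> : X = dot (grad b resolvent) (grad b (fun x => v x - phi x)) -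
      dot w (fun x => v x - phi x).
    have [r1 _] := rf.
    rewrite /X gradB !dotBr// E; ring.
  have c1 := cauchy_schwarz (proj1 rf) p1; have c2 := cauchy_schwarz ws p2.
  move: c1 c2 pe; rewrite /K /form_normsq.
  move: (dotff_ge0 (grad b resolvent)) (dotff_ge0 w).
  move: (dotff_ge0 (grad b (fun x => v x - phi x))) (dotff_ge0 (fun x => v x - phi x)).
  set A := dot (grad b resolvent) (grad b resolvent); set W := dot w w.
  set n1 := dot (grad b (fun x => v x - phi x)) _; set n2 := dot (fun x => v x - phi x) _.
  set P := dot _ _; set Q := dot w _ => n10 n20 A0 W0 PA QW ne.
  apply: (@le_trans _ _ (2 * P ^+ 2 + 2 * Q ^+ 2)).
    by have := sqr_ge0 (P + Q); rewrite !expr2; nra.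
  by nra.
apply/eqP; rewrite -subr_eq0 -sqrf_eq0 -/X eq_le sqr_ge0 andbT.
rewrite leNgt; apply/negP => X0.
(* This error makes the bound of [XK] smaller than [X ^+ 2]; the [+ 1] covers [K = 0]. *)
have /XK : 0 < X ^+ 2 / (2 * (K + 1)) by rewrite divr_gt0// mulr_gt0// ltr_wpDl.
rewrite leNgt => /negP; apply.
rewrite mulrCA -[ltRHS]mulr1 ltr_pM2l// ltr_pdivrMr; first by lra.
by rewrite mulr_gt0// ltr_wpDl.
Qed.

End Resolvent.

(** * Integrals and linear functionals *)

Section MeasureLemmas.
Context {d : measure_display} {T : measurableType d} {R : realType}.

Import HBNNSimple.

(** The integral against a bare set function reads it only on the level sets of simple functions.
    This replaces [spectral_distribution], meaningful on measurable sets only, by a genuine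
    measure. *)
Lemma eq_set_function_integral (nu : set T -> \bar R) (mu : {measure set T -> \bar R}) (f : T -> \bar R) :
  (forall A, measurable A -> nu A = mu A) ->
  (\int[nu]_x f x = \int[mu]_x f x)%E.
Proof.
move=> numu; have E (h : {nnsfun T >-> R}) : sintegral nu h = sintegral mu h.
  by apply: eq_fsbigr => r _; rewrite numu.
rewrite /integral; congr (ereal_sup _ - ereal_sup _)%E;
  by apply/seteqP; split => _ [h hf <-]; exists h.
Qed.

Lemma nnsfun_integral_density (nu1 nu2 mu : {measure set T -> \bar R}) (phi : T -> R)
    (h : {nnsfun T >-> R}) :
  measurable_fun setT phi -> (forall x, 0 <= phi x) ->
  (forall A, measurable A -> (nu1 A = nu2 A + \int[mu]_(x in A) (phi x)%:E)%E) ->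
  (\int[nu1]_x (h x)%:E = \int[nu2]_x (h x)%:E + \int[mu]_x (h x * phi x)%:E)%E.
Proof.
move=> mphi phi0 nuE.
rewrite !integralT_nnsfun !sintegralE.
have -> : (\int[mu]_x (h x * phi x)%:E =
    \int[mu]_x (\sum_(r \in range h) ((r * \1_(h @^-1` [set r]) x)%:E * (phi x)%:E)))%E.
  apply: eq_integral => x _; rewrite -ge0_mule_fsuml; last first.
    by move=> r; rewrite EFinM nnfun_muleindic_ge0.
  by rewrite fsumEFin// -fimfunE EFinM.
rewrite ge0_integral_fsum//; last 2 first.
- move=> r; apply/measurable_EFinP/measurable_funM => //; exact: measurable_funM.
- move=> r x _; apply: mule_ge0; last by rewrite lee_fin.
  by rewrite EFinM nnfun_muleindic_ge0.
rewrite -fsbig_split//; apply: eq_fsbigr => _ /set_mem [t _ <-].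
rewrite nuE// muleDr; last 2 first.
- by [].
- by apply: ge0_adde_def; rewrite inE// integral_ge0// => x _; rewrite lee_fin.
congr (_ + _)%E; rewrite integral_mkcond -ge0_integralZl//.
- apply: eq_integral => x _; rewrite patchE/= indicE.
  by case: ifPn => _; rewrite ?mulr1 ?mulr0 ?mule0 ?mul0e.
- apply/(measurable_restrict _ _ _) => //; rewrite setTI.
  by apply/measurable_EFinP/measurable_funTS.
- by move=> x _; rewrite patchE; case: ifPn => // _; rewrite lee_fin.
- by rewrite lee_fin.
Qed.

(** The hypothesis says that the signed measure [nu1 - nu2] has density [phi] with respect to [mu];
    the additive form makes sense for infinite integrals too. For [nu2 = 0] it is the usual change
    of density. Simple functions come first, then monotone convergence. *)
Lemma ge0_integral_density (nu1 nu2 mu : {measure set T -> \bar R}) (phi psi : T -> R) :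
  measurable_fun setT phi -> (forall x, 0 <= phi x) ->
  (forall A, measurable A -> (nu1 A = nu2 A + \int[mu]_(x in A) (phi x)%:E)%E) ->
  measurable_fun setT psi -> (forall x, 0 <= psi x) ->
  (\int[nu1]_x (psi x)%:E = \int[nu2]_x (psi x)%:E + \int[mu]_x (psi x * phi x)%:E)%E.
Proof.
move=> mphi phi0 nuE mpsi psi0.
have mpsi' : measurable_fun setT (EFin \o psi) by exact/measurable_EFinP.
pose h := nnsfun_approx measurableT mpsi'.
have hcvg x : (h n x)%:E @[n --> \oo] --> (psi x)%:E.
  by apply: (@cvg_nnsfun_approx _ _ _ _ measurableT _ mpsi') => // y _; rewrite lee_fin.
have hnd x : nondecreasing_seq (h ^~ x).
  by move=> m n mn; exact/lefP/nd_nnsfun_approx.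
have c1 (nu : {measure set T -> \bar R}) (f : T -> R) : measurable_fun setT f ->
  (forall x, 0 <= f x) ->
  (\int[nu]_x (h n x * f x)%:E)%E @[n --> \oo] --> (\int[nu]_x (psi x * f x)%:E)%E.
  move=> mf f0.
  rewrite (_ : (\int[nu]_x (psi x * f x)%:E)%E = (\int[nu]_x limn (fun n => (h n x * f x)%:E))%E); last first.
    apply: eq_integral => x _; apply/esym/cvg_lim => //.
    by rewrite EFinM; under eq_fun do rewrite EFinM; apply: cvgeMr => //; exact: hcvg.
  apply: cvg_monotone_convergence => //.
  - by move=> n; apply/measurable_EFinP/measurable_funM.
  - by move=> n x _; rewrite lee_fin mulr_ge0.
  - by move=> x _ m n mn; rewrite lee_fin ler_wpM2r//; exact: hnd.
have c (nu : {measure set T -> \bar R}) :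
  (\int[nu]_x (h n x)%:E)%E @[n --> \oo] --> (\int[nu]_x (psi x)%:E)%E.
  have := c1 nu (fun=> 1) (measurable_cst _) (fun=> ler01).
  under eq_fun => n do under eq_integral => x _ do rewrite mulr1.
  by under eq_integral => x _ do rewrite mulr1.
rewrite -(cvg_lim _ (c nu1))//.
have c2 : (\int[nu2]_x (h n x)%:E + \int[mu]_x (h n x * phi x)%:E)%E @[n --> \oo] -->
    (\int[nu2]_x (psi x)%:E + \int[mu]_x (psi x * phi x)%:E)%E.
  apply: cvgeD; [|exact: c|exact: c1].
  apply: ge0_adde_def; rewrite inE; apply: integral_ge0 => x _; rewrite lee_fin//.
  exact: mulr_ge0.
rewrite -(cvg_lim _ c2)//; congr (limn _); apply/funext => n.
exact: nnsfun_integral_density.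
Qed.

(** Splitting the coefficients into positive and negative parts turns the relation into an equality
    of two nonnegative combinations [M c] and [M cN], which are measures and so have equal
    integrals. *)
Lemma ge0_Rintegral_lincomb (n : nat) (c : nat -> R) (m : nat -> {measure set T -> \bar R}) (f : T -> R) :
  (forall i A, measurable A -> m i A < +oo)%E ->
  (forall A, measurable A -> \sum_(i < n) c i * fine (m i A) = 0) ->
  (forall x, 0 <= f x) -> (forall i, (m i).-integrable setT (EFin \o f)) ->
  \sum_(i < n) c i * (\int[m i]_x f x)%R = 0.
Proof.
move=> mfin mc f0 fi.
have nn (x : R) : 0 <= Num.max x 0 by rewrite le_max lexx orbT.
have mf : measurable_fun setT (EFin \o f) by exact: measurable_int (fi 0%N).
pose M (e : nat -> R) := msum (fun i => mscale (NngNum (nn (e i))) (m i)) n.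
have ME e A : measurable A -> M e A = (\sum_(i < n) Num.max (e i) 0 * fine (m i A))%:E.
  move=> mA; rewrite /M /msum -sumEFin; apply: eq_bigr => i _.
  rewrite /mscale/= EFinM fineK// ge0_fin_numE//; exact: mfin.
have MI e : (\int[M e]_x (f x)%:E = (\sum_(i < n) Num.max (e i) 0 * (\int[m i]_x f x)%R)%:E)%E.
  rewrite /M ge0_integral_measure_sum//; last by move=> x _; rewrite lee_fin.
  rewrite -sumEFin; apply: eq_bigr => i _.
  rewrite ge0_integral_mscale//; last by move=> x _; rewrite lee_fin.
  by rewrite /= EFinM /Rintegral fineK//; exact: integrable_fin_num (fi i).
pose cN i := - c i.
have : (\int[M c]_x (f x)%:E = \int[M cN]_x (f x)%:E)%E.
  apply: eq_measure_integral => A mA _; change (M c A = M cN A); rewrite !ME//; congr EFin.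
  apply/eqP; rewrite -subr_eq0 -sumrB -[X in _ == X](mc A mA); apply/eqP/eq_bigr => i _.
  by rewrite -mulrBl; congr (_ * _); rewrite /cN /Num.max; do 2 (case: ifPn); rewrite -?leNgt; lra.
rewrite !MI => -[] /eqP; rewrite -subr_eq0 -sumrB => /eqP {2}<-; apply: eq_bigr => i _.
by rewrite -mulrBl; congr (_ * _); rewrite /cN /Num.max; do 2 (case: ifPn); rewrite -?leNgt; lra.
Qed.

Lemma Rintegral_lincomb (n : nat) (c : nat -> R) (m : nat -> {measure set T -> \bar R}) (f : T -> R) :
  (forall i A, measurable A -> m i A < +oo)%E ->
  (forall A, measurable A -> \sum_(i < n) c i * fine (m i A) = 0) ->
  (forall i, (m i).-integrable setT (EFin \o f)) ->
  \sum_(i < n) c i * (\int[m i]_x f x)%R = 0.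
Proof.
move=> mfin mc fi.
have fp i : (m i).-integrable setT (EFin \o f^\+) by exact: integrable_funrpos.
have fn i : (m i).-integrable setT (EFin \o f^\-) by exact: integrable_funrneg.
have p0 := ge0_Rintegral_lincomb mfin mc (@funrpos_ge0 _ _ f) fp.
have n0 := ge0_Rintegral_lincomb mfin mc (@funrneg_ge0 _ _ f) fn.
transitivity (\sum_(i < n) c i * (\int[m i]_x f^\+ x)%R - \sum_(i < n) c i * (\int[m i]_x f^\- x)%R).
  rewrite -sumrB; apply: eq_bigr => i _.
  rewrite -mulrBr -RintegralB//; congr (_ * _); apply: eq_Rintegral => x _.
  by rewrite -{1}(funrposBneg f).
by rewrite p0 n0 subrr.
Qed.

End MeasureLemmas.

(** * Riesz representation in [l^2(V)] *)

Section Riesz.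
Context {R : realType} {V : countType}.
Implicit Types (f g h : V -> R).

(** The bound is affine in the square norm, the form in which spectral integrals are estimated;
    rescaling [g] recovers continuity. The coordinates of [w] have to be [l (delta x)]. It is
    square-summable because [l] is controlled on the truncations of [w], and [l - <w, .>] vanishes
    on finitely supported functions, hence everywhere by continuity. *)
Lemma riesz (l : (V -> R) -> R) (A C : R) :
  (forall a g h, sq_summable g -> sq_summable h -> l (fun x => a * g x + h x) = a * l g + l h) ->
  (forall g, sq_summable g -> `|l g| <= A + C * dot g g) ->
  exists2 w, sq_summable w & forall g, sq_summable g -> dot w g = l g.
Proof.
move=> lin bd.
have C0 : 0 <= `|C| by [].
have {}bd g : sq_summable g -> `|l g| <= `|A| + `|C| * dot g g.
  move=> gs; apply: (le_trans (bd _ gs)); apply: lerD; first exact: ler_norm.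
  by rewrite ler_wpM2r ?dotff_ge0// ler_norm.
move: (normr_ge0 A) C0 bd; move: `|A| `|C| => {}A {}C A0 C0 bd.
have l0 : l (fun=> 0) = 0.
  have := lin (-1) _ _ sq_summable0 sq_summable0.
  by rewrite (_ : (fun x => _) = fun=> 0); [lra|apply/funext => x; rewrite mulr0 addr0].
have lZ a g : sq_summable g -> l (fun x => a * g x) = a * l g.
  move=> gs; have := lin a _ _ gs sq_summable0; rewrite l0 addr0 => <-.
  by congr l; apply/funext => x; rewrite addr0.
pose w x := l (@delta R V x).
pose tr g (s : seq V) := fun x => if x \in s then g x else 0.
have trs g s : sq_summable (tr g s).
  elim: s => [|y s IH].
    by rewrite (_ : tr g [::] = fun=> 0) //; exact: sq_summable0.
  have [ys|ys] := boolP (y \in s).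
    rewrite (_ : tr g _ = tr g s)//; apply/funext => x; rewrite /tr inE.
    by case: eqVneq => // ->; rewrite ys.
  rewrite (_ : tr g _ = fun x => g y * @delta R V y x + tr g s x).
    by apply: sq_summableD => //; apply/sq_summableZ/delta_sq_summable.
  apply/funext => x; rewrite /tr inE /delta; case: eqVneq => [->|_].
    by rewrite (negPf ys) mulr1 addr0.
  by rewrite mulr0 add0r.
have ltr g s : uniq s -> l (tr g s) = \sum_(x <- s) g x * w x.
  elim: s => [_|y s IH /= /andP[ys us]].
    by rewrite big_nil (_ : tr g [::] = fun=> 0).
  rewrite big_cons -IH// -lin//; last exact: delta_sq_summable.
  congr l; apply/funext => x; rewrite /tr inE /delta; case: eqVneq => [->|_].
    by rewrite (negPf ys) mulr1 addr0.
  by rewrite mulr0 add0r.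
have dtr f g s : uniq s -> sq_summable f -> dot f (tr g s) = \sum_(x <- s) f x * g x.
  move=> us fs; elim: s us => [_|y s IH /= /andP[ys us]].
    rewrite big_nil /dot (_ : (fun i => _) = fun=> 0) ?rsum0//.
    by apply/funext => x; rewrite mulr0.
  rewrite big_cons -IH//.
  have -> : f y * g y = dot f (fun x => g y * @delta R V y x).
    by rewrite dotZr dot_delta mulrC.
  rewrite -dotDr//; last exact/sq_summableZ/delta_sq_summable.
  congr dot; apply/funext => x; rewrite /tr inE /delta; case: eqVneq => [->|_].
    by rewrite (negPf ys) mulr1 addr0.
  by rewrite mulr0 add0r.
have ws : sq_summable w.
  apply: (proj1 (sq_summableE w)).
  suff : (\esum_(x in [set: V]) (w x ^+ 2)%:E <= (4 * A * (C + 1))%:E)%E.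
    by move=> /le_lt_trans; apply; exact: ltry.
  apply: ge_ereal_sup => _ [X [finX _] <-]; rewrite fsbig_finite//= sumEFin lee_fin.
  set s := enum_fset _; have us : uniq s by exact: fset_uniq.
  set q := \sum_(i <- s) _.
  have q1 : l (tr w s) = q by rewrite ltr//; apply: eq_bigr => x _; rewrite expr2.
  have q2 : dot (tr w s) (tr w s) = q.
    rewrite dtr// /q; apply: eq_big_seq => x xs.
    by rewrite /tr xs expr2.
  have q0 : 0 <= q by apply: sumr_ge0 => x _; exact: sqr_ge0.
  (* The bound at [t * tr w s] reads [t q <= A + C t^2 q]. As [C t <= 1/2], the last term is
     absorbed and [q <= 2 A / t]. *)
  set t := (2 * (C + 1))^-1.
  have t0 : 0 < t by rewrite invr_gt0 mulr_gt0// ltr_wpDl.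
  have := bd _ (@sq_summableZ _ _ t _ (trs w s)).
  rewrite lZ// q1 dotZl dotZr q2 ger0_norm ?mulr_ge0 ?(ltW t0)//.
  have tC : t * (2 * (C + 1)) = 1 by rewrite mulVf// gt_eqF// mulr_gt0// ltr_wpDl.
  move=> H; have Ct : C * t <= 2^-1 by have := ltW t0; nra.
  have zA : t * q / 2 <= A.
    have : C * (t * (t * q)) <= 2^-1 * (t * q).
      by rewrite (mulrA C t (t * q)) ler_wpM2r// mulr_ge0// ltW.
    lra.
  rewrite -(ler_pM2l t0).
  have -> : t * (4 * A * (C + 1)) = 2 * A * (t * (2 * (C + 1))) by ring.
  rewrite tC; lra.
exists w => // g gs; apply/eqP; rewrite -subr_eq0 -normr_le0 leNgt; apply/negP => X0.
pose l' h := dot w h - l h.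
have l'lin a u v : sq_summable u -> sq_summable v -> l' (fun x => a * u x + v x) = a * l' u + l' v.
  move=> us vs; rewrite /l' lin// dotDr//; last exact: sq_summableZ.
  by rewrite dotZr; ring.
pose A' := A + dot w w; pose C' := C + 1.
have A'0 : 0 <= A' by rewrite addr_ge0 ?dotff_ge0.
have C'0 : 0 < C' by rewrite ltr_wpDl.
have l'bd h : sq_summable h -> `|l' h| <= A' + C' * dot h h.
  move=> hs; rewrite /l'; apply: (le_trans (ler_normB _ _)).
  have -> : A' + C' * dot h h = (dot w w + dot h h) + (A + C * dot h h) by rewrite /A' /C'; ring.
  apply: lerD; last exact: bd.
  have := dotff_ge0 (fun x => w x + h x); have := dotff_ge0 (fun x => w x + - h x).
  rewrite !dot_expand//; last exact: sq_summableN.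
  rewrite (dotC w (fun x => - h x)) !dotNl (dotC h (fun x => - h x)) dotNl (dotC h w).
  have := dotff_ge0 w; have := dotff_ge0 h.
  by rewrite ler_norml; lra.
pose X := `|l' g|; have {}X0 : 0 < X := X0.
pose t := (2 * A' + 1) / X.
(* For a tail [k] of [g], the bound at [t * k] will give [t X <= A' + C' t^2 <k, k> < A' + t X / 2],
   that is [t X < 2 A'], against [t X = 2 A' + 1]. *)
have t0 : 0 < t by rewrite divr_gt0// ltr_wpDl// mulr_ge0.
have tX : t * X = 2 * A' + 1 by rewrite divfK// gt_eqF.
have Ct0 : 0 < 2 * C' * t by rewrite (mulr_gt0 _ t0)// mulr_gt0.
have Ctt0 : 0 < C' * t * t by rewrite (mulr_gt0 _ t0)// (mulr_gt0 _ t0).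
have e0 : 0 < X / (2 * C' * t) by rewrite divr_gt0.
have [F finF tail] := esum_tail (fun x => sqr_ge0 (g x)) gs e0.
pose s := enum_fset (fset_set F); have us : uniq s by exact: fset_uniq.
have sF x : (x \in s) = (x \in F) by rewrite /s in_fset_set.
pose k x := g x - tr g s x.
have ks : sq_summable k by exact: sq_summableB.
have k2 : dot k k < X / (2 * C' * t).
  rewrite -lte_fin dot_EFin//; move: tail; congr (_ < _)%E; apply: eq_esum => x _.
  by rewrite /k /tr sF; case: ifPn; rewrite ?subrr ?expr0n ?subr0.
have lk : l' k = l' g.
  have -> : k = fun x => (-1) * tr g s x + g x.
    by apply/funext => x; rewrite /k mulN1r addrC.
  rewrite l'lin// /l' ltr// dtr//.
  rewrite (_ : \sum_(x <- s) g x * w x = \sum_(x <- s) w x * g x); first by ring.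
  by apply: eq_bigr => x _; rewrite mulrC.
have := l'bd _ (@sq_summableZ _ _ t _ ks).
have -> : l' (fun x => t * k x) = t * l' k.
  by rewrite /l' lZ// dotZr; ring.
rewrite lk dotZl dotZr normrM (ger0_norm (ltW t0)) -/X tX.
have : C' * (t * (t * dot k k)) < t * X / 2.
  have -> : C' * (t * (t * dot k k)) = (C' * t * t) * dot k k by ring.
  rewrite mulrC -ltr_pdivlMr//.
  apply: (lt_le_trans k2); rewrite le_eqVlt; apply/orP; left; apply/eqP.
  by field; rewrite !gt_eqF.
rewrite tX; lra.
Qed.

End Riesz.

(** * Spectral measures *)

Section Spectral.
Context {R : realType} {V : countType}.
Variable E : set R -> (V -> R) -> V -> R.
Hypothesis hE : projection_valued_measure (fun=> 1) E.
Implicit Types (f g h u w : V -> R) (B C : set R) (psi : R -> R).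

Lemma E_sq_summable B f : measurable B -> sq_summable f -> sq_summable (E B f).
Proof.
move=> mB fs; exact: (proj1 (in_l2_1 _) (pvm_l2 hE mB (proj2 (in_l2_1 f) fs))).
Qed.

Lemma E_linear B a f g : measurable B -> sq_summable f -> sq_summable g ->
  E B (fun x => a * f x + g x) = fun x => a * E B f x + E B g x.
Proof.
move=> mB fs gs.
exact: (pvm_linear hE a mB (proj2 (in_l2_1 f) fs) (proj2 (in_l2_1 g) gs)).
Qed.

Lemma E_sym B f g : measurable B -> sq_summable f -> sq_summable g ->
  dot (E B f) g = dot f (E B g).
Proof.
move=> mB fs gs.
have := pvm_symmetric hE mB (proj2 (in_l2_1 f) fs) (proj2 (in_l2_1 g) gs).
by rewrite !inner_1.
Qed.

Lemma E_setI B C f : measurable B -> measurable C -> sq_summable f ->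
  E (B `&` C) f = E B (E C f).
Proof. move=> mB mC fs; exact: (pvm_setI hE mB mC (proj2 (in_l2_1 f) fs)). Qed.

Lemma E_setT f : sq_summable f -> E setT f = f.
Proof. move=> fs; exact: (pvm_setT hE (proj2 (in_l2_1 f) fs)). Qed.

Lemma E_set0 f : sq_summable f -> E set0 f = fun=> 0.
Proof. move=> fs; exact: (pvm_set0 hE (proj2 (in_l2_1 f) fs)). Qed.

Lemma E_D B f g : measurable B -> sq_summable f -> sq_summable g ->
  E B (fun x => f x + g x) = fun x => E B f x + E B g x.
Proof.
move=> mB fs gs; have := E_linear 1 mB fs gs.
by under eq_fun do rewrite mul1r; move=> ->; apply/funext => x; rewrite mul1r.
Qed.

Lemma E_0 B : measurable B -> E B (fun=> 0) = fun=> 0.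
Proof.
move=> mB; have := E_linear (-1) mB sq_summable0 sq_summable0.
by under eq_fun do rewrite mulr0 addr0; move=> ->; apply/funext => x; rewrite mulN1r addNr.
Qed.

Lemma E_Z B a f : measurable B -> sq_summable f ->
  E B (fun x => a * f x) = fun x => a * E B f x.
Proof.
move=> mB fs; have := E_linear a mB fs sq_summable0; rewrite E_0//.
by under eq_fun do rewrite addr0; move=> ->; apply/funext => x; rewrite addr0.
Qed.

Lemma E_B B f g : measurable B -> sq_summable f -> sq_summable g ->
  E B (fun x => f x - g x) = fun x => E B f x - E B g x.
Proof.
move=> mB fs gs; have := E_linear (-1) mB gs fs.
under eq_fun do rewrite mulN1r addrC; move=> ->.
by apply/funext => x; rewrite mulN1r addrC.
Qed.

Lemma dot_E_E B C f g : measurable B -> measurable C -> sq_summable f -> sq_summable g ->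
  dot (E B f) (E C g) = dot (E (B `&` C) f) g.
Proof.
move=> mB mC fs gs; have Bf := E_sq_summable mB fs.
by rewrite -(E_sym mC Bf gs) setIC E_setI.
Qed.

Lemma dot_E B f : measurable B -> sq_summable f -> dot (E B f) f = dot (E B f) (E B f).
Proof. by move=> mB fs; rewrite dot_E_E// setIid. Qed.

(* Made zero where the value of [E B f] is meaningless, so as to be a measure on
   all sets; the proof argument lets the measure structure be inferred. *)
Definition spm (_ : projection_valued_measure (fun=> 1) E) f B : \bar R :=
  if `[< measurable B /\ sq_summable f >] then (dot (E B f) f)%:E else 0%E.

Lemma spmE f B : measurable B -> sq_summable f -> spm hE f B = (dot (E B f) f)%:E.
Proof. by move=> mB fs; rewrite /spm; case: asboolP => // -[]. Qed.

Let spm0 f : spm hE f set0 = 0%E.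
Proof.
rewrite /spm; case: asboolP => // -[_ fs]; rewrite E_set0// /dot.
rewrite (_ : (fun i => _) = fun=> 0) ?rsum0//.
by apply/funext => x; rewrite mul0r.
Qed.

Let spm_ge0 f B : (0 <= spm hE f B)%E.
Proof.
rewrite /spm; case: asboolP => // -[mB fs].
by rewrite dot_E// lee_fin dotff_ge0.
Qed.

(** The sums of projections converge in norm, and pairing with [f] is continuous by Cauchy-Schwarz.
    For [f] outside [l^2] the measure is zero. *)
Let spm_sigma_additive f : semi_sigma_additive (spm hE f).
Proof.
move=> F mF tF mUF; have [fs|fs] := pselect (sq_summable f); last first.
  have E0 B : spm hE f B = 0%E by rewrite /spm; case: asboolP => // -[].
  rewrite E0; under eq_fun => n do rewrite big1//; exact: cvg_cst.
pose s n x := \sum_(k < n) E (F k) f x.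
have ss n : sq_summable (s n).
  elim: n => [|n IH].
    rewrite (_ : s 0%N = fun=> 0); first exact: sq_summable0.
    by apply/funext => x; rewrite /s big_ord0.
  rewrite (_ : s n.+1 = fun x => s n x + E (F n) f x).
    exact/sq_summableD/E_sq_summable.
  by apply/funext => x; rewrite /s big_ord_recr.
have sE n : (\sum_(0 <= k < n) spm hE f (F k))%E = (dot (s n) f)%:E.
  rewrite big_mkord; elim: n => [|n IH].
    rewrite big_ord0 /dot (_ : (fun i => _) = fun=> 0) ?rsum0//.
    by apply/funext => x; rewrite /s big_ord0 mul0r.
  rewrite big_ord_recr/= IH spmE// -EFinD -dotDl//; last exact: E_sq_summable.
  rewrite [X in dot X f](_ : _ = s n.+1)//.
  by apply/funext => x; rewrite /s big_ord_recr.
rewrite spmE//; under eq_fun do rewrite sE.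
apply: cvg_EFin; first exact: nearW.
pose U := E (\bigcup_k F k) f.
have Us : sq_summable U by exact: E_sq_summable.
pose k n x := U x - s n x.
have ks n : sq_summable (k n) by exact: sq_summableB.
have k0 : Num.sqrt (dot (k n) (k n)) @[n --> \oo] --> 0.
  have := pvm_sigma_additive hE mF tF ((in_l2_1 _).2 fs).
  rewrite (_ : (fun n => _) = fun n => (Num.sqrt (dot (k n) (k n)))%:E); last first.
    by apply/funext => n; rewrite /l2norm l2normsq_1//; exact: ks.
  by move/fine_cvg.
have c0 : Num.sqrt (dot (k n) (k n)) * Num.sqrt (dot f f) @[n --> \oo] --> 0.
  by rewrite -[X in _ --> X](mul0r (Num.sqrt (dot f f))); apply: cvgM => //; exact: cvg_cst.
apply/cvgrPdist_le => e e0; near=> n; rewrite /=.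
apply: (@le_trans _ _ (Num.sqrt (dot (k n) (k n)) * Num.sqrt (dot f f))).
  rewrite -dotBl//; have := cauchy_schwarz (ks n) fs.
  rewrite -ler_sqrt ?mulr_ge0 ?dotff_ge0// sqrtr_sqr sqrtrM ?dotff_ge0//.
by near: n; move: e e0; apply: cvgr_le; exact: c0.
Unshelve. all: by end_near. Qed.

HB.instance Definition _ f := isMeasure.Build _ _ _ (spm hE f)
  (spm0 f) (spm_ge0 f) (@spm_sigma_additive f).

Let spm_fin f : fin_num_fun (spm hE f).
Proof. by move=> B mB; rewrite /spm; case: asboolP. Qed.

HB.instance Definition _ f := Measure_isFinite.Build _ _ _ (spm hE f) (@spm_fin f).

Lemma integral_spectral_distribution f (F : R -> \bar R) : sq_summable f ->
  (\int[spectral_distribution (fun=> 1%R) E f]_s F s = \int[spm hE f]_s F s)%E.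
Proof.
move=> fs; apply: eq_set_function_integral => B mB.
by rewrite /spectral_distribution inner_1 -spmE.
Qed.

Definition pairing psi f g : R :=
  4^-1 * ((\int[spm hE (fun x => f x + g x)]_s psi s)%R -
          (\int[spm hE (fun x => f x - g x)]_s psi s)%R).

Lemma spectral_pairingE psi f g : sq_summable f -> sq_summable g ->
  spectral_pairing (fun=> 1) E psi f g = pairing psi f g.
Proof.
move=> fs gs; rewrite /spectral_pairing /pairing /Rintegral.
rewrite !integral_spectral_distribution//; [exact: sq_summableB|exact: sq_summableD].
Qed.

Definition spm_integrable psi f := (spm hE f).-integrable setT (EFin \o psi).

Definition pair_integrable psi f g :=
  spm_integrable psi (fun x => f x + g x) /\ spm_integrable psi (fun x => f x - g x).

Lemma polarization B f g : measurable B -> sq_summable f -> sq_summable g ->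
  fine (spm hE (fun x => f x + g x) B) - fine (spm hE (fun x => f x - g x) B) =
  4 * dot (E B f) g.
Proof.
move=> mB fs gs; have sD := sq_summableD fs gs; have sB := sq_summableB fs gs.
rewrite !spmE//= E_D// E_B//.
have Bf := E_sq_summable mB fs; have Bg := E_sq_summable mB gs.
rewrite (dotDl Bf Bg sD) (dotBl Bf Bg sB) !(dotDr fs gs)// !(dotBr fs gs)//.
by rewrite (E_sym mB gs fs) (dotC g); ring.
Qed.

(** The six-term sum is written as it unfolds in [pairing_lincomb], with abstract reals in place of
    the measures and scalar products. *)
Let lincomb_aux (a c e1 e2 e3 e4 e5 e6 D D1 D2 : R) :
  e1 - e2 = 4 * D -> e3 - e4 = 4 * D1 -> e5 - e6 = 4 * D2 -> D = a * D1 + c * D2 ->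
  1 * e1 + (-1 * e2 + (- a * e3 + (a * e4 + (- c * e5 + (c * e6 + 0))))) = 0.
Proof.
move=> h1 h2 h3 h4.
have -> : 1 * e1 + (-1 * e2 + (- a * e3 + (a * e4 + (- c * e5 + (c * e6 + 0))))) =
  (e1 - e2) - a * (e3 - e4) - c * (e5 - e6) by ring.
by rewrite h1 h2 h3 h4; ring.
Qed.

Let pairing_aux (a c I1 I2 I3 I4 I5 I6 : R) :
  1 * I1 + (-1 * I2 + (- a * I3 + (a * I4 + (- c * I5 + (c * I6 + 0))))) = 0 ->
  4^-1 * (I1 - I2) = a * (4^-1 * (I3 - I4)) + c * (4^-1 * (I5 - I6)).
Proof.
move=> h; have -> : I1 = I1 - (1 * I1 + (-1 * I2 + (- a * I3 + (a * I4 + (- c * I5 + (c * I6 + 0))))))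
  by rewrite h subr0.
by ring.
Qed.

(** A linear relation between the signed measures [<E B f, g>] passes to integrals. Polarization
    makes it a relation between six finite positive measures, two for each pairing. *)
Lemma pairing_lincomb psi a c f g f1 g1 f2 g2 :
  sq_summable f -> sq_summable g -> sq_summable f1 -> sq_summable g1 ->
  sq_summable f2 -> sq_summable g2 ->
  pair_integrable psi f g -> pair_integrable psi f1 g1 -> pair_integrable psi f2 g2 ->
  (forall B, measurable B ->
     dot (E B f) g = a * dot (E B f1) g1 + c * dot (E B f2) g2) ->
  pairing psi f g = a * pairing psi f1 g1 + c * pairing psi f2 g2.
Proof.
move=> fs gs f1s g1s f2s g2s [i1 i2] [i3 i4] [i5 i6] H.
pose cs := [:: 1; -1; - a; a; - c; c].
pose hs := [:: (fun x => f x + g x); (fun x => f x - g x);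
  (fun x => f1 x + g1 x); (fun x => f1 x - g1 x);
  (fun x => f2 x + g2 x); (fun x => f2 x - g2 x)].
have := @Rintegral_lincomb _ _ _ 6 (nth 0 cs) (fun i => spm hE (nth (fun x => f x + g x) hs i)) psi.
rewrite !big_ord_recl !big_ord0/= => main.
rewrite /pairing; apply: pairing_aux; apply: main.
- by move=> i B mB; rewrite -ge0_fin_numE//; exact: fin_num_measure.
- move=> B mB; rewrite !big_ord_recl !big_ord0/=.
  exact: (lincomb_aux (polarization mB fs gs) (polarization mB f1s g1s)
    (polarization mB f2s g2s) (H _ mB)).
(* Beyond the six entries [nth] returns its default, the first function again, whose integrability
   is known. *)
- by do 7 (case=> //).
Qed.

Lemma spm_T f : sq_summable f -> spm hE f setT = (dot f f)%:E.
Proof. by move=> fs; rewrite spmE// E_setT. Qed.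

Lemma bounded_spm_integrable psi f (M : R) : measurable_fun setT psi ->
  (forall s, `|psi s| <= M) -> spm_integrable psi f.
Proof.
move=> mpsi bd; apply: measurable_bounded_integrable => //.
  by rewrite -ge0_fin_numE//; exact: fin_num_measure.
exists M; split; first exact: num_real.
by move=> N MN s _ /=; apply: (le_trans (bd s)); exact: ltW.
Qed.

Lemma bounded_pair_integrable psi f g (M : R) : measurable_fun setT psi ->
  (forall s, `|psi s| <= M) -> pair_integrable psi f g.
Proof. by move=> mpsi bd; split; exact: bounded_spm_integrable bd. Qed.

Lemma le_Rintegral_spm psi f (M : R) : measurable_fun setT psi ->
  (forall s, `|psi s| <= M) -> sq_summable f ->
  `|(\int[spm hE f]_s psi s)%R| <= M * dot f f.
Proof.
move=> mpsi bd fs; apply: (le_trans (le_normr_Rintegral measurableT (bounded_spm_integrable f mpsi bd))).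
apply: (@le_trans _ _ (\int[spm hE f]_s (cst M s))%R).
  apply: le_Rintegral => //.
  - apply: (@bounded_spm_integrable (fun s => `|psi s|) f M); first exact: measurableT_comp.
    by move=> s; rewrite normr_id.
  - by apply: (@bounded_spm_integrable (cst M) f `|M|).
by rewrite Rintegral_cst// -[fine _]/(fine (spm hE f setT)) spm_T.
Qed.

(** Bounded functional calculus: [w] is [psi(A) f]. The total masses of the two polarized measures
    add up by the parallelogram law, whence a bound affine in the square norm of [g]. *)
Lemma spectral_riesz psi f (M : R) : measurable_fun setT psi ->
  (forall s, `|psi s| <= M) -> sq_summable f ->
  exists2 w, sq_summable w & forall g, sq_summable g -> dot w g = pairing psi f g.
Proof.
move=> mpsi bd fs; apply: (@riesz _ _ (pairing psi f) (M * dot f f) M).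
  move=> a g h gs hs; rewrite -[pairing psi f h]mul1r.
  apply: pairing_lincomb => //; try exact: bounded_pair_integrable bd.
    by apply: sq_summableD => //; exact: sq_summableZ.
  move=> B mB; have Bf := E_sq_summable mB fs.
  by rewrite dotDr ?dotZr ?mul1r//; exact: sq_summableZ.
move=> g gs; have sD := sq_summableD fs gs; have sB := sq_summableB fs gs.
have b1 := le_Rintegral_spm mpsi bd sD; have b2 := le_Rintegral_spm mpsi bd sB.
have pl : dot (fun x => f x + g x) (fun x => f x + g x) +
  dot (fun x => f x - g x) (fun x => f x - g x) = 2 * dot f f + 2 * dot g g.
  rewrite dot_expand// (dot_expand fs (sq_summableN gs)) (dotC f (fun x => - _ x)) !dotNl.
  by rewrite (dotC g (fun x => - _ x)) dotNl (dotC g f); ring.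
rewrite /pairing normrM ger0_norm ?invr_ge0//.
have M0 : 0 <= M by exact: le_trans (bd 0).
have := ler_normB (\int[spm hE (fun x => f x + g x)]_s psi s)%R
  (\int[spm hE (fun x => f x - g x)]_s psi s)%R.
have MF := mulr_ge0 M0 (dotff_ge0 f); have MG := mulr_ge0 M0 (dotff_ge0 g).
move: (dot f f) (dot g g) (dot (fun x => f x + g x) _) (dot (fun x => f x - g x) _)
  (Rintegral _ _ _) (Rintegral _ _ _) MF MG pl b1 b2 => F G D1 D2 I1 I2 MF MG pl b1 b2 b3.
have MM : M * D1 + M * D2 = 2 * (M * F) + 2 * (M * G) by rewrite -mulrDr pl; ring.
lra.
Qed.

End Spectral.

(** * The operator of a spectral measure *)

Section Support.
Context {R : realType} {V : countType}.
Variable E : set R -> (V -> R) -> V -> R.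
Hypothesis hE : projection_valued_measure (fun=> 1) E.
Implicit Types (f g h u w : V -> R) (B C : set R) (psi : R -> R).

Lemma fine_spm f B : measurable B -> (fine (spm hE f B))%:E = spm hE f B.
Proof. by move=> mB; rewrite fineK//; exact: fin_num_measure. Qed.

Lemma spm_E f B C : measurable B -> measurable C -> sq_summable f ->
  spm hE (E B f) C = spm hE f (C `&` B).
Proof.
move=> mB mC fs; have Bf := E_sq_summable hE mB fs.
rewrite !spmE//; last exact: measurableI.
rewrite (dot_E hE mC Bf) (dot_E hE _ fs); last exact: measurableI.
by rewrite (E_setI hE).
Qed.

(** The spectral measure of [f + f] is 4 times that of [f], and that of [f - f] is zero. *)
Lemma pairing_diag psi f : sq_summable f -> pair_integrable hE psi f f -> spm_integrable hE psi f ->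
  pairing hE psi f f = (\int[spm hE f]_s psi s)%R.
Proof.
move=> fs [i1 i2] i3.
pose cs : seq R := [:: 1; -1; - 4].
pose hs := [:: (fun x => f x + f x); (fun x => f x - f x); f].
have := @Rintegral_lincomb _ _ _ 3 (nth 0 cs) (fun i => spm hE (nth f hs i)) psi.
rewrite !big_ord_recl !big_ord0/= => main.
suff : 1 * (\int[spm hE (fun x => f x + f x)]_s psi s)%R +
  (-1 * (\int[spm hE (fun x => f x - f x)]_s psi s)%R + (- 4 * (\int[spm hE f]_s psi s)%R + 0)) = 0.
  rewrite /pairing; move: (Rintegral _ _ _) (Rintegral _ _ _) (Rintegral _ _ _) => I1 I2 I3; lra.
apply: main.
- by move=> i B mB; rewrite -ge0_fin_numE//; exact: fin_num_measure.
- move=> B mB; rewrite !big_ord_recl !big_ord0/=.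
  have := polarization hE mB fs fs.
  have -> : fine (spm hE f B) = dot (E B f) f by rewrite spmE.
  by move: (fine _) (fine _) (dot _ _) => e1 e2 D; lra.
- by do 4 (case=> //).
Qed.

Lemma spm_null_integral f B psi1 psi2 : measurable B -> spm hE f (~` B) = 0%E ->
  measurable_fun setT psi1 -> measurable_fun setT psi2 -> (forall s, B s -> psi1 s = psi2 s) ->
  (\int[spm hE f]_s (psi1 s)%:E = \int[spm hE f]_s (psi2 s)%:E)%E.
Proof.
move=> mB f0 m1 m2 e; apply: ae_eq_integral => //; [exact/measurable_EFinP..|].
exists (~` B); split => //; first exact: measurableC.
by move=> s /= H Bs; apply: H => _; rewrite e.
Qed.

Lemma spm_null_integrable f B psi1 psi2 : measurable B -> spm hE f (~` B) = 0%E ->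
  measurable_fun setT psi1 -> measurable_fun setT psi2 -> (forall s, B s -> psi1 s = psi2 s) ->
  spm_integrable hE psi1 f -> spm_integrable hE psi2 f.
Proof.
move=> mB f0 m1 m2 e /integrableP[_ fi]; apply/integrableP; split.
  exact/measurable_EFinP.
move: fi; congr (_ < _)%E.
apply: (@spm_null_integral f B (fun s => `|psi1 s|) (fun s => `|psi2 s|)) => //.
- exact: measurableT_comp.
- exact: measurableT_comp.
- by move=> s Bs; rewrite e.
Qed.

Definition id_domain f : Prop :=
  sq_summable f /\ (\int[spm hE f]_s (s ^+ 2)%:E < +oo)%E.

Lemma id_domainE f : spectral_domain (fun=> 1) E idfun f <-> id_domain f.
Proof.
split=> [[/in_l2_1 fs]|[fs fi]].
  by rewrite (integral_spectral_distribution hE)//; split.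
by split; [exact/in_l2_1|rewrite (integral_spectral_distribution hE)].
Qed.

Lemma measurable_sqr : measurable_fun setT (fun s : R => s ^+ 2).
Proof. exact: measurable_funX. Qed.

Lemma measurable_sqr_EFin : measurable_fun setT (fun s : R => (s ^+ 2)%:E).
Proof. by apply/measurable_EFinP; exact: measurable_sqr. Qed.

(** Since [E B] is an orthogonal projection, [<E B h, h>] is the square norm of [E B h], to which
    [dotff_le2] applies. *)
Lemma spm_D_le f g B : measurable B -> sq_summable f -> sq_summable g ->
  (spm hE (fun x => f x + g x)%R B <= 2%:E * spm hE f B + 2%:E * spm hE g B)%E.
Proof.
move=> mB fs gs; have fgs := sq_summableD fs gs.
rewrite !spmE// -!EFinM -EFinD lee_fin !(dot_E hE mB)// (E_D hE mB fs gs).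
by apply: dotff_le2; exact: E_sq_summable.
Qed.

Lemma id_domainD f g : id_domain f -> id_domain g -> id_domain (fun x => f x + g x).
Proof.
move=> [fs fi] [gs gi]; split; first exact: sq_summableD.
have two : 0 <= 2 :> R by [].
pose m2 := measure_add (mscale (NngNum two) (spm hE f)) (mscale (NngNum two) (spm hE g)).
have m0 s : (0 <= (s ^+ 2)%:E :> \bar R)%E by rewrite lee_fin sqr_ge0.
have msq : measurable_fun setT (fun s : R => (s ^+ 2)%:E) by exact: measurable_sqr_EFin.
apply: (@le_lt_trans _ _ (\int[m2]_s (s ^+ 2)%:E)%E).
  apply: ge0_le_measure_integral => //= B mB.
  apply: (le_trans (spm_D_le mB fs gs)).
  by rewrite -[X in (_ <= X)%E]/(m2 B) /m2 measure_addE.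
rewrite /m2 ge0_integral_measure_add// !ge0_integral_mscale//=.
by apply: lte_add_pinfty; rewrite lte_mul_pinfty// lee_fin.
Qed.

Lemma id_domainN f : id_domain f -> id_domain (fun x => - f x).
Proof.
move=> [fs fi]; split; first exact: sq_summableN.
have -> : (\int[spm hE (fun x => - f x)%R]_s (s ^+ 2)%:E = \int[spm hE f]_s (s ^+ 2)%:E)%E.
  apply: eq_measure_integral => B mB _.
  change (spm hE (fun x => - f x) B = spm hE f B).
  have E1 : (fun x => - f x) = fun x => (-1) * f x by apply/funext => x; rewrite mulN1r.
  rewrite !spmE//; last exact: sq_summableN.
  rewrite E1 (E_Z hE _ mB fs) dotZl dotZr; congr EFin; ring.
by [].
Qed.

Lemma id_domainB f g : id_domain f -> id_domain g -> id_domain (fun x => f x - g x).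
Proof. by move=> fd /id_domainN; exact: id_domainD. Qed.

Lemma id_domain_E f B : measurable B -> id_domain f -> id_domain (E B f).
Proof.
move=> mB [fs fi]; split; first exact: E_sq_summable.
apply: le_lt_trans fi; apply: ge0_le_measure_integral => //=.
- move=> C mC; rewrite spm_E//; exact: measureIl.
- by move=> s; rewrite lee_fin sqr_ge0.
- exact: measurable_sqr_EFin.
Qed.

Lemma id_domain_integrable f : id_domain f -> spm_integrable hE idfun f.
Proof.
move=> [fs fi]; apply/integrableP; split; first by apply/measurable_EFinP; exact: measurable_id.
apply: (@le_lt_trans _ _ (\int[spm hE f]_s ((cst 1%:E) s + (s ^+ 2)%:E))%E).
  apply: ge0_le_integral => //.
  - by apply: measurableT_comp => //; apply/measurable_EFinP; exact: measurable_id.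
  - by apply: emeasurable_funD => //; exact: measurable_sqr_EFin.
  - move=> s _ /=; rewrite -EFinD lee_fin.
    have := sqr_ge0 (`|s| - 1); rewrite sqrrB1 real_normK ?num_real//.
    by have := normr_ge0 s; lra.
rewrite ge0_integralD//; last 2 first.
- by move=> s _; rewrite lee_fin sqr_ge0.
- exact: measurable_sqr_EFin.
apply: lte_add_pinfty => //; rewrite integral_cst// mul1e.
by rewrite -ge0_fin_numE//; exact: fin_num_measure.
Qed.

Lemma id_domain_pair f g : id_domain f -> id_domain g -> pair_integrable hE idfun f g.
Proof.
by move=> fd gd; split; apply: id_domain_integrable; [exact: id_domainD|exact: id_domainB].
Qed.

Lemma bounded_id_domain f B (M : R) : measurable B -> (forall s, B s -> `|s| <= M) ->
  sq_summable f -> id_domain (E B f).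
Proof.
move=> mB BM fs; have Bf := E_sq_summable hE mB fs; split => //.
have null : spm hE (E B f) (~` B) = 0%E.
  rewrite (spm_E mB (measurableC mB) fs) setICl; exact: measure0.
have mpsi : measurable_fun setT (fun s : R => s ^+ 2 * \1_B s).
  by apply: measurable_funM; [exact: measurable_sqr|exact: measurable_indic].
rewrite (@spm_null_integral _ B _ (fun s => s ^+ 2 * \1_B s))//.
- have : spm_integrable hE (fun s => s ^+ 2 * \1_B s) (E B f).
    apply: (@bounded_spm_integrable _ _ _ hE _ _ (M ^+ 2)) => //.
    move=> s; rewrite indicE; case: (boolP (s \in B)) => [/set_mem /BM sM|_];
      rewrite ?mulr1 ?mulr0 ?normr0 ?sqr_ge0//.
    by rewrite normrX ler_pXn2r// ?nnegrE// (le_trans _ sM).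
  move=> /integrableP[mi]; apply: le_lt_trans.
  apply: ge0_le_integral => //=.
  - by move=> s _; rewrite lee_fin mulr_ge0// sqr_ge0.
  - by apply/measurable_EFinP; apply: measurableT_comp.
  - by move=> s _; rewrite lee_fin ler_norm.
- by move=> s Bs; rewrite indicE mem_set// mulr1.
Qed.

(** Outside [B] the function [g] may have spectral mass, but [<E C f, g> = 0] for [C] disjoint from
    [B]. Hence the measures of [f + g] and [f - g] agree there and their contributions cancel. *)
Lemma pairing_local psi1 psi2 f g B : measurable B -> sq_summable f -> sq_summable g ->
  E (~` B) f = (fun=> 0) -> (forall s, B s -> psi1 s = psi2 s) ->
  pair_integrable hE psi1 f g -> pair_integrable hE psi2 f g ->
  pairing hE psi1 f g = pairing hE psi2 f g.
Proof.
move=> mB fs gs f0 e [i1 i2] [i3 i4].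
have mC := measurableC mB.
have eqm C : measurable C -> C `<=` ~` B ->
    spm hE (fun x => f x + g x) C = spm hE (fun x => f x - g x) C.
  move=> mC' CB; have := polarization hE mC' fs gs.
  have -> : E C f = fun=> 0.
    by rewrite -(setIidl CB) (E_setI hE)// f0 (E_0 hE).
  rewrite /dot (_ : (fun i => 0 * g i) = fun=> 0); last by apply/funext => x; rewrite mul0r.
  rewrite rsum0 mulr0 => /eqP; rewrite subr_eq0 => /eqP H.
  by rewrite -fine_spm// H fine_spm.
have split_ psi h : spm_integrable hE psi h -> (\int[spm hE h]_s psi s)%R =
    (\int[spm hE h]_(s in B) psi s)%R + (\int[spm hE h]_(s in ~` B) psi s)%R.
  move=> ih; rewrite -Rintegral_setU ?setUv//; exact/disj_setPCl.
rewrite /pairing; congr (_ * _); rewrite !split_//.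
have eqB h : (\int[spm hE h]_(s in B) psi1 s)%R = (\int[spm hE h]_(s in B) psi2 s)%R.
  by apply: eq_Rintegral => s /set_mem Bs; exact: e.
have eqC psi : (\int[spm hE (fun x => f x + g x)%R]_(s in ~` B) psi s)%R =
    (\int[spm hE (fun x => f x - g x)%R]_(s in ~` B) psi s)%R.
  by rewrite /Rintegral; congr fine; apply: eq_measure_integral.
rewrite !eqB !eqC; move: (Rintegral _ _ _) (Rintegral _ _ _) (Rintegral _ _ _) (Rintegral _ _ _) => a1 a2 a3 a4.
by rewrite !opprD; ring.
Qed.

End Support.

(** * Nonnegativity of the spectrum *)

Section SpectralOperator.
Context {R : realType} {V : countType}.
Variable E : set R -> (V -> R) -> V -> R.
Variable A : (V -> R) -> (V -> R) -> Prop.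
Hypothesis hEA : spectral_measure_of (fun=> 1) E A.
Hypothesis A_ge0 : forall u w, A u w -> 0 <= dot w u.
Implicit Types (f g h u w : V -> R) (B C : set R) (psi : R -> R).

Let hE : projection_valued_measure (fun=> 1) E := proj1 hEA.

Lemma spectral_operatorP u w : A u w <-> [/\ id_domain hE u, sq_summable w &
  forall g, id_domain hE g -> dot w g = pairing hE idfun u g].
Proof.
rewrite (proj2 hEA); split=> [[/(id_domainE hE) ud /in_l2_1 ws H]|[ud ws H]].
  split => // g gd; have := H _ (proj2 (id_domainE hE g) gd).
  by rewrite inner_1 (spectral_pairingE hE _ ud.1 gd.1).
split; [exact/(id_domainE hE)|exact/in_l2_1|move=> g /(id_domainE hE) gd].
by rewrite inner_1 (spectral_pairingE hE _ ud.1 gd.1); exact: H.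
Qed.

(** For [f = E B h], [<A f, f>] is the integral of [s] over [B], at most [- n.+1^-1] times the mass
    of [B], and it is nonnegative by hypothesis. Boundedness of [B] puts [f] in the domain of [A];
    its distance from 0 forces the mass to vanish. *)
Lemma spm_neg_itv h (n : nat) : sq_summable h ->
  spm hE h [set` `[- n.+1%:R, - n.+1%:R^-1]] = 0%E.
Proof.
move=> hs; set B := [set` _]; have mB : measurable B by exact: measurable_itv.
set f := E B h; have fs : sq_summable f by exact: E_sq_summable.
pose psi s := s * \1_B s : R.
have mpsi : measurable_fun setT psi by apply: measurable_funM => //; exact: measurable_indic.
have bd s : B s -> `|s| <= n.+1%:R :> R.
  rewrite /B/= in_itv/= => /andP[s1 s2]; rewrite ler_norml s1/=.
  by rewrite (le_trans s2)// lerNl (le_trans (_ : _ <= 0))// ?oppr_le0// invr_ge0.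
have psibd s : `|psi s| <= n.+1%:R.
  rewrite /psi indicE; case: (boolP (s \in B)) => [/set_mem /bd sB|_].
    by rewrite mulr1.
  by rewrite mulr0 normr0.
have fd : id_domain hE f := bounded_id_domain hE mB bd hs.
have [w ws wE] := spectral_riesz hE mpsi psibd fs.
have fB : E (~` B) f = fun=> 0.
  by rewrite /f -(E_setI hE)//; [rewrite setICl (E_set0 hE)|exact: measurableC].
have Afw : A f w.
  apply/spectral_operatorP; split => // g gd; rewrite (wE _ (proj1 gd)).
  apply: (@pairing_local _ _ _ hE psi idfun f g B) => //; first exact: (proj1 gd).
  - by move=> s Bs; rewrite /psi indicE mem_set// mulr1.
  - exact: (bounded_pair_integrable hE _ _ mpsi psibd).
  - exact: id_domain_pair.
have := A_ge0 Afw; rewrite wE// (pairing_diag fs); last 2 first.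
- exact: (bounded_pair_integrable hE _ _ mpsi psibd).
- exact: (bounded_spm_integrable hE _ mpsi psibd).
have le : (\int[spm hE f]_s psi s)%R <= (\int[spm hE f]_s (- n.+1%:R^-1 * \1_B s))%R.
  apply: le_Rintegral => //.
  - exact: (bounded_spm_integrable hE _ mpsi psibd).
  - apply: (@bounded_spm_integrable _ _ _ hE _ _ 1).
      by apply: measurable_funM => //; exact: measurable_indic.
    move=> s; rewrite indicE normrM normrN (ger0_norm (_ : 0 <= n.+1%:R^-1)) ?invr_ge0//.
    case: (s \in B); rewrite ?normr1 ?mulr1 ?normr0 ?mulr0//.
    by rewrite invf_le1// ler1n.
  - move=> s _; rewrite /psi indicE; case: (boolP (s \in B)) => [/set_mem|_]; rewrite ?mulr0// !mulr1.
    by rewrite /B/= in_itv/= => /andP[].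
move=> /le_trans /(_ le).
rewrite RintegralZl//; last exact: integrable_indic.
rewrite /Rintegral integral_indic// setIT => H.
have fB1 : spm hE f B = spm hE h B by rewrite (spm_E hE mB mB hs) setIid.
move: H; rewrite -[fine _]/(fine (spm hE f B)) fB1 mulNr oppr_ge0 pmulr_rle0 ?invr_gt0// => H.
rewrite -(fine_spm hE _ mB); congr EFin; apply/eqP; rewrite eq_le H fine_ge0//.
Qed.

Lemma spm_neg h : sq_summable h -> spm hE h [set` `]-oo, 0[] = 0%E.
Proof.
move=> hs; pose F n := [set` `[- n.+1%:R, - n.+1%:R^-1]] : set R.
have FE : [set` `]-oo, 0[] = \bigcup_n F n.
  apply/seteqP; split=> [s|s [n _]]; rewrite /F/= !in_itv/=; last first.
    by move=> /andP[_ sn]; rewrite (le_lt_trans sn)// oppr_lt0 invr_gt0.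
  move=> s0; have ms : 0 < - s by rewrite oppr_gt0.
  have [n Hn] : exists n : nat, Num.max (- s) (- s)^-1 < n.+1%:R.
    exists (Num.truncn (Num.max (- s) (- s)^-1)); exact: truncnS_gt.
  exists n => //=; move: Hn; rewrite gt_max in_itv/= => /andP[H1 H2]; apply/andP; split.
    by rewrite lerNl ltW.
  by rewrite lerNr -[leRHS]invrK lef_pV2 ?posrE ?invr_gt0// ltW.
have mF n : measurable (F n) by exact: measurable_itv.
rewrite FE; apply/negligibleP; first exact: bigcupT_measurable.
apply: negligible_bigcup => n; apply/negligibleP; first exact: mF.
exact: spm_neg_itv.
Qed.

End SpectralOperator.

(** * Nonnegative operators *)

Section PositiveOperator.
Context {R : realType} {V : countType}.
Variable E : set R -> (V -> R) -> V -> R.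
Variable A : (V -> R) -> (V -> R) -> Prop.
Hypothesis hEA : spectral_measure_of (fun=> 1) E A.
Hypothesis A_ge0 : forall u w, A u w -> 0 <= dot w u.
Implicit Types (f g h u w : V -> R) (B C : set R) (psi : R -> R).

Let hE : projection_valued_measure (fun=> 1) E := proj1 hEA.

(* Truncating at 0 does not affect integrals, since the spectrum is nonnegative, and
   makes functions such as [expR (- t * s)] bounded on the whole line. *)
Definition pos (s : R) : R := Num.max s 0.

Lemma pos_ge0 s : 0 <= pos s. Proof. by rewrite le_max lexx orbT. Qed.

Lemma measurable_pos : measurable_fun setT pos.
Proof. by apply: measurable_maxr. Qed.

Let D : set R := [set` `[0, +oo[].

Let mD : measurable D. Proof. exact: measurable_itv. Qed.

Let D_null f : sq_summable f -> spm hE f (~` D) = 0%E.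
Proof.
move=> fs; rewrite -[RHS](spm_neg hEA A_ge0 fs); congr (spm _ _ _).
apply/seteqP; split => s; rewrite /D /= !in_itv/= andbT.
  by move=> /negP; rewrite -ltNge.
by rewrite ltNge => /negP.
Qed.

Let pos_D s : D s -> pos s = s.
Proof. by rewrite /D/= in_itv/= andbT => s0; rewrite /pos max_l. Qed.

Lemma integral_pos psi f : measurable_fun setT psi -> sq_summable f ->
  (\int[spm hE f]_s (psi s)%:E = \int[spm hE f]_s (psi (pos s))%:E)%E.
Proof.
move=> mpsi fs; apply: (spm_null_integral mD (D_null fs)) => //.
  by apply: measurableT_comp => //; exact: measurable_pos.
by move=> s /pos_D ->.
Qed.

Lemma integrable_pos psi f : measurable_fun setT psi -> sq_summable f ->
  spm_integrable hE psi f -> spm_integrable hE (fun s => psi (pos s)) f.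
Proof.
move=> mpsi fs; apply: (spm_null_integrable mD (D_null fs)) => //.
  by apply: measurableT_comp => //; exact: measurable_pos.
by move=> s /pos_D ->.
Qed.

Lemma pairing_pos psi f g : measurable_fun setT psi -> sq_summable f -> sq_summable g ->
  pairing hE psi f g = pairing hE (fun s => psi (pos s)) f g.
Proof.
move=> mpsi fs gs; rewrite /pairing /Rintegral.
by rewrite (integral_pos mpsi (sq_summableD fs gs)) (integral_pos mpsi (sq_summableB fs gs)).
Qed.

Lemma semigroupE (t : R) x y : 0 <= t ->
  semigroup (fun=> 1) E t (@delta R V x) y =
  pairing hE (fun s => expR (- t * pos s)) (@delta R V x) (@delta R V y).
Proof.
move=> t0; pose psi s := expR (- t * s).
have mpsi : measurable_fun setT psi.
  by apply: measurableT_comp => //; exact: measurable_funM.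
have mpsi' : measurable_fun setT (fun s => psi (pos s)).
  by apply: measurableT_comp => //; exact: measurable_pos.
have bd s : `|psi (pos s)| <= 1.
  rewrite ger0_norm ?expR_ge0// -expR0 ler_expR mulNr oppr_le0 mulr_ge0//.
  exact: pos_ge0.
have dx := @delta_sq_summable R V x; have dy := @delta_sq_summable R V y.
have dom f : sq_summable f -> spectral_domain (fun=> 1) E psi f.
  move=> fs; split; first exact/in_l2_1.
  rewrite (integral_spectral_distribution hE)//.
  rewrite (@integral_pos (fun s => psi s ^+ 2))//; last exact: measurable_funX.
  have : spm_integrable hE (fun s => psi (pos s) ^+ 2) f.
    apply: (@bounded_spm_integrable _ _ _ hE _ _ 1).
      exact: (@measurable_funX _ _ _ _ (fun s => psi (pos s))).
    by move=> s; rewrite normrX expr_le1.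
  move=> /integrableP[_]; apply: le_lt_trans.
  rewrite le_eqVlt; apply/orP; left; apply/eqP; apply: eq_integral => s _ /=.
  by rewrite ger0_norm// sqr_ge0.
have [w ws wE] := spectral_riesz hE mpsi' bd dx.
have wP : spectral_integral (fun=> 1) E psi (@delta R V x) w.
  split; [exact: dom|exact/in_l2_1|move=> g [/in_l2_1 gs _]].
  by rewrite inner_1 (spectral_pairingE hE _ dx gs) wE// (pairing_pos mpsi dx gs).
(* [xget] may pick a solution other than [w], but any solution is tested against [delta y], which
   lies in the domain, and this fixes its value at [y]. *)
have [_ /in_l2_1 zs zE] := xgetPex (fun=> 0) (ex_intro _ w wP).
rewrite /semigroup /spectral_calculus -(dot_delta _ y).
have := zE _ (dom _ dy); rewrite inner_1 (spectral_pairingE hE _ dx dy) => ->.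
exact: pairing_pos.
Qed.

(** * Spectral measures of [u] and [w] when [A u = w] *)

Section Graph.
Variables (u w : V -> R).
Hypothesis Auw : A u w.

Let ud : id_domain hE u := let: And3 h _ _ := proj1 (spectral_operatorP hEA u w) Auw in h.
Let us : sq_summable u := proj1 ud.
Let ws : sq_summable w := let: And3 _ h _ := proj1 (spectral_operatorP hEA u w) Auw in h.

Let wE g : id_domain hE g -> dot w g = pairing hE pos u g.
Proof.
move=> gd; have [_ _ ->//] := proj1 (spectral_operatorP hEA u w) Auw.
apply: (@pairing_pos idfun); [exact: measurable_id|exact: us|exact: (proj1 gd)].
Qed.

Let pos_integrable g : id_domain hE g -> spm_integrable hE pos g.
Proof.
move=> gd; apply: (@integrable_pos idfun); [exact: measurable_id|exact: (proj1 gd)|].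
exact: id_domain_integrable.
Qed.

Let pos_pair g h : id_domain hE g -> id_domain hE h -> pair_integrable hE pos g h.
Proof. by move=> gd hd; split; apply: pos_integrable; [exact: id_domainD|exact: id_domainB]. Qed.

Let mpos := measurable_pos.

(** Moving [E B] onto [u] gives the pairing of [u] with [E B u]. As projections commute,
    [<E C u, E B u>] is the spectral measure of [E B u], that is, the measure of [u] restricted to
    [B]. *)
Lemma dot_E_graph B : measurable B ->
  ((dot (E B w) u)%:E = \int[spm hE u]_(s in B) (pos s)%:E)%E.
Proof.
move=> mB; have Bu := id_domain_E mB ud; have Bus := proj1 Bu.
rewrite (E_sym hE mB ws us) wE//.
have -> : pairing hE pos u (E B u) = (\int[spm hE (E B u)]_s pos s)%R.
  rewrite -pairing_diag//; [|exact: pos_pair|exact: pos_integrable].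
  (* [pairing_lincomb] expects two terms; the second gets coefficient 0. *)
  rewrite -[RHS]mul1r -[RHS]addr0 -(mul0r (pairing hE pos (E B u) (E B u))).
  apply: pairing_lincomb => //; try exact: pos_pair.
  move=> C mC; rewrite mul1r mul0r addr0.
  rewrite (dot_E_E hE mC mB us us) -(E_setI hE mC mB us).
  by rewrite (dot_E_E hE (measurableI _ _ mC mB) mB us us) -setIA setIid.
rewrite /Rintegral fineK; last exact: (integrable_fin_num measurableT (pos_integrable Bu)).
have mC := measurableC mB.
rewrite (@spm_null_integral _ _ _ hE _ B pos (fun s => pos s * \1_B s))//.
- rewrite [RHS]integral_mkcond.
  rewrite (_ : (fun s => (pos s * \1_B s)%:E) = (fun s => (pos s)%:E) \_ B); last first.
    apply/funext => s; rewrite patchE indicE.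
    by case: ifPn => _; rewrite ?mulr1 ?mulr0.
  rewrite -!integral_mkcond; apply: eq_measure_integral => C mC' CB.
  rewrite -[LHS]/(spm hE (E B u) C) (spm_E hE mB mC' us).
  by rewrite (setIidl CB).
- rewrite (spm_E hE mB mC us) setICl; exact: measure0.
- by apply: measurable_funM => //; exact: measurable_indic.
- by move=> s Bs; rewrite indicE mem_set// mulr1.
Qed.

Let integral_indic_mul psi B (f : V -> R) : (\int[spm hE f]_s (psi s * \1_B s)%:E =
  \int[spm hE f]_(s in B) (psi s)%:E)%E.
Proof.
rewrite [RHS]integral_mkcond; apply: eq_integral => s _; rewrite patchE indicE.
by case: ifPn => _; rewrite ?mulr1 ?mulr0.
Qed.

Let mmul psi B : measurable B -> measurable_fun setT psi ->
  measurable_fun setT (fun s => psi s * \1_B s).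
Proof. by move=> mB mpsi; apply: measurable_funM => //; exact: measurable_indic. Qed.

(** The function [g = E B w] is in the domain because [B] is bounded, so [<w, g>] is the integral of
    [pos] against [C |-> <E C u, g>]. By [dot_E_graph] this measure has density [pos] on [B], which
    supplies the second factor. The 4 in [phi] undoes the quarter of the polarization. *)
Let spm_graph_bounded B (M : R) : measurable B -> (forall s, B s -> `|s| <= M) ->
  (spm hE w B = \int[spm hE u]_(s in B) (pos s ^+ 2)%:E)%E.
Proof.
move=> mB BM; have gd := bounded_id_domain hE mB BM ws.
set g := E B w in gd *; have gs := proj1 gd.
rewrite spmE// dotC -/g wE//.
have ip : spm_integrable hE pos (fun x => u x + g x) by apply/pos_integrable/id_domainD.
have im : spm_integrable hE pos (fun x => u x - g x) by apply/pos_integrable/id_domainB.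
pose phi s := 4 * pos s * \1_B s.
have mphi : measurable_fun setT phi by apply: mmul => //; exact: measurable_funM.
have phi0 s : 0 <= phi s by rewrite mulr_ge0// mulr_ge0// pos_ge0.
have dens C : measurable C -> (spm hE (fun x => u x + g x)%R C =
    spm hE (fun x => u x - g x)%R C + \int[spm hE u]_(s in C) (phi s)%:E)%E.
  move=> mC; have mCB := measurableI _ _ mC mB.
  have -> : (\int[spm hE u]_(s in C) (phi s)%:E = (4 * dot (E C u) g)%:E)%E.
    rewrite /g (dotC (E C u)) (dot_E_E hE mB mC ws us) setIC EFinM dot_E_graph//.
    rewrite -ge0_integralZl//; last 2 first.
    - by apply/measurable_EFinP; exact: measurable_funTS.
    - by move=> s _; rewrite lee_fin pos_ge0.
    rewrite [RHS]integral_mkcond [LHS]integral_mkcond; apply: eq_integral => s _.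
    rewrite !patchE in_setI /phi indicE -EFinM.
    by case: (s \in C) => //=; case: (s \in B); rewrite /= ?mulr1 ?mulr0.
  have := polarization hE mC us gs.
  rewrite -(fine_spm hE _ mC) -[X in (_ = X + _)%E](fine_spm hE _ mC) -EFinD => <-.
  by congr EFin; rewrite addrC subrK.
have := ge0_integral_density mphi phi0 dens mpos pos_ge0.
have -> : (\int[spm hE u]_s (pos s * phi s)%:E =
    4%:E * \int[spm hE u]_(s in B) (pos s ^+ 2)%:E)%E.
  rewrite -(integral_indic_mul (fun s => pos s ^+ 2)) -ge0_integralZl//.
  - by apply: eq_integral => s _; rewrite /phi -EFinM; congr EFin; ring.
  - apply/measurable_EFinP; apply: mmul => //; exact: measurable_funX.
  - by move=> s _; rewrite lee_fin mulr_ge0// sqr_ge0.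
have Z0 : (0 <= \int[spm hE u]_(s in B) (pos s ^+ 2)%:E)%E.
  by apply: integral_ge0 => s _; rewrite lee_fin sqr_ge0.
rewrite /pairing /Rintegral.
rewrite -{1}(fineK (integrable_fin_num measurableT ip)) -{1}(fineK (integrable_fin_num measurableT im)).
set X1 := fine _; set X2 := fine _.
(* The value [+oo] is excluded: the two other integrals are finite, as [u + g] and [u - g] are in
   the domain. *)
case: (integral _ _ _) Z0 => [z||]//= z0.
- by rewrite -EFinM -EFinD => -[->]; congr EFin; field.
- by rewrite mulry gtr0_sg// mul1e.
Qed.

Lemma spm_graph B : measurable B ->
  (spm hE w B = \int[spm hE u]_(s in B) (pos s ^+ 2)%:E)%E.
Proof.
move=> mB; pose F (n : nat) := B `&` [set` `[- n%:R, n%:R]] : set R.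
have mF n : measurable (F n) by apply: measurableI => //; exact: measurable_itv.
have FB : \bigcup_n F n = B.
  rewrite /F -setI_bigcupr; apply/setIidl => s _.
  exists (Num.truncn `|s|).+1 => //=; rewrite in_itv/= -ler_norml ltW//.
  exact: truncnS_gt.
have ndF : nondecreasing_seq F.
  apply/nondecreasing_seqP => n; rewrite subsetEset; apply: setIS => s /=.
  rewrite !in_itv/= -!ler_norml => /le_trans; apply; by rewrite ler_nat.
have c1 : spm hE w (F n) @[n --> \oo] --> spm hE w B.
  rewrite -[in X in _ --> X]FB; apply: (nondecreasing_cvg_mu (mu := spm hE w)) => //.
  exact: bigcupT_measurable.
have c2 : (\int[spm hE u]_(s in F n) (pos s ^+ 2)%:E)%E @[n --> \oo] -->
    (\int[spm hE u]_(s in B) (pos s ^+ 2)%:E)%E.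
  rewrite -[in X in _ --> X]FB; apply: ge0_nondecreasing_set_cvg_integral => //.
  - move=> n; apply/measurable_EFinP; apply: measurable_funTS; exact: measurable_funX.
  - by move=> n s _; rewrite lee_fin sqr_ge0.
rewrite -(cvg_lim _ c1)// -(cvg_lim _ c2)//; congr (limn _); apply/funext => n.
apply: (@spm_graph_bounded _ n%:R) => // s [_] /=.
by rewrite in_itv/= -ler_norml.
Qed.

(** * Change of density under the shift by [alpha] *)

Section Shift.
Variable alpha : R.
Hypothesis alpha0 : 0 < alpha.

Definition shift_inv (s : R) : R := (pos s + alpha)^-1.

Let r x := w x + alpha * u x.

Let rs : sq_summable r. Proof. by apply: sq_summableD => //; exact: sq_summableZ. Qed.

Let pa0 s : 0 < pos s + alpha. Proof. by rewrite ltr_wpDl// pos_ge0. Qed.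

Lemma shift_inv_gt0 s : 0 < shift_inv s. Proof. by rewrite invr_gt0. Qed.

Lemma measurable_shift : measurable_fun setT (fun s => pos s + alpha).
Proof. by apply: measurable_funD. Qed.

Lemma measurable_shift_inv : measurable_fun setT shift_inv.
Proof.
rewrite (_ : shift_inv = fun s => expR (- ln (pos s + alpha))); last first.
  by apply/funext => s; rewrite expRN lnK// posrE.
apply: measurableT_comp => //; apply: measurableT_comp => //.
by apply: measurableT_comp => //; exact: measurable_shift.
Qed.

Let pEFin B psi : measurable_fun setT psi -> measurable_fun B (fun s => (psi s)%:E).
Proof. by move=> m; apply/measurable_EFinP; exact: measurable_funTS. Qed.

(** Expanding [<E B r, r>] yields the densities [s^2] for [w], [2 alpha s] for the cross term and
    [alpha^2] for [u], a perfect square. *)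
Let spm_shift B : measurable B ->
  (spm hE r B = \int[spm hE u]_(s in B) ((pos s + alpha) ^+ 2)%:E)%E.
Proof.
move=> mB; have Bw := E_sq_summable hE mB ws; have Bu := E_sq_summable hE mB us.
have aus := @sq_summableZ _ _ alpha _ us.
have -> : spm hE r B = (spm hE w B + ((2 * alpha)%:E * (dot (E B w) u)%:E + (alpha ^+ 2)%:E * spm hE u B))%E.
  rewrite !spmE// -!EFinM -!EFinD; congr EFin.
  rewrite /r (E_D hE mB ws aus) (E_Z hE _ mB us).
  rewrite (dotDl Bw (@sq_summableZ _ _ alpha _ Bu) rs) dotZl !(dotDr ws aus)// !dotZr.
  by rewrite (E_sym hE mB us ws) (dotC u); ring.
rewrite spm_graph// dot_E_graph//.
have mp2 : measurable_fun setT (fun s => pos s ^+ 2) by exact: measurable_funX.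
rewrite -ge0_integralZl//; last 3 first.
- exact: pEFin.
- by move=> s _; rewrite lee_fin pos_ge0.
- by rewrite lee_fin mulr_ge0// ltW.
rewrite -[X in (_ + (_ + _ * X))%E]mul1e -integral_cst// -ge0_integralZl ?lee_fin ?sqr_ge0//.
rewrite -ge0_integralD//; last 3 first.
- by move=> s _; rewrite -EFinM lee_fin !mulr_ge0 ?pos_ge0 ?ltW.
- by apply: (pEFin (psi := fun s => 2 * alpha * pos s)); exact: measurable_funM.
- by move=> s _; rewrite mule1 lee_fin sqr_ge0.
rewrite -ge0_integralD//; last 4 first.
- by move=> s _; rewrite lee_fin sqr_ge0.
- exact: pEFin.
- by move=> s _; rewrite mule1 -EFinM -EFinD lee_fin addr_ge0 ?sqr_ge0// !mulr_ge0 ?pos_ge0 ?ltW.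
- apply: (pEFin (psi := fun s => 2 * alpha * pos s + alpha ^+ 2 * 1)).
  by apply: measurable_funD => //; exact: measurable_funM.
by apply: eq_integral => s _; rewrite -!EFinM -!EFinD; congr EFin; ring.
Qed.

Let shift_density psi : measurable_fun setT psi -> (forall s, 0 <= psi s) ->
  (\int[spm hE r]_s (psi s)%:E = \int[spm hE u]_s (psi s * (pos s + alpha) ^+ 2)%:E)%E.
Proof.
move=> mpsi psi0.
have := @ge0_integral_density _ _ _ (spm hE r) mzero (spm hE u) (fun s => (pos s + alpha) ^+ 2) psi.
rewrite integral_measure_zero add0e; apply => //.
- by apply: measurable_funX; exact: measurable_shift.
- by move=> s; exact: sqr_ge0.
- by move=> B mB; rewrite /mzero add0e; exact: spm_shift.
Qed.

(** The density leaves one factor [s + alpha], whose integral against the measure of [u] is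
    [<w, u> + alpha <u, u>]. *)
Lemma integral_shift_inv : (\int[spm hE r]_s (shift_inv s)%:E = (dot r u)%:E)%E.
Proof.
rewrite shift_density; [|exact: measurable_shift_inv|by move=> s; rewrite ltW// shift_inv_gt0].
have -> : dot r u = dot (E setT w) u + alpha * dot u u.
  by rewrite (E_setT hE ws) /r dotDl// ?dotZl//; exact: sq_summableZ.
rewrite EFinD dot_E_graph// EFinM -(spm_T hE us).
rewrite -integral_cst// -ge0_integralD//.
- apply: eq_integral => s _; rewrite -EFinD; congr EFin.
  by rewrite expr2 mulrA mulVf ?mul1r// gt_eqF.
- by move=> s _; rewrite lee_fin pos_ge0.
- exact: pEFin.
- by move=> s _; rewrite lee_fin ltW.
Qed.

(** The density cancels two factors of [shift_inv], at the price of passing from [r] to its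
    resolvent [u]. *)
Lemma integral_shift_inv_pow k :
  (\int[spm hE r]_s (shift_inv s ^+ (2 * k.+1))%:E = \int[spm hE u]_s (shift_inv s ^+ (2 * k))%:E)%E.
Proof.
rewrite shift_density.
- apply: eq_integral => s _; congr EFin; rewrite mulnS exprD mulrC mulrA -exprMn mulfV ?expr1n ?mul1r//.
  by rewrite gt_eqF.
- by apply: measurable_funX; exact: measurable_shift_inv.
- by move=> s; rewrite exprn_ge0// ltW// shift_inv_gt0.
Qed.

End Shift.
End Graph.
End PositiveOperator.

(** * Exponential limits and Laplace transforms *)

Section Exponential.
Context {R : realType}.

(** Squeeze, with [y = x / n] and [n] even: [1 + y <= e^y] bounds the power below by [e^(-x)], and
    [(1 + y)^-1 = 1 - y / (1 + y) <= e^(- y / (1 + y))] bounds it above by [e^(- x / (1 + y))]. *)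
Lemma cvg_expRN (x : R) : 0 <= x ->
  (1 + x / (2 * k.+1)%:R) ^- (2 * k.+1) @[k --> \oo] --> expR (- x).
Proof.
move=> x0; pose y k := x / (2 * k.+1)%:R.
have y0 k : 0 <= y k by rewrite divr_ge0.
have y1 k : 0 < 1 + y k by rewrite ltr_pwDl.
have yn k : (2 * k.+1)%:R * y k = x by rewrite mulrC divfK// pnatr_eq0.
have ycvg : y k @[k --> \oo] --> 0.
  rewrite (_ : y = fun k => (x / 2) * (k.+1%:R)^-1); last first.
    by apply/funext => k; rewrite /y natrM invfM mulrA.
  rewrite -[X in _ --> X](mulr0 (x / 2)); apply: cvgM; first exact: cvg_cst.
  exact: cvg_harmonic.
apply: (@squeeze_cvgr _ _ _ _ (fun=> expR (- x)) (fun k => expR (- (x / (1 + y k))))).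
- apply: nearW => k; apply/andP; split.
    rewrite -/(y k) expRN lef_pV2 ?posrE ?expR_gt0 ?exprn_gt0//.
    rewrite -[in leRHS](yn k) expRM_natl; apply: lerXn2r; rewrite ?nnegrE ?expR_ge0 ?(ltW (y1 k))//.
    exact: expR_ge1Dx.
  rewrite -exprVn -/(y k).
  have -> : - (x / (1 + y k)) = (2 * k.+1)%:R * (- (y k / (1 + y k))).
    by rewrite mulrN mulrA yn.
  rewrite expRM_natl; apply: lerXn2r; rewrite ?nnegrE ?expR_ge0 ?invr_ge0 ?(ltW (y1 k))//.
  apply: le_trans (expR_ge1Dx _); rewrite le_eqVlt; apply/orP; left; apply/eqP.
  by field; rewrite gt_eqF.
- exact: cvg_cst.
- apply: (@cvg_comp _ _ _ (fun k => - (x / (1 + y k))) expR _ (nbhs (- x))); last exact: continuous_expR.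
  apply: cvgN; rewrite -[X in _ --> X]divr1; apply: cvgM; first exact: cvg_cst.
  apply: cvgV; first exact: oner_neq0.
  by rewrite -[X in _ --> X](addr0 1); apply: cvgD => //; exact: cvg_cst.
Qed.

Variables (mu : {finite_measure set R -> \bar R}) (phi : R -> R) (alpha : R).
Hypothesis mphi : measurable_fun setT phi.
Hypothesis phi0 : forall s, 0 <= phi s.

Lemma measurable_laplace (f := fun t : R => (\int[mu]_s (expR (- t * phi s))%:E)%E) :
  measurable_fun setT f.
Proof.
apply: (@measurable_fun_fubini_tonelli_F _ _ _ _ _ mu
  (fun z : R * R => (expR (- z.1 * phi z.2))%:E)).
- apply/measurable_EFinP; apply: measurableT_comp => //; apply: measurable_funM.
    by apply: measurableT_comp.
  by apply: measurableT_comp.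
- by move=> z; rewrite lee_fin expR_ge0.
Qed.

Hypothesis alpha0 : 0 < alpha.

Lemma laplace_transform :
  (\int[lebesgue_measure]_(t in `[0%R, +oo[)
      ((expR (- t * alpha))%:E * \int[mu]_s (expR (- t * phi s))%:E) =
   \int[mu]_s ((phi s + alpha)^-1)%:E)%E.
Proof.
have pa s : 0 < phi s + alpha by rewrite ltr_wpDl.
pose f (z : R * R) : \bar R := ((expR (- z.1 * alpha) * expR (- z.1 * phi z.2)) * \1_`[0%R, +oo[ z.1)%:E.
have mf : measurable_fun setT f.
  apply/measurable_EFinP; apply: measurable_funM; first apply: measurable_funM.
  - apply: measurableT_comp => //; apply: measurable_funM => //.
    by apply: measurableT_comp.
  - apply: measurableT_comp => //; apply: measurable_funM.
      by apply: measurableT_comp.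
    by apply: measurableT_comp.
  - have m1 : measurable_fun setT (\1_`[0%R, +oo[ : R -> R) by exact: measurable_indic.
    exact: (measurableT_comp m1 measurable_fst).
have f0 z : (0 <= f z)%E by rewrite lee_fin !mulr_ge0 ?expR_ge0.
have := fubini_tonelli (m1 := lebesgue_measure) (m2 := mu) f mf f0.
have -> : (\int[mu]_s \int[lebesgue_measure]_t f (t, s) = \int[mu]_s ((phi s + alpha)^-1)%:E)%E.
  apply: eq_integral => s _.
  (* The inner integral is read off the exponential law of rate [phi s + alpha], whose total mass is
     1. *)
  rewrite -[RHS]mule1 -(integral_exponential_pdf (pa s)) -ge0_integralZl//.
  - apply: eq_integral => t _; rewrite -EFinM; congr EFin.
    rewrite /exponential_pdf patchE indicE /=.
    case: (t \in _); rewrite ?mulr1 ?mulr0//.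
    rewrite mulrA mulVf ?gt_eqF// mul1r -expRD; congr expR; ring.
  - by apply/measurable_EFinP; exact: measurable_exponential_pdf.
  - by move=> t _; rewrite lee_fin exponential_pdf_ge0// ltW.
  - by rewrite lee_fin invr_ge0 ltW.
move=> <-; rewrite integral_mkcond; apply: eq_integral => t _.
rewrite patchE /f/= indicE; case: (t \in _); last first.
  by rewrite integral0_eq// => s _; rewrite mulr0.
rewrite -ge0_integralZl//.
- by apply: eq_integral => s _; rewrite -EFinM mulr1.
- by apply/measurable_EFinP; apply: measurableT_comp => //; exact: measurable_funM.
Qed.

End Exponential.

(** * The random walk *)

Section RandomWalk.
Context {R : realType} {V : countType}.
Variable b : V -> V -> R.
Hypothesis bG : weighted_graph b (fun=> 0).
Hypothesis d0 : forall x, 0 < vdeg b x.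

Let b0 x y : 0 <= b x y := graph_b_ge0 bG x y.
Local Notation d := (vdeg b).
Local Notation P := (transition b (fun=> 0)).
Local Notation dl := (@delta R V).

Let P0 x y : 0 <= P x y.
Proof. exact: (divr_ge0 (b0 x y) (ltW (d0 x))). Qed.

(* At [alpha = 0] the Neumann series of [delta y] is the Green function of the walk. *)
Lemma matrix_power_neumann n x y :
  matrix_power P n x y = (d y * neumann b 0 (dl y) n x)%:E /\
  0 <= d y * neumann b 0 (dl y) n x <= 1.
Proof.
elim: n x => [|n IH] x /=.
  rewrite /delta addr0; case: eqVneq => [->|xy]; last by rewrite mul0r mulr0 lexx ler01.
  by rewrite mul1r mulfV ?gt_eqF// lexx ler01.
(* The bound by 1, which persists because the rows of [P] sum to 1, is carried along the induction:
   it makes the one-step sum finite, so that [rsum] and [esum] agree. *)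
pose q z := d y * neumann b 0 (dl y) n z.
have Ps : abs_summable (fun z => P x z * q z).
  apply: (abs_summable_le _ (abs_summableZ (d x)^-1 (b_summable bG x))) => z.
  have [_ /andP[q0 q1]] := IH z.
  rewrite (ger0_norm (mulr_ge0 (P0 x z) q0)) ger0_norm; last first.
    by rewrite mulr_ge0 ?invr_ge0// ltW.
  by rewrite -[P x z]/(b x z / d x) (mulrC (b x z)) ler_piMr// mulr_ge0// invr_ge0 ltW.
have Pq z : 0 <= P x z * q z by rewrite mulr_ge0//; have [_ /andP[]] := IH z.
have qE : d y * (bsum b (neumann b 0 (dl y) n) x / (d x + 0)) = rsum (fun z => P x z * q z).
  rewrite addr0 /bsum (mulrC (rsum _)) -!rsumZ; congr rsum; apply/funext => z.
  by rewrite /q -[P x z]/(b x z / d x); ring.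
rewrite qE; split.
  by rewrite rsum_EFin//; apply: eq_esum => z _; have [-> _] := IH z; rewrite -EFinM.
rewrite rsum_ge0//=; apply: (@le_trans _ _ (rsum (P x))).
  have PS : abs_summable (P x).
    rewrite (_ : P x = fun z => (d x)^-1 * b x z); first exact/abs_summableZ/b_summable.
    by apply/funext => z; rewrite mulrC.
  by apply: ler_rsum => // z; have [_ /andP[q0 q1]] := IH z; rewrite ler_piMr.
rewrite (_ : P x = fun z => (d x)^-1 * b x z); last by apply/funext => z; rewrite mulrC.
by rewrite rsumZ -(vdegE bG) mulVf// gt_eqF.
Qed.

Lemma neumann0_ge0 n x y : 0 <= neumann b 0 (dl y) n x.
Proof.
by have [_ /andP[+ _]] := matrix_power_neumann n x y; rewrite pmulr_rge0.
Qed.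

Lemma neumann0_norm n x y : `|neumann b 0 (dl y) n x| <= (d y)^-1.
Proof.
have [_ /andP[_]] := matrix_power_neumann n x y.
by rewrite ger0_norm ?neumann0_ge0// -ler_pdivlMl// mulr1.
Qed.

Lemma delta_ge0 x z : 0 <= dl x z. Proof. by rewrite ler0n. Qed.

Lemma delta_summable x : abs_summable (dl x).
Proof. by apply: (@abs_summable_single _ _ x) => z /negPf zx; rewrite /delta zx. Qed.

Let a (j : nat) : R := j.+1%:R^-1.
Let a0 j : 0 < a j. Proof. by rewrite invr_gt0. Qed.
Let anI j i : (j <= i)%N -> a i <= a j.
Proof. by move=> ji; rewrite lef_pV2 ?posrE// ler_nat. Qed.

(** A smaller [alpha] enlarges every factor [(d z + alpha)^-1], so the terms increase with [j] and
    the limit passes through [bsum] by monotone convergence. *)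
Lemma neumann_alpha_cvg n x y :
  nondecreasing_seq (fun j => neumann b (a j) (dl y) n x) /\
  neumann b (a j) (dl y) n x @[j --> \oo] --> neumann b 0 (dl y) n x.
Proof.
have da j z : 0 < d z + a j by rewrite addr_gt0.
have inv_nd z i j : (i <= j)%N -> (d z + a i)^-1 <= (d z + a j)^-1.
  by move=> ij; rewrite lef_pV2 ?posrE// lerD2l anI.
have inv_cvg z : (d z + a j)^-1 @[j --> \oo] --> (d z + 0)^-1.
  apply: cvgV; first by rewrite addr0 gt_eqF.
  by apply: cvgD; [exact: cvg_cst|exact: cvg_harmonic].
elim: n x => [|n IH] x; split.
- by move=> i j ij /=; rewrite ler_wpM2l ?delta_ge0 ?inv_nd.
- by apply: cvgM; [exact: cvg_cst|exact: inv_cvg].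
- move=> i j ij /=; have bs0 k : 0 <= bsum b (neumann b (a k) (dl y) n) x.
    by apply: (bsum_ge0 bG) => z; apply: (neumann_ge0 bG (a0 k)); exact: delta_ge0.
  apply: ler_pM; rewrite ?invr_ge0 ?bs0// ?(ltW (da _ _))//; last exact: inv_nd.
  (* This bound grows with [k]; it serves only for summability at a fixed [k]. *)
  have bd k z : `|neumann b (a k) (dl y) n z| <= rsum (dl y) / a k.
    by apply: (neumann_norm bG (a0 k)); [exact: delta_ge0|exact: delta_summable].
  apply: ler_rsum => [||z]; [exact: (bsum_summable bG _ (bd _))..|].
  by rewrite ler_wpM2l//; exact: (proj1 (IH z)).
- apply: cvgM; last exact: inv_cvg.
  apply: rsum_cvg => [k z|z i j ij|z|].
  + by rewrite mulr_ge0//; apply: (neumann_ge0 bG (a0 k)); exact: delta_ge0.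
  + by rewrite ler_wpM2l//; exact: (proj1 (IH z)).
  + by apply: cvgM; [exact: cvg_cst|exact: (proj2 (IH z))].
  + by apply: (bsum_summable bG) => z; exact: neumann0_norm.
Qed.

Lemma resolvent_series alpha r x : 0 < alpha -> (forall z, 0 <= r z) -> abs_summable r ->
  (resolvent b alpha r x)%:E = \esum_(n in [set: nat]) (neumann b alpha r n x)%:E.
Proof.
move=> al0 r0 rs; rewrite -nneseries_esumT; last first.
  by move=> n; rewrite lee_fin (neumann_ge0 bG al0).
apply/esym/cvg_lim => //.
have -> : (fun n => (\sum_(0 <= k < n) (neumann b alpha r k x)%:E)%E) =
    EFin \o (neumann_sum b alpha r ^~ x).
  by apply/funext => n; rewrite /= sumEFin big_mkord.
by apply: cvg_EFin; [exact: nearW|exact: neumann_sum_cvg].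
Qed.

(** All terms of the series increase with [j], so limit and sum exchange in [[0, +oo]], whether or
    not the sum is finite. *)
Lemma resolvent_green x y :
  (resolvent b (a j) (dl y) x)%:E @[j --> \oo] -->
  ((d y)^-1%:E * \sum_(0 <= n <oo) matrix_power P n x y)%E.
Proof.
have mp0 n : (0 <= matrix_power P n x y)%E.
  by have [-> /andP[+ _]] := matrix_power_neumann n x y; rewrite lee_fin.
rewrite -nneseriesZl; last by move=> n _.
have -> : (\sum_(0 <= n <oo) ((d y)^-1%:E * matrix_power P n x y))%E =
    \esum_(n in [set: nat]) (neumann b 0 (dl y) n x)%:E.
  rewrite -nneseries_esumT; last by move=> n; rewrite lee_fin neumann0_ge0.
  apply: eq_eseriesr => n _; have [-> _] := matrix_power_neumann n x y.
  by rewrite -EFinM mulrA mulVf ?mul1r// gt_eqF.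
under eq_fun => j do rewrite (resolvent_series x (a0 j) (@delta_ge0 y) (@delta_summable y)).
apply: esum_cvg => [j n|n i j ij|n].
- by rewrite lee_fin; apply: (neumann_ge0 bG (a0 j)); exact: delta_ge0.
- by rewrite lee_fin; exact: (proj1 (neumann_alpha_cvg n x y)).
- by apply: cvg_EFin; [exact: nearW|exact: (proj2 (neumann_alpha_cvg n x y))].
Qed.

End RandomWalk.

(** * The heat kernel *)

Section HeatKernel.
Context {R : realType} {V : countType}.
Variable b : V -> V -> R.
Hypothesis bG : weighted_graph b (fun=> 0).
Variable E : set R -> (V -> R) -> V -> R.
Hypothesis hEA : spectral_measure_of (fun=> 1) E
                    (dirichlet_operator b (fun=> 0) (fun=> 1)).

Local Notation A := (dirichlet_operator b (fun=> 0) (fun=> 1)).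
Local Notation dl := (@delta R V).
Let hE : projection_valued_measure (fun=> 1) E := proj1 hEA.
Let A_ge0 u w : A u w -> 0 <= dot w u := @dirichlet_operator_ge0 R V b bG u w.

Definition resolvent_iter alpha k x : V -> R := iter k (resolvent b alpha) (dl x).

Lemma resolvent_iter_ge0_summable alpha k x : 0 < alpha ->
  (forall z, 0 <= resolvent_iter alpha k x z) /\ abs_summable (resolvent_iter alpha k x).
Proof.
move=> al0; elim: k => [|k [IH1 IH2]].
  by split; [move=> z; exact: delta_ge0|exact: delta_summable].
by split; [exact: (resolvent_ge0 bG al0 IH1 IH2)|exact: (resolvent_summable bG al0 IH1 IH2)].
Qed.

Variables x y : V.

(** The [k]-th power of the resolvent applied to [delta x + s delta y]; [s = 1] and [s = -1] are the
    two vectors of the polarization, treated together. *)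
Definition resolvent_comb alpha (s : R) k z : R :=
  s * resolvent_iter alpha k y z + resolvent_iter alpha k x z.

Lemma resolvent_comb_operator alpha s k : 0 < alpha ->
  A (resolvent_comb alpha s k.+1)
    (fun z => resolvent_comb alpha s k z - alpha * resolvent_comb alpha s k.+1 z).
Proof.
move=> al0; have [y0 ys] := resolvent_iter_ge0_summable k y al0.
have [x0 xs] := resolvent_iter_ge0_summable k x al0.
have := dirichlet_operatorD bG s (resolvent_operator bG al0 y0 ys) (resolvent_operator bG al0 x0 xs).
congr (dirichlet_operator _ _ _ _ _); apply/funext => z; rewrite /resolvent_comb /=; ring.
Qed.

Lemma resolvent_iter_sq_summable alpha k z : 0 < alpha -> sq_summable (resolvent_iter alpha k z).
Proof.
move=> al0; have [z0 zs] := resolvent_iter_ge0_summable k z al0.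
apply: (@bounded_sq_summable _ _ _ (rsum (resolvent_iter alpha k z))) => // v.
by rewrite ger0_norm// ler_rsum1.
Qed.

Lemma resolvent_comb_sq_summable alpha s k : 0 < alpha -> sq_summable (resolvent_comb alpha s k).
Proof.
move=> al0; apply: sq_summableD; first apply: sq_summableZ.
  exact: resolvent_iter_sq_summable.
exact: resolvent_iter_sq_summable.
Qed.

Lemma resolvent_combE alpha s k :
  (fun z => resolvent_comb alpha s k z - alpha * resolvent_comb alpha s k.+1 z +
            alpha * resolvent_comb alpha s k.+1 z) = resolvent_comb alpha s k.
Proof. by apply/funext => z; rewrite subrK. Qed.

(** Each use of [integral_shift_inv_pow] trades two factors of [shift_inv] for one more resolvent on
    the vector, until only the total mass is left. *)
Lemma resolvent_comb_pow alpha s m k : 0 < alpha ->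
  (\int[spm hE (resolvent_comb alpha s k)]_v (shift_inv alpha v ^+ (2 * m))%:E =
   (dot (resolvent_comb alpha s (k + m)) (resolvent_comb alpha s (k + m)))%:E)%E.
Proof.
move=> al0; elim: m k => [|m IH] k.
  under eq_integral do rewrite muln0 expr0.
  rewrite addn0 integral_cst// mul1e; exact: (spm_T hE (resolvent_comb_sq_summable s k al0)).
have := integral_shift_inv_pow hEA A_ge0 (resolvent_comb_operator s k al0) al0 m.
by rewrite resolvent_combE => ->; rewrite -/hE IH addSnnS.
Qed.

Lemma resolvent_comb_inv alpha s : 0 < alpha ->
  (\int[spm hE (resolvent_comb alpha s 0)]_v (shift_inv alpha v)%:E =
   (dot (resolvent_comb alpha s 0) (resolvent_comb alpha s 1))%:E)%E.
Proof.
move=> al0; have := integral_shift_inv hEA A_ge0 (resolvent_comb_operator s 0 al0) al0.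
by rewrite resolvent_combE.
Qed.

Lemma resolvent_comb0 alpha s : resolvent_comb alpha s 0 = fun z => s * dl y z + dl x z.
Proof. by []. Qed.

Let fD z := dl x z + dl y z.
Let fB z := dl x z - dl y z.

Let fDE alpha : resolvent_comb alpha 1 0 = fD.
Proof. by apply/funext => z; rewrite resolvent_comb0 /fD mul1r addrC. Qed.

Let fBE alpha : resolvent_comb alpha (-1) 0 = fB.
Proof. by apply/funext => z; rewrite resolvent_comb0 /fB mulN1r addrC. Qed.

Definition heat_kernel (t : R) : R := pairing hE (fun v => expR (- t * pos v)) (dl x) (dl y).

Let heat_kernelE t : heat_kernel t =
  4^-1 * ((\int[spm hE fD]_v expR (- t * pos v))%R - (\int[spm hE fB]_v expR (- t * pos v))%R).
Proof. by []. Qed.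

(** By polarization the difference is 4 times the scalar product of the [m]-th resolvent iterates of
    [delta y] and [delta x], both nonnegative functions. *)
Lemma shift_inv_pow_ge0 alpha m : 0 < alpha ->
  0 <= (\int[spm hE fD]_v (shift_inv alpha v ^+ (2 * m)))%R -
       (\int[spm hE fB]_v (shift_inv alpha v ^+ (2 * m)))%R.
Proof.
move=> al0; rewrite -(fDE alpha) -(fBE alpha) /Rintegral !resolvent_comb_pow//= add0n.
have [y0 ys] := resolvent_iter_ge0_summable m y al0; have [x0 xs] := resolvent_iter_ge0_summable m x al0.
have ys2 := resolvent_iter_sq_summable m y al0; have xs2 := resolvent_iter_sq_summable m x al0.
have dE s : dot (resolvent_comb alpha s m) (resolvent_comb alpha s m) =
    s ^+ 2 * dot (resolvent_iter alpha m y) (resolvent_iter alpha m y) +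
    2 * (s * dot (resolvent_iter alpha m y) (resolvent_iter alpha m x)) +
    dot (resolvent_iter alpha m x) (resolvent_iter alpha m x).
  rewrite (dot_expand (sq_summableZ s ys2) xs2) !dotZl dotZr; ring.
have : 0 <= dot (resolvent_iter alpha m y) (resolvent_iter alpha m x).
  by apply: rsum_ge0 => z; rewrite mulr_ge0.
rewrite !dE; move: (dot _ _) (dot _ _) (dot _ _) => d1 d2 d3; rewrite sqrrN expr1n; lra.
Qed.

Let mexp t : measurable_fun setT (fun v => expR (- t * pos v) : R).
Proof.
apply: measurableT_comp => //; apply: measurable_funM => //; exact: measurable_pos.
Qed.

Let exp_bd t v : 0 <= t -> `|expR (- t * pos v)| <= 1 :> R.
Proof.
move=> t0; rewrite ger0_norm ?expR_ge0// -expR0 ler_expR mulNr oppr_le0 mulr_ge0//.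
exact: pos_ge0.
Qed.

(* Post--Widder: the heat kernel is a limit of even powers of resolvents, and even
   powers have nonnegative matrix entries because the resolvent does. *)
Lemma heat_kernel_ge0 t : 0 <= t -> 0 <= heat_kernel t.
Proof.
rewrite le_eqVlt => /orP[/eqP <-|t0].
  rewrite heat_kernelE; have e1 v : expR (- 0 * pos v) = shift_inv 1 v ^+ (2 * 0) :> R.
    by rewrite oppr0 mul0r expR0 muln0 expr0.
  under eq_Rintegral do rewrite e1.
  under [X in _ - X]eq_Rintegral do rewrite e1.
  by rewrite mulr_ge0// shift_inv_pow_ge0.
rewrite heat_kernelE mulr_ge0//.
(* For [al = n / t], [(1 + t s / n)^-n = al^n (s + al)^-n], a positive multiple of an even power of
   [shift_inv al]. *)
pose n k := (2 * k.+1)%N; pose al k : R := (n k)%:R / t.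
have al0 k : 0 < al k by rewrite divr_gt0// ltr0n.
pose psi k v := (1 + t * pos v / (n k)%:R) ^- (n k) : R.
have psiE k v : psi k v = al k ^+ (n k) * shift_inv (al k) v ^+ (n k).
  rewrite /psi -exprVn -exprMn; congr (_ ^+ _); rewrite /shift_inv /al.
  have p0 := pos_ge0 v; have nk : 0 < (n k)%:R :> R by rewrite ltr0n.
  have h1 : 0 < 1 + t * pos v / (n k)%:R by rewrite ltr_pwDl// divr_ge0 ?mulr_ge0 ?(ltW t0) ?(ltW nk).
  have h2 : 0 < pos v + (n k)%:R / t by rewrite ltr_wpDl// divr_gt0.
  have h3 : pos v * t + (n k)%:R != 0 by rewrite gt_eqF// ltr_wpDl// mulr_ge0// ltW.
  by field; rewrite ?(gt_eqF nk) ?(gt_eqF t0) ?h3 ?[_ + t * _]addrC ?[t * _]mulrC ?h3.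
have mpsi k : measurable_fun setT (psi k).
  rewrite (funext (psiE k)); apply: measurable_funM => //.
  by apply: measurable_funX; exact: measurable_shift_inv.
have psi_bd k v : `|psi k v| <= 1.
  have h : 1 <= 1 + t * pos v / (n k)%:R by rewrite lerDl divr_ge0 ?mulr_ge0 ?pos_ge0 ?(ltW t0).
  rewrite /psi ger0_norm; last by rewrite invr_ge0 exprn_ge0// (le_trans _ h).
  by rewrite invf_le1 ?exprn_ege1// exprn_gt0// (lt_le_trans _ h).
have cv f : (\int[spm hE f]_v psi k v)%R @[k --> \oo] --> (\int[spm hE f]_v expR (- t * pos v))%R.
  have [] := @dominated_convergence _ _ _ (spm hE f) setT measurableT
    (fun k v => (psi k v)%:E) (fun v => (expR (- t * pos v))%:E) (cst 1%:E).
  - by move=> k; apply/measurable_EFinP.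
  - by apply/measurable_EFinP.
  - apply: aeW => v _; apply: cvg_EFin; first exact: nearW.
    by rewrite mulNr; apply: cvg_expRN; rewrite mulr_ge0 ?pos_ge0 ?ltW.
  - exact: finite_measure_integrable_cst.
  - by apply: aeW => v k _; rewrite /= lee_fin.
  move=> ie _ c; apply: fine_cvg; rewrite fineK//.
  exact: (integrable_fin_num measurableT ie).
have c : (\int[spm hE fD]_v psi k v)%R - (\int[spm hE fB]_v psi k v)%R @[k --> \oo] -->
    (\int[spm hE fD]_v expR (- t * pos v))%R - (\int[spm hE fB]_v expR (- t * pos v))%R.
  by apply: cvgB; exact: cv.
apply: (cvgr_to_ge c); apply: nearW => k.
have iq f : spm_integrable hE (fun v => shift_inv (al k) v ^+ n k) f.
  apply: (@bounded_spm_integrable _ _ _ hE _ _ ((al k)^-1 ^+ n k)).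
    by apply: measurable_funX; exact: measurable_shift_inv.
  move=> v; rewrite ger0_norm ?exprn_ge0 ?(ltW (shift_inv_gt0 (al0 k) v))//.
  apply: lerXn2r; rewrite ?nnegrE ?(ltW (shift_inv_gt0 (al0 k) v)) ?invr_ge0 ?(ltW (al0 k))//.
  by rewrite /shift_inv lef_pV2 ?posrE// ?lerDr ?pos_ge0// ltr_wpDl// pos_ge0.
have scale f : (\int[spm hE f]_v psi k v)%R =
    al k ^+ n k * (\int[spm hE f]_v (shift_inv (al k) v ^+ n k))%R.
  rewrite -RintegralZl//; last exact: iq.
  by apply: eq_Rintegral => v _; exact: psiE.
rewrite !scale -mulrBr mulr_ge0 ?exprn_ge0 ?(ltW (al0 k))//.
exact: shift_inv_pow_ge0.
Qed.

Let H f (t : R) : \bar R := (\int[spm hE f]_v (expR (- t * pos v))%:E)%E.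

Let mH f : measurable_fun setT (H f).
Proof. by apply: measurable_laplace; exact: measurable_pos. Qed.

Let H_ge0 f t : (0 <= H f t)%E.
Proof. by apply: integral_ge0 => v _; rewrite lee_fin expR_ge0. Qed.

Let heat_kernel_H t : 0 <= t -> (H fD t = 4%:E * (heat_kernel t)%:E + H fB t)%E.
Proof.
move=> t0; have fin f : H f t \is a fin_num.
  apply: (integrable_fin_num measurableT).
  by apply: (bounded_spm_integrable hE _ (@mexp t)) => v; exact: exp_bd.
rewrite -(fineK (fin fD)) -(fineK (fin fB)) heat_kernelE -EFinM -EFinD.
by congr EFin; rewrite mulrA mulfV// mul1r subrK.
Qed.

Lemma measurable_heat_kernel : measurable_fun setT heat_kernel.
Proof.
rewrite (_ : heat_kernel = fun t => 4^-1 * (fine (H fD t) - fine (H fB t))) //.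
apply: measurable_funM => //; apply: measurable_funB; exact: measurableT_comp.
Qed.

Lemma heat_kernel_laplace alpha : 0 < alpha ->
  (\int[lebesgue_measure]_(t in `[0%R, +oo[) (expR (- t * alpha) * heat_kernel t)%:E =
   (resolvent b alpha (dl y) x)%:E)%E.
Proof.
move=> al0; set I := (\int[_]_(_ in _) _)%E.
have laplace s : (\int[lebesgue_measure]_(t in `[0%R, +oo[)
    ((expR (- t * alpha))%:E * H (resolvent_comb alpha s 0) t) =
    (dot (resolvent_comb alpha s 0) (resolvent_comb alpha s 1))%:E)%E.
  rewrite /H laplace_transform ?resolvent_comb_inv//; [exact: measurable_pos|exact: pos_ge0].
have mexp' : measurable_fun setT (fun t : R => (expR (- t * alpha))%:E).
  by apply/measurable_EFinP; apply: measurableT_comp => //; exact: measurable_funM.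
have mk : measurable_fun setT (fun t : R => (expR (- t * alpha) * heat_kernel t)%:E).
  apply/measurable_EFinP; apply: measurable_funM; first by apply/measurable_EFinP.
  exact: measurable_heat_kernel.
have k0 t : `[0%R, +oo[%classic t -> (0 <= (expR (- t * alpha) * heat_kernel t)%:E)%E.
  by rewrite /= in_itv/= andbT => t0; rewrite lee_fin mulr_ge0 ?expR_ge0 ?heat_kernel_ge0.
have I0 : (0 <= I)%E by apply: integral_ge0 => t; exact: k0.
(* Integrating [heat_kernel_H] against [e^(- alpha t)]: all integrands are nonnegative, which is
   where [heat_kernel_ge0] enters. *)
have main : ((dot (resolvent_comb alpha 1 0) (resolvent_comb alpha 1 1))%:E =
    4%:E * I + (dot (resolvent_comb alpha (-1) 0) (resolvent_comb alpha (-1) 1))%:E)%E.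
  rewrite -!laplace fDE fBE /I -ge0_integralZl//; last exact: measurable_funTS.
  rewrite -ge0_integralD//; last 4 first.
  - by move=> t /k0 ?; rewrite mule_ge0.
  - by apply: measurable_funTS; exact: measurable_funeM.
  - by move=> t _; apply: mule_ge0; [rewrite lee_fin expR_ge0|exact: H_ge0].
  - apply: measurable_funTS; exact: (emeasurable_funM mexp' (mH fB)).
  apply: eq_integral => t /set_mem; rewrite /= in_itv/= andbT => t0.
  by rewrite heat_kernel_H// muleDr ?ge0_adde_def ?inE ?mule_ge0 ?lee_fin ?heat_kernel_ge0//
    muleCA -EFinM.
have Rx := resolvent_iter_ge0_summable 0 x al0; have Ry := resolvent_iter_ge0_summable 0 y al0.
have xs2 := resolvent_iter_sq_summable 1 x al0; have ys2 := resolvent_iter_sq_summable 1 y al0.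
have dx := @delta_sq_summable R V x; have dy := @delta_sq_summable R V y.
(* Symmetry of the operator on the two resolvents; the terms with factor [alpha] cancel. *)
have sym : resolvent b alpha (dl y) x = resolvent b alpha (dl x) y.
  have := dirichlet_operator_sym bG (resolvent_operator bG al0 Rx.1 Rx.2)
    (resolvent_operator bG al0 Ry.1 Ry.2).
  rewrite !dotBl//; try exact: sq_summableZ.
  rewrite !dotZl (dotC (resolvent b alpha (resolvent_iter alpha 0 y))) => /addIr.
  by rewrite dotC dot_delta [RHS]dotC dot_delta.
have dE s : dot (resolvent_comb alpha s 0) (resolvent_comb alpha s 1) =
   s ^+ 2 * resolvent b alpha (dl y) y + 2 * (s * resolvent b alpha (dl y) x) +
   resolvent b alpha (dl x) x.
  have cs := resolvent_comb_sq_summable s 1 al0.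
  rewrite (dotDl (sq_summableZ s dy) dx cs) dotZl.
  rewrite !(dotDr (sq_summableZ s ys2) xs2)// !dotZr.
  rewrite !(dotC (dl _)) !dot_delta /= -sym; ring.
(* The two squares differ by 4 times the resolvent entry, and their finiteness rules out
   [I = +oo]. *)
move: main; rewrite !dE sqrrN expr1n -/I; case: I I0 => [i||]//= i0.
  by rewrite -EFinM -EFinD => -[H4]; congr EFin; lra.
by rewrite mulry gtr0_sg// mul1e.
Qed.

(** Because the heat kernel is nonnegative, the damped integrands increase to it as [j] grows. *)
Lemma integral_heat_kernel :
  ((resolvent b j.+1%:R^-1 (dl y) x)%:E @[j --> \oo] -->
   \int[lebesgue_measure]_(t in `[0%R, +oo[) (heat_kernel t)%:E)%E.
Proof.
have a0 j : 0 < j.+1%:R^-1 :> R by rewrite invr_gt0.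
under eq_fun => j do rewrite -(heat_kernel_laplace (a0 j)).
have cv t : (expR (- t * j.+1%:R^-1) * heat_kernel t)%:E @[j --> \oo] --> (heat_kernel t)%:E.
  apply: cvg_EFin; first exact: nearW.
  rewrite -[X in _ --> X]mul1r; apply: cvgM; last exact: cvg_cst.
  rewrite -[X in _ --> X]expR0 -(mulr0 (- t)).
  apply: (@cvg_comp _ _ _ (fun j => - t * j.+1%:R^-1) expR _ (nbhs (- t * 0))).
    by apply: cvgM; [exact: cvg_cst|exact: cvg_harmonic].
  exact: continuous_expR.
have -> : (\int[lebesgue_measure]_(t in `[0%R, +oo[) (heat_kernel t)%:E =
    \int[lebesgue_measure]_(t in `[0%R, +oo[) limn (fun j => (expR (- t * j.+1%:R^-1) * heat_kernel t)%:E))%E.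
  by apply: eq_integral => t _; apply/esym/cvg_lim => //; exact: cv.
apply: cvg_monotone_convergence => //.
- move=> j; apply: measurable_funTS; apply/measurable_EFinP; apply: measurable_funM.
    by apply: measurableT_comp => //; exact: measurable_funM.
  exact: measurable_heat_kernel.
- move=> j t; rewrite /= in_itv/= andbT => t0.
  by rewrite lee_fin mulr_ge0 ?expR_ge0 ?heat_kernel_ge0.
- move=> t; rewrite /= in_itv/= andbT => t0 i j ij.
  rewrite lee_fin ler_wpM2r ?heat_kernel_ge0// ler_expR !mulNr lerN2 ler_wpM2l//.
  by rewrite lef_pV2 ?posrE// ler_nat.
Qed.

Lemma green_heat_kernel : green (fun=> 1) E x y =
  (\int[lebesgue_measure]_(t in `[0%R, +oo[) (heat_kernel t)%:E)%E.
Proof.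
apply: eq_integral => t /set_mem; rewrite /= in_itv/= andbT => t0.
by rewrite (semigroupE hEA A_ge0).
Qed.

End HeatKernel.

(** Some vertex differs from [x], and the first edge of a path towards it already contributes a
    positive weight. *)
Lemma connected_vdeg_gt0 (R : realType) (V : countType) (b : V -> V -> R) :
  infinite_set [set: V] -> weighted_graph b (fun=> 0) -> graph_connected b ->
  forall x, 0 < vdeg b x.
Proof.
move=> Vinf bG conn x; have [z zx] : exists z, z != x.
  apply: contrapT => H; apply: Vinf; apply: (@sub_finite_set _ _ [set x]); last exact: finite_set1.
  by move=> z _ /=; apply: contrapT => zx; apply: H; exists z; exact/eqP.
have [[|u p] /= xp zE] := conn x z; first by rewrite zE eqxx in zx.
move: xp => /andP[xu _]; apply: (lt_le_trans xu).
rewrite (vdegE bG); apply: ler_rsum1; first exact: b_summable.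
exact: (graph_b_ge0 bG).
Qed.

Theorem theorem3p4 (R : realType) (V : countType) (b : V -> V -> R)
    (V_infinite : infinite_set [set: V])
    (b_graph : weighted_graph b (fun=> 0))
    (b_connected : graph_connected b)
    (E : set R -> (V -> R) -> V -> R)
    (E_spectral : spectral_measure_of (fun=> 1) E
                    (dirichlet_operator b (fun=> 0) (fun=> 1)))
    (x y : V) :
  green (fun=> 1) E x y =
    (((degree b (fun=> 0%R) y)^-1)%:E *
     \sum_(0 <= n <oo) matrix_power (transition b (fun=> 0%R)) n x y)%E.
Proof.
have d0 := connected_vdeg_gt0 V_infinite b_graph b_connected.
rewrite (green_heat_kernel b_graph E_spectral).
(* Both sides are limits of the same sequence of resolvent entries, at [alpha = j.+1^-1]. *)
have c1 := @integral_heat_kernel _ _ _ b_graph _ E_spectral x y.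
have c2 := @resolvent_green _ _ _ b_graph d0 x y.
by rewrite -(cvg_lim _ c1)// (cvg_lim _ c2).
Qed.
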